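(* Let $G$ be a subcubic planar multigraph with edge multiplicity at most two. Then $\chi'_{2\text{-int}}(G) \le 5$; that is, $G$ has a 2-intersection edge-coloring using at most $5$ colors.
   Context: All multigraphs are finite and loopless. A multigraph is subcubic if its maximum degree is at most three (degrees counted with multiplicity). Edge multiplicity at most two means that any two vertices are joined by at most two parallel edges. A proper edge-coloring of a multigraph is an assignment of colors to edges such that any two distinct edges sharing an endpoint (including parallel edges) receive distinct colors. Given an edge-coloring, for each vertex $v$ let $S_v$ be the set of colors used on the edges incident to $v$. For a positive integer $k$ and a multigraph of edge multiplicity at most $k$, a $k$-intersection edge-coloring is a proper edge-coloring such that $|S_u\cap S_v|\le k$ for all adjacent vertices $u,v$. The $k$-intersection chromatic index $\chi'_{k\text{-int}}(G)$ is the minimum $t$ such that $G$ has a $k$-intersection edge-coloring using $t$ colors. *)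

(* Defs.v *)
From HB Require Import structures.
From mathcomp Require Import all_boot all_order all_algebra.
From mathcomp Require Import all_classical all_reals all_analysis.
Import numFieldNormedType.Exports.

Set Implicit Arguments.
Unset Strict Implicit.
Unset Printing Implicit Defensive.

Import Order.TTheory GRing.Theory Num.Theory.

(* Finite multigraph; parallel edges are distinct elements of [edge] with the
   same set of ends, and looplessness is the requirement of two ends. *)
Record multigraph := Multigraph {
  vertex : finType;
  edge : finType;
  ends : edge -> {set vertex};
  card_ends : forall e, #|ends e| = 2
}.

Section Multigraph.
Variable G : multigraph.
Implicit Types (u v : vertex G) (e f : edge G).

Definition incident v : {set edge G} := [set e | v \in ends e]%SET.

Definition degree v : nat := #|incident v|.

Definition max_degree : nat := \max_(v : vertex G) degree v.

Definition subcubic : Prop := max_degree <= 3.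

Definition parallel_class u v : {set edge G} :=
  [set e | ends e == [set u; v]%SET]%SET.

Definition multiplicity_le (k : nat) : Prop :=
  forall u v, #|parallel_class u v| <= k.

Definition adjacent u v : bool :=
  [exists e, ends e == [set u; v]%SET].

Section Coloring.
Variables (C : finType) (c : edge G -> C).

Definition proper_edge_coloring : bool :=
  [forall e, forall f, (e != f) ==> ~~ [disjoint ends e & ends f] ==>
     (c e != c f)].

Definition colors_at v : {set C} := (c @: incident v)%SET.

Definition kint_edge_coloring (k : nat) : bool :=
  proper_edge_coloring &&
  [forall u, forall v,
     adjacent u v ==> (#|(colors_at u :&: colors_at v)%SET| <= k)].

End Coloring.

Definition kint_edge_colorable (k t : nat) : bool :=
  [exists c : {ffun edge G -> 'I_t}, kint_edge_coloring c k].

Lemma kint_edge_colorable_ex (k : nat) :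
  multiplicity_le k -> exists t, kint_edge_colorable k t.
Proof.
move=> Gk; exists #|edge G|; apply/existsP; exists [ffun e => enum_rank e].
apply/andP; split.
  apply/forallP => e; apply/forallP => f; apply/implyP => nef.
  by apply/implyP => _; rewrite !ffunE (inj_eq enum_rank_inj).
apply/forallP => u; apply/forallP => v; apply/implyP.
case/existsP=> e0 /eqP e0uv; have := card_ends e0; rewrite e0uv cards2 => uv.
apply: leq_trans (Gk u v).
have <- := card_imset (parallel_class u v) (@enum_rank_inj (edge G)).
apply: subset_leq_card; apply/fintype.subsetP => x.
rewrite inE => /andP[/imsetP[e eu ->] /imsetP[f fv]].
rewrite !ffunE => /enum_rank_inj ef; apply: imset_f.
move: eu fv; rewrite -ef !inE => eu ev; rewrite eq_sym eqEcard card_ends.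
by rewrite cards2 uv leqnn andbT; apply/fintype.subsetP => w; rewrite !inE => /pred2P[]->.
Qed.

(* Defined, as usual, only when the multiplicity is at most [k]: otherwise no
   such coloring exists. *)
Definition kint_chromatic_index (k : nat) (Gk : multiplicity_le k) : nat :=
  ex_minn (kint_edge_colorable_ex Gk).

End Multigraph.

Arguments max_degree : clear implicits.
Arguments subcubic : clear implicits.
Arguments multiplicity_le : clear implicits.
Arguments kint_edge_colorable : clear implicits.
Arguments kint_chromatic_index G k Gk : clear implicits.

Lemma kint_chromatic_index_le (G : multigraph) (k t : nat)
    (Gk : multiplicity_le G k) :
  kint_chromatic_index G k Gk <= t <->
  exists c : edge G -> 'I_t, kint_edge_coloring c k.
Proof.
rewrite /kint_chromatic_index; case: ex_minnP => m /existsP[c cP] mmin; split.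
  move=> le_mt; exists (widen_ord le_mt \o c).
  have wI : injective (widen_ord le_mt) by move=> i j [] /val_inj.
  case/andP: cP => cp ci; apply/andP; split.
    apply/forallP => e; apply/forallP => f; rewrite (inj_eq wI).
    by move/forallP/(_ e)/forallP: cp; apply.
  apply/forallP => u; apply/forallP => v.
  move/forallP/(_ u)/forallP/(_ v): ci; rewrite /colors_at !imset_comp.
  rewrite -(imsetI (f := widen_ord le_mt)) ?(card_imset _ wI) //.
  by move=> x y _ _ /wI.
case=> d dP; apply: mmin; apply/existsP; exists [ffun e => d e].
have dE : [ffun e => d e] =1 d by move=> e; rewrite ffunE.
case/andP: dP => dp di; apply/andP; split.
  apply/forallP => e; apply/forallP => f; rewrite !dE.
  by move/forallP/(_ e)/forallP: dp; apply.
apply/forallP => u; apply/forallP => v.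
by rewrite /colors_at !(eq_imset _ dE); move/forallP/(_ u)/forallP: di; apply.
Qed.

Local Open Scope classical_set_scope.
Local Open Scope ring_scope.

(* [earc e] is a parametrization by [0, 1]; its values elsewhere are junk.
   Arcs may only meet at common ends, i.e. at parameters 0 and 1. *)
Record plane_drawing (R : realType) (G : multigraph) := PlaneDrawing {
  vpoint : vertex G -> (R * R)%type;
  earc : edge G -> R -> (R * R)%type;
  point_inj : injective vpoint;
  arc_continuous :
    forall e, {within `[0, 1], continuous (earc e)};
  arc_inj : forall e, {in `[0, 1] &, injective (earc e)};
  arc_ends : forall e,
    [set earc e 0; earc e 1] = vpoint @` [set` ends e];
  arc_avoids_points : forall e v (t : R),
    t \in `]0, 1[ -> earc e t <> vpoint v;
  arc_avoids_arcs : forall e f (s t : R), e <> f ->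
    s \in `]0, 1[ -> t \in `[0, 1] -> earc e s <> earc f t
}.

Definition planar (R : realType) (G : multigraph) : Prop :=
  inhabited (plane_drawing R G).

(* Main.v *)
(** Two adjacent palettes meet in at most two colors unless both have size three
    and are equal, so we look for a proper coloring, with four colors [Some z] and
    a fifth color [None], in which adjacent cubic vertices have distinct palettes.

    If a connected component has a root of degree at most two, delete the root
    and recurse at one of its neighbors.  To make the induction work, half-edges
    are allowed: a half-edge colored [None] may be prescribed at any set X of
    vertices of degree at most two, and the root receives a half-edge of some
    color [Some z], which can moreover be chosen in two ways unless [None] occurs
    at the root.

    A cubic component A has a largest connected induced part D whose complement W
    contains a cycle, and maximality forces W to be an induced cycle in which
    each vertex sends one edge, its spoke, to D.  Give color [None] to all spokes
    but the one of some v0 in W, color D by the previous case with root the foot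
    of that spoke, and color the path W - v0 with the four other colors; the
    possible pairs of colors at its two extremities are a reachability problem
    for a finite automaton.  This requires that the spokes other than that of v0
    have distinct feet.  Otherwise A is K4, or W is a 4-cycle attached to only
    two vertices of D, and explicit colorings exist. *)

Require Import Defs.
From mathcomp Require Import all_boot perm zify.

Set Implicit Arguments.
Unset Strict Implicit.
Unset Printing Implicit Defensive.

(** * Color pairs along a path *)

(** The count of five comes from one observation: two colors complete to a given palette by at most
    one third color. A new vertex with two colors fixed and two neighbors to be distinguished thus
    excludes at most 2 + 2 colors. This greedy step needs a vertex of degree at most two, which a
    cubic component lacks; the induced cycle is where the process is closed up instead. Color [None]
    on the spokes decouples the cycle from the rest. Every cycle vertex but v0 has [None] in its
    palette and v0 has not, so v0 never clashes with its cycle neighbors. A foot clashes with its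
    cycle vertex only if its palette is [None] with one particular pair, so each vertex of the path
    has a single forbidden pair. What remains is the clash between v0 and its own foot, and the
    requirement that the spoke of v0 differ in color from its two cycle edges. If [None] occurs at
    that foot, the first cannot happen; if not, the second admissible color of the spoke resolves a
    coincidence with a cycle edge. *)

Definition quad := (bool * bool)%type.
Definition quads : seq quad :=
  [:: (false, false); (false, true); (true, false); (true, true)].

Lemma mem_quads q : q \in quads.
Proof. by case: q => [[] []]. Qed.

Definition allowed (F : quad * quad) (x y : quad) : bool :=
  [&& x != y, (x, y) != F & (y, x) != F].

(* Each vertex u of a path carries a [None] spoke and two [Some] colors, the pair
   of which must avoid the forbidden pair F u.  [reach a Fs (x, y)] says that the
   path with forbidden pairs Fs can be colored so that the half-edge at its last
   vertex has color a and that the two colors at its first vertex are x, on the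
   edge to the next vertex, and y, on the half-edge.  Consecutive vertices share
   one color, so their palettes differ exactly when [s.2 != x]. *)
Fixpoint reach (a : quad) (Fs : seq (quad * quad)) (s : quad * quad) : bool :=
  match Fs with
  | [::] => false
  | [:: F] => (s.1 == a) && allowed F s.1 s.2
  | F :: Fs' =>
    has (fun x => [&& reach a Fs' (x, s.1), s.2 != x & allowed F s.1 s.2]) quads
  end.

Definition states : seq (quad * quad) :=
  [seq (x, y) | x <- quads, y <- [seq y <- quads | y != x]].

(** When a vertex is put in front of the path, the half-edge color [s.2] becomes the color of the
    new edge and [z] that of the new half-edge, so the next state is [(s.2, z)]. *)
Definition succs (F s : quad * quad) : seq quad :=
  [seq z <- quads | (z != s.1) && allowed F s.2 z].

(* Reachable sets are bounded from below by two facts: there are always two linked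
   reachable states, and the states reachable from one of two distinct values of a
   never all agree on a component. *)
Definition linked (s t : quad * quad) : bool :=
  (s != t) && ((s.1 == t.1) || (s.2 == t.2)).

Definition unlinked (P : pred (quad * quad)) : bool :=
  let l := filter P states in all (fun s => all (fun t => ~~ linked s t) l) l.

Definition sync (P P' : pred (quad * quad)) : bool :=
  let l := filter (predU P P') states in
  has (fun x => all (fun s => s.2 == x) l || all (fun s => s.1 == x) l) quads.

(** The weakest precondition of [P] for one more vertex with forbidden pair [F]. *)
Definition before (F : quad * quad) (P : pred (quad * quad)) : pred (quad * quad) :=
  fun s => all (fun z => P (s.2, z)) (succs F s).

Lemma reach_cons a F F' Fs s :
  reach a (F :: F' :: Fs) s =
  has (fun x => [&& reach a (F' :: Fs) (x, s.1), s.2 != x & allowed F s.1 s.2]) quads.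
Proof. by []. Qed.

Lemma reach_states a Fs s : reach a Fs s -> s \in states.
Proof.
have st x y : x != y -> (x, y) \in states by case: x y => [[] []] [[] []].
case: s => x y; case: Fs => [|F [|F' Fs]] //=; first by case/and3P => _ /st.
by rewrite !orbF => /or4P[] /and3P[_ _ /and3P[/st]].
Qed.

Lemma reach_step a F Fs s z :
  Fs != [::] -> reach a Fs s -> z \in succs F s -> reach a (F :: Fs) (s.2, z).
Proof.
case: Fs => // F' Fs _; case: s => x y r; rewrite mem_filter => /andP[/andP[zx al] _].
by rewrite reach_cons; apply/hasP; exists x; [exact: mem_quads | apply/and3P].
Qed.

Lemma reach_before a F Fs (P : pred (quad * quad)) :
  Fs != [::] -> (forall s, reach a (F :: Fs) s -> P s) ->
  forall s, reach a Fs s -> before F P s.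
Proof. by move=> nF h s rs; apply/allP => z zs; apply/h/reach_step. Qed.

(** One orientation per unordered pair suffices, since [allowed] does not depend on the orientation
    of [F]. *)
Definition doubletons : seq (quad * quad) :=
  let: (a, b, c, d) := ((false, false), (false, true), (true, false), (true, true)) in
  [:: (a, b); (a, c); (a, d); (b, c); (b, d); (c, d)].

(** A linked pair yields the next one in one of three ways: one successor of each state, or two
    successors of a single state. *)
Definition linked_step_check : bool :=
  all (fun F => all (fun s => all (fun t => linked s t ==>
    has (fun z => has (fun z' =>
      [|| linked (s.2, z) (t.2, z') && (z \in succs F s) && (z' \in succs F t),
          linked (s.2, z) (s.2, z') && (z \in succs F s) && (z' \in succs F s)
        | linked (t.2, z) (t.2, z') && (z \in succs F t) && (z' \in succs F t)])
       quads) quads) states) states) doubletons.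

Lemma linked_step_checkE : linked_step_check.
Proof. by vm_compute. Qed.

Lemma reach_linked a Fs : all [in doubletons] Fs -> Fs != [::] ->
  exists s t, [/\ reach a Fs s, reach a Fs t & linked s t].
Proof.
elim: Fs => // F [|F' Fs] IH /andP[Fd Fsd] _.
  have: all (fun F => all (fun a => has (fun y => has (fun y' =>
    [&& allowed F a y, allowed F a y' & y != y']) quads) quads) quads) doubletons
    by vm_compute.
  move=> /allP/(_ F Fd)/allP/(_ a (mem_quads a)).
  case/hasP => y _ /hasP[y' _ /and3P[h h' yy]].
  exists (a, y), (a, y'); rewrite /= eqxx h h' /linked eqxx /= andbT.
  by split => //; apply: contra yy => /eqP[->].
have [//|//|s [t [rs rt l]]] := IH.
have /allP/(_ F Fd)/allP := linked_step_checkE.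
move=> /(_ s (reach_states rs))/allP/(_ t (reach_states rt))/implyP/(_ l).
case/hasP => z _ /hasP[z' _ /or3P[] /andP[/andP[ll zs] zs']].
- by exists (s.2, z), (t.2, z'); split=> //; apply: reach_step.
- by exists (s.2, z), (s.2, z'); split=> //; apply: reach_step.
- by exists (t.2, z), (t.2, z'); split=> //; apply: reach_step.
Qed.

Lemma reach_unlinked a Fs (P : pred (quad * quad)) : all [in doubletons] Fs -> Fs != [::] ->
  unlinked P -> (forall s, reach a Fs s -> P s) -> False.
Proof.
move=> Fsd nF u h; have [s [t [rs rt l]]] := reach_linked a Fsd nF.
have inl r : reach a Fs r -> r \in [seq r <- states | P r].
  by move=> rr; rewrite mem_filter h ?(reach_states rr).
by move: u => /allP/(_ s (inl s rs))/allP/(_ t (inl t rt)); rewrite l.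
Qed.

(** Agreement in a component would propagate to the last vertex of the path. The first component of
    a state is the second component of its predecessor; and if all successors of a state equal x,
    then its first component is determined by x and [F]. At the last vertex both [a] and [a'] are
    first components, and [a] admits two half-edge colors, so neither component is constant. *)
Lemma reach_sync a a' Fs (P P' : pred (quad * quad)) : a != a' ->
  all [in doubletons] Fs -> Fs != [::] ->
  sync P P' -> (forall s, reach a Fs s -> P s) -> (forall s, reach a' Fs s -> P' s) ->
  False.
Proof.
move=> aa Fsd nF sy hP hP'.
suff key x : (forall s, reach a Fs s || reach a' Fs s -> s.2 = x) \/
  (forall s, reach a Fs s || reach a' Fs s -> s.1 = x) -> False.
  case/hasP: sy => x _ /orP[] /allP h; apply: (key x); [left|right] => s rs;
    apply/eqP/h; rewrite mem_filter /=;
    by case/orP: rs => rs; rewrite ?(hP _ rs) ?(hP' _ rs) ?orbT (reach_states rs).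
elim: Fs Fsd nF x {hP hP'} => // F [|F' Fs] IH /andP[Fd Fsd] _ x.
  case=> h.
    have /allP/(_ F Fd)/allP/(_ a (mem_quads a)):
      all (fun F => all (fun a => has (fun y => has (fun y' =>
      [&& allowed F a y, allowed F a y' & y != y']) quads) quads) quads) doubletons
      by vm_compute.
    case/hasP => y _ /hasP[y' _ /and3P[hy hy' /eqP[]]].
    have /= := h (a, y); rewrite eqxx hy /= => ->; last by [].
    by have /= := h (a, y'); rewrite eqxx hy' /= => ->.
  have ex b : exists y, allowed F b y.
    have /allP/(_ F Fd)/allP/(_ b (mem_quads b))/hasP[y _ hy]:
      all (fun F => all (fun a => has (fun y => allowed F a y) quads) quads) doubletons
      by vm_compute.
    by exists y.
  have [y hy] := ex a; have [y' hy'] := ex a'.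
  have /= := h (a, y); rewrite eqxx hy /= => /(_ isT) ax.
  have /= := h (a', y'); rewrite eqxx hy' orbT /= => /(_ isT) ax'.
  by rewrite ax ax' eqxx in aa.
have stp s z : reach a (F' :: Fs) s || reach a' (F' :: Fs) s -> z \in succs F s ->
  reach a (F :: F' :: Fs) (s.2, z) || reach a' (F :: F' :: Fs) (s.2, z).
  by case/orP => rs zs; rewrite (@reach_step _ F (F' :: Fs) s z isT rs zs) ?orbT.
have sst s : reach a (F' :: Fs) s || reach a' (F' :: Fs) s -> s \in states.
  by case/orP => /reach_states.
case=> h.
  have /allP/(_ F Fd)/allP/(_ x (mem_quads x))/hasP[w _ /allP hw]:
    all (fun F => all (fun x => has (fun w => all (fun s =>
      all (fun z => z == x) (succs F s) ==> (s.1 == w)) states) quads) quads) doubletons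
    by vm_compute.
  apply: (IH Fsd isT w); right=> s rs; apply/eqP; move/implyP: (hw s (sst s rs)); apply.
  by apply/allP => z zs; apply/eqP/(h _ (stp s z rs zs)).
apply: (IH Fsd isT x); left => s rs.
have /allP/(_ F Fd)/allP/(_ s (sst s rs)):
  all (fun F => all (fun s => succs F s != [::]) states) doubletons by vm_compute.
case E: (succs F s) => [//|z ?] _.
by apply: (h _ (stp s z rs _)); rewrite E mem_head.
Qed.

(* If no reachable state were accepted, then the states reached one step earlier
   would all be bad, and those reached two steps earlier would satisfy
   [before F' bad]; the check refutes this by means of [unlinked] and [sync]. *)
Definition closing_check (acc : rel quad) : bool :=
  let bad F a s := all (fun z => ~~ acc a z) (succs F s) in
  all (fun F =>
    has (fun a => has (fun y => allowed F a y && acc a y) quads) quads &&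
    if has (fun a => unlinked (bad F a)) quads then true else
    has (fun a => has (fun a' =>
      if (a == a') || has (fun s => bad F a s && (s.1 == a)) states then false else
      all (fun F' => if unlinked (before F' (bad F a)) then true else
        if unlinked (before F' (bad F a')) then true else
          sync (before F' (bad F a)) (before F' (bad F a'))) doubletons) quads) quads)
  doubletons.

Lemma reach_closing acc Fs : closing_check acc ->
  all [in doubletons] Fs -> Fs != [::] ->
  exists a s, reach a Fs s && acc a s.2.
Proof.
move=> /allP ck; case: Fs => // F Fs /andP[Fd Fsd] _.
have /andP[ck1 ck2] := ck F Fd.
case: Fs Fsd => [_|F' Fs Fsd].
  case/hasP: ck1 => a _ /hasP[y _ /andP[al ay]].
  by exists a, (a, y); rewrite /= eqxx al.
suff: [exists a, exists s, reach a (F :: F' :: Fs) s && acc a s.2].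
  by case/existsP => a /existsP[s h]; exists a, s.
apply: contraT; rewrite negb_exists => /forallP h.
have {h} nacc a s : reach a (F :: F' :: Fs) s -> ~~ acc a s.2.
  by move=> rs; have := h a; rewrite negb_exists => /forallP/(_ s); rewrite rs.
have bad a s : reach a (F' :: Fs) s -> all (fun z => ~~ acc a z) (succs F s).
  by move=> rs; apply/allP => z zs; apply: (nacc a (s.2, z)); apply: reach_step.
case: ifP ck2 => [/hasP[a _ u] _|_ /hasP[a _ /hasP[a' _]]].
  by case: (@reach_unlinked a (F' :: Fs) _ Fsd isT u (bad a)).
case: ifPn => //; rewrite negb_or => /andP[aa hd] /allP ck2.
case/andP: Fsd => F'd; case: Fs bad {nacc} => [|F2 Fs] bad Fsd.
  (* All states of a path with one vertex have first component [a], and the check has excluded bad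
     states of this kind. *)
  have [|s [t [rs _ _]]] := @reach_linked a [:: F'] _ isT; first by rewrite /= F'd.
  case/negP: hd; apply/hasP; exists s; rewrite ?(reach_states rs) // bad //=.
  by case/andP: rs.
have {}Fsd : all [in doubletons] (F2 :: Fs) by [].
have ba b := reach_before (isT : F2 :: Fs != [::]) (@bad b).
case: ifP (ck2 F' F'd) => [u _|_].
  by case: (reach_unlinked Fsd (isT : F2 :: Fs != [::]) u (ba a)).
case: ifP => [u _|_ sy].
  by case: (reach_unlinked Fsd (isT : F2 :: Fs != [::]) u (ba a')).
by case: (reach_sync aa Fsd (isT : F2 :: Fs != [::]) sy (ba a) (ba a')).
Qed.

(** Here [z] is the color of the spoke of v0, and [a], [s.2] are those of its two cycle edges. *)
Lemma reach_avoiding z Fs : all [in doubletons] Fs -> Fs != [::] ->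
  exists a s, reach a Fs s && [&& a != z, s.2 != z & a != s.2].
Proof.
apply: (@reach_closing (fun a y => [&& a != z, y != z & a != y])).
suff /allP/(_ z (mem_quads z)) : all (fun z => closing_check
  (fun a y => [&& a != z, y != z & a != y])) quads by [].
by vm_compute.
Qed.

(** Here [F] is the pair of colors at the foot of v0 inside D. Since only one of the two cycle
    colors at v0 lies in [F], they do not form this pair, and a spoke color outside [F] can coincide
    only with the other one. *)
Lemma reach_separated F Fs : F \in doubletons ->
  all [in doubletons] Fs -> Fs != [::] ->
  exists a s, reach a Fs s &&
    ((a \in [:: F.1; F.2]) != (s.2 \in [:: F.1; F.2])).
Proof.
move=> Fd.
apply: (@reach_closing (fun a y => (a \in [:: F.1; F.2]) != (y \in [:: F.1; F.2]))).
suff /allP/(_ F Fd) : all (fun F => closing_check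
  (fun a y => (a \in [:: F.1; F.2]) != (y \in [:: F.1; F.2]))) doubletons by [].
by vm_compute.
Qed.

(** * Colorings of induced subgraphs with half-edges *)

Notation color := (option quad).

Section Colorings.
Variable G : multigraph.
Implicit Types (u v r : vertex G) (e f : edge G) (A B : {set vertex G}).
Implicit Types (h : vertex G -> {set color}) (c k : edge G -> color).

Definition within A v : {set edge G} :=
  [set e | (v \in ends e) && (ends e \subset A)].

Definition palette A h c v : {set color} := c @: within A v :|: h v.

(* [c] colors the subgraph induced by A, and [h v] is the set of colors of the
   half-edges at v. *)
Definition valid A h c : Prop :=
  (forall v, v \in A -> {in within A v &, injective c} /\
                        [disjoint c @: within A v & h v]) /\
  (forall u v, u \in A -> v \in A -> adjacent u v ->
     #|palette A h c u| = 3 -> palette A h c u != palette A h c v).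

Lemma adjacentP u v : reflect (exists e, ends e = [set u; v]) (adjacent u v).
Proof. by apply: (iffP existsP) => -[e /eqP]; exists e => //; apply/eqP. Qed.

Lemma adjacent_sym u v : adjacent u v = adjacent v u.
Proof. by apply: eq_existsb => e; rewrite setUC. Qed.

Lemma adjacent_neq u v : adjacent u v -> u != v.
Proof. by case/adjacentP => e Ee; have := card_ends e; rewrite Ee cards2; case: eqP. Qed.

Lemma within_sub A v e : e \in within A v -> v \in A.
Proof. by rewrite inE => /andP[ve /subsetP]; apply. Qed.

Lemma withinS A B v : A \subset B -> within A v \subset within B v.
Proof.
move=> AB; apply/subsetP => e; rewrite !inE => /andP[-> eA].
exact: subset_trans AB.
Qed.

Lemma eq_palette A h h' c c' v : h v = h' v ->
  {in within A v, c =1 c'} -> palette A h c v = palette A h' c' v.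
Proof. by rewrite /palette => -> /eq_in_imset ->. Qed.

Lemma valid_ext A h h' c : {in A, h =1 h'} -> valid A h c -> valid A h' c.
Proof.
move=> hh [V1 V2].
have pal v : v \in A -> palette A h' c v = palette A h c v.
  by move=> vA; apply: eq_palette => //; rewrite hh.
split=> [v vA|u v uA vA uv]; last by rewrite !pal //; apply: V2.
by rewrite -hh //; apply: V1.
Qed.

Lemma glue_at A S h h1 c c1 k v (X := within S v :\: within A v) :
  A \subset S -> {in within A v, c =1 c1} -> {in X, c =1 k} ->
  h1 v = h v :|: k @: X ->
  {in within A v &, injective c1} -> [disjoint c1 @: within A v & h1 v] ->
  {in X &, injective k} -> [disjoint k @: X & h v] ->
  [/\ palette S h c v = palette A h1 c1 v, {in within S v &, injective c} &
      [disjoint c @: within S v & h v]].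
Proof.
move=> AS cc ck hh i1 d1 ik dk.
have WS : within S v = within A v :|: X.
  by rewrite -{1}(setID (within S v) (within A v)) (setIidPr (withinS v AS)).
have im : c @: within S v = c1 @: within A v :|: k @: X.
  by rewrite WS imsetU (eq_in_imset cc) (eq_in_imset ck).
have disj e f : e \in within A v -> f \in X -> c e != c f.
  move=> eA fX; rewrite cc // ck //; apply/eqP => ef.
  move/pred0P/(_ (c1 e)): d1; rewrite /= imset_f //= hh !inE ef imset_f // orbT.
  by [].
split.
- by rewrite /palette im hh -setUA (setUC (k @: X)).
- rewrite WS => e f /setUP[] eX /setUP[] fX ef.
  + by apply: i1; rewrite // -!cc.
  + by move: (disj _ _ eX fX); rewrite ef eqxx.
  + by move: (disj _ _ fX eX); rewrite ef eqxx.
  + by apply: ik; rewrite // -!ck.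
- rewrite im disjoints_subset subUset -!disjoints_subset dk andbT.
  by apply: disjointWr d1; rewrite hh subsetUl.
Qed.

(** Every edge between A and B is cut into two half-edges of the same color, given by [k]. Rejoining
    them preserves all palettes, so only adjacent pairs across the cut need a comparison. *)
Lemma glue A B h h1 c1 c2 k (S := A :|: B) :
  [disjoint A & B] -> valid A h1 c1 -> valid B h1 c2 ->
  {in A, forall v, h1 v = h v :|: k @: (within S v :\: within A v)} ->
  {in B, forall v, h1 v = h v :|: k @: (within S v :\: within B v)} ->
  {in A, forall v, {in within S v :\: within A v &, injective k}} ->
  {in B, forall v, {in within S v :\: within B v &, injective k}} ->
  {in A, forall v, [disjoint k @: (within S v :\: within A v) & h v]} ->
  {in B, forall v, [disjoint k @: (within S v :\: within B v) & h v]} ->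
  (forall u v, u \in A -> v \in B -> adjacent u v -> #|palette A h1 c1 u| = 3 ->
     palette A h1 c1 u != palette B h1 c2 v) ->
  exists c, [/\ valid S h c,
    {in A, forall v, palette S h c v = palette A h1 c1 v} &
    {in B, forall v, palette S h c v = palette B h1 c2 v}].
Proof.
move=> dAB [VA1 VA2] [VB1 VB2] hA hB iA iB dA dB AB.
pose c e := if ends e \subset A then c1 e else if ends e \subset B then c2 e else k e.
have nAB v : v \in A -> v \in B -> False.
  by move=> vA vB; move/pred0P/(_ v): dAB; rewrite /= vA vB.
have gA v : v \in A -> [/\ palette S h c v = palette A h1 c1 v,
    {in within S v &, injective c} & [disjoint c @: within S v & h v]].
  move=> vA; apply: (@glue_at A S h h1 c c1 k v (subsetUl _ _) _ _ (hA v vA)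
    (VA1 v vA).1 (VA1 v vA).2 (iA v vA) (dA v vA)) => e; rewrite !inE /c.
    by case/andP => ve ->.
  case/andP => + /andP[ve _]; rewrite ve /= => /negPf ->.
  by case: ifP => // /subsetP/(_ v ve)/(nAB v vA).
have gB v : v \in B -> [/\ palette S h c v = palette B h1 c2 v,
    {in within S v &, injective c} & [disjoint c @: within S v & h v]].
  move=> vB; apply: (@glue_at B S h h1 c c2 k v (subsetUr _ _) _ _ (hB v vB)
    (VB1 v vB).1 (VB1 v vB).2 (iB v vB) (dB v vB)) => e; rewrite !inE /c.
    case/andP => ve eB; rewrite eB; case: ifP => // /subsetP/(_ v ve) vA.
    by case: (nAB v vA vB).
  case/andP => + /andP[ve _]; rewrite ve /= => /negPf ->.
  by case: ifP => // /subsetP/(_ v ve) /nAB /(_ vB).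
have pA v : v \in A -> palette S h c v = palette A h1 c1 v by case/gA.
have pB v : v \in B -> palette S h c v = palette B h1 c2 v by case/gB.
exists c; split => //; split=> [v /setUP[/gA[]|/gB[]]//|u v].
case/setUP => uS /setUP[] vS uv.
- by rewrite !pA //; apply: VA2.
- by rewrite pA // pB //; apply: AB.
- rewrite pB // pA // => u3; rewrite eq_sym; apply/eqP => E.
  by have:= AB v u vS uS; rewrite adjacent_sym uv E u3 eqxx => /(_ isT erefl).
- by rewrite !pB //; apply: VB2.
Qed.

Lemma within_cross A r v : v != r ->
  within A v :\: within (A :\ r) v = within A v :&: within A r.
Proof.
move=> vr; apply/setP => e; rewrite !inE; case: (v \in _) => //=.
case eA: (_ \subset A) => /=; rewrite ?andbF //= ?andbT.
rewrite subsetD1 eA /= negbK; by [].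
Qed.

Lemma within_set1 r v : within [set r] v = set0.
Proof.
apply/setP => e; rewrite !inE; apply/negP => /andP[_ /subset_leq_card].
by rewrite cards1 card_ends.
Qed.

(** The case of [glue] where one part is the single vertex r, all of whose colors are half-edges. *)
Lemma add_root A r h h1 c k : r \in A -> valid (A :\ r) h1 c ->
  {in A :\ r, forall v, h1 v = h v :|: k @: (within A v :&: within A r)} ->
  {in within A r &, injective k} ->
  {in within A r, forall e, {in ends e, forall v, k e \notin h v}} ->
  {in A :\ r, forall v, adjacent r v -> #|k @: within A r :|: h r| = 3 ->
     k @: within A r :|: h r != palette (A :\ r) h1 c v} ->
  exists c', [/\ valid A h c', palette A h c' r = k @: within A r :|: h r &
    {in A :\ r, forall v, palette A h c' v = palette (A :\ r) h1 c v}].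
Proof.
move=> rA V h1E ik hk rP.
pose h2 v := if v == r then k @: within A r :|: h r else h1 v.
have h12 : {in A :\ r, h1 =1 h2} by move=> v; rewrite !inE /h2 => /andP[/negPf->].
have V2 := valid_ext h12 V.
have AE : A :\ r :|: [set r] = A by rewrite setUC setD1K.
have pr c' : palette [set r] h2 c' r = k @: within A r :|: h r.
  by rewrite /palette within_set1 imset0 set0U /h2 eqxx.
have pD v : v \in A :\ r -> palette (A :\ r) h2 c v = palette (A :\ r) h1 c v.
  by move=> vD; apply: eq_palette => //; rewrite h12.
have [||||||||||c' []] := @glue (A :\ r) [set r] h h2 c c k; rewrite ?AE.
- by rewrite disjoint_sym disjoints1 !inE eqxx.
- exact: V2.
- split=> [v|u v]; first by rewrite within_set1 imset0 disjoints_subset sub0set;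
    split=> // e; rewrite inE.
  by rewrite !inE => /eqP-> /eqP-> /adjacent_neq; rewrite eqxx.
- move=> v vD; rewrite -h12 // h1E // within_cross //.
  by move: vD; rewrite !inE => /andP[].
- move=> v /set1P->; rewrite within_set1 setD0 /h2 eqxx; exact: setUC.
- move=> v; rewrite !inE => /andP[vr vA]; rewrite within_cross // => e f.
  by move=> /setIP[_ er] /setIP[_ fr]; apply: ik.
- by move=> v /set1P->; rewrite within_set1 setD0.
- move=> v; rewrite !inE => /andP[vr vA]; rewrite within_cross //.
  rewrite disjoints_subset; apply/subsetP => _ /imsetP[e /setIP[ev er] ->].
  by rewrite inE; apply: (hk e er); move: ev; rewrite inE => /andP[].
- move=> v /set1P->; rewrite within_set1 setD0.
  rewrite disjoints_subset; apply/subsetP => _ /imsetP[e er ->].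
  by rewrite inE; apply: (hk e er); move: er; rewrite inE => /andP[].
- move=> u v uD /set1P-> ur; rewrite pr pD // => u3; rewrite eq_sym; apply/eqP => E.
  have:= rP u uD; rewrite adjacent_sym ur E u3 eqxx => /(_ isT erefl).
  by [].
- move=> V' pA /(_ r (set11 r)); rewrite pr => pr'; exists c'; split=> // v vD.
  by rewrite pA // pD.
Qed.

Lemma set_half A h c u (H : {set color}) : u \in A -> valid A h c ->
  [disjoint c @: within A u & H] ->
  {in A, forall v, adjacent u v -> #|c @: within A u :|: H| = 3 ->
     c @: within A u :|: H != palette A h c v} ->
  valid A (fun v => if v == u then H else h v) c.
Proof.
move=> uA [V1 V2] dH uP; set h' := fun v => _.
have pu : palette A h' c u = c @: within A u :|: H by rewrite /palette /h' eqxx.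
have pn v : v != u -> palette A h' c v = palette A h c v.
  by move=> /negPf vu; rewrite /palette /h' vu.
split=> [v vA|x y xA yA xy].
  by rewrite /h'; case: eqP => [->|_]; [split=> //; case: (V1 u uA)|apply: V1].
have [xu|xu] := eqVneq x u; have [yu|yu] := eqVneq y u.
- by move: xy; rewrite xu yu => /adjacent_neq; rewrite eqxx.
- by rewrite xu pu pn //; apply: uP; rewrite -?xu.
- rewrite yu pu pn // => x3; rewrite eq_sym; apply/eqP => E.
  by have := uP x xA; rewrite -yu adjacent_sym xy yu E x3 eqxx => /(_ isT erefl).
- by rewrite !pn //; apply: V2.
Qed.

Lemma valid_inj A h c (s : color -> color) : injective s ->
  valid A h c -> valid A (fun v => s @: h v) (s \o c) /\
  forall v, palette A (fun v => s @: h v) (s \o c) v = s @: palette A h c v.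
Proof.
move=> si [V1 V2].
have pal v : palette A (fun v => s @: h v) (s \o c) v = s @: palette A h c v.
  by rewrite /palette imsetU -imset_comp.
split=> //; split=> [v vA|u v uA vA uv]; last first.
  by rewrite !pal card_imset // (inj_eq (imset_inj si)); apply: V2.
have [i d] := V1 v vA; split; first by move=> e f eA fA /si; apply: i.
rewrite imset_comp -setI_eq0 -(imsetI (f := s)) ?imset_eq0 ?setI_eq0 //.
by move=> x y _ _ /si.
Qed.

End Colorings.

(** * Adding a vertex to a coloring; connectivity after vertex deletion *)

Section Connectivity.
Variable G : multigraph.
Implicit Types (u v w r d : vertex G) (e f : edge G) (A B D X : {set vertex G}).
Implicit Types (h g : vertex G -> {set color}) (c k : edge G -> color).

Lemma other_end e v : v \in ends e -> exists w, w != v /\ ends e = [set v; w].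
Proof.
move=> ve; have /cards2P[x [y [xy E]]] : #|ends e| == 2 by rewrite card_ends.
move: ve; rewrite E !inE => /orP[]/eqP->; first by exists y; rewrite eq_sym.
by exists x; rewrite setUC.
Qed.

Lemma within_pair A u v e : u \in A -> v \in A -> ends e = [set u; v] ->
  e \in within A u.
Proof.
move=> uA vA E; rewrite inE E set21 /=; apply/subsetP => x.
by rewrite !inE => /orP[]/eqP->.
Qed.

Lemma pair_inj r u v : r != u -> r != v -> [set r; u] = [set r; v] -> u = v.
Proof.
move=> ru rv E; have : u \in [set r; v] by rewrite -E set22.
by rewrite !inE eq_sym (negPf ru) => /eqP.
Qed.

(* A list of triples (e, v, x) encodes half-edges: e is an edge whose other end has
   been removed, v its remaining end, and x its color. *)
Definition half (L : seq (edge G * vertex G * color)) v : {set color} :=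
  [set x | has (fun t => (t.1.2 == v) && (t.2 == x)) L].

(** The half-edges listed in [L] become the edges at r, while [H] is the set of half-edges that r
    itself carries. *)
Lemma add_root_seq A r g (H : {set color}) c (L : seq (edge G * vertex G * color)) : r \in A ->
  uniq [seq t.1.1 | t <- L] -> uniq [seq t.2 | t <- L] ->
  within A r =i [seq t.1.1 | t <- L] ->
  (forall t, t \in L -> ends t.1.1 = [set r; t.1.2]) ->
  valid (A :\ r) (fun v => g v :|: half L v) c ->
  (forall t, t \in L -> (t.2 \notin H) && (t.2 \notin g t.1.2)) ->
  (forall t, t \in L -> #|[set x in [seq t.2 | t <- L]] :|: H| = 3 ->
     [set x in [seq t.2 | t <- L]] :|: H !=
       palette (A :\ r) (fun v => g v :|: half L v) c t.1.2) ->
  exists c', [/\ valid A (fun v => if v == r then H else g v) c',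
    palette A (fun v => if v == r then H else g v) c' r =
      [set x in [seq t.2 | t <- L]] :|: H &
    {in A :\ r, forall v, palette A (fun v => if v == r then H else g v) c' v =
      palette (A :\ r) (fun v => g v :|: half L v) c v}].
Proof.
move=> rA uE uC wE eE V HH dist.
(* The default is never read at an edge of [within A r], as all of these are listed in [L]. *)
pose k e := nth None [seq t.2 | t <- L] (index e [seq t.1.1 | t <- L]).
have kE t : t \in L -> k t.1.1 = t.2.
  move=> tL; have iL : index t L < size L by rewrite index_mem.
  have E1 : t.1.1 = nth t.1.1 [seq t.1.1 | t <- L] (index t L).
    by rewrite (nth_map t) // nth_index.
  by rewrite /k E1 index_uniq ?size_map // (nth_map t) // nth_index.
have Lr t : t \in L -> t.1.1 \in within A r.
  by move=> tL; rewrite wE; apply/mapP; exists t.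
have kin e : e \in within A r -> exists2 t, t \in L & e = t.1.1.
  by rewrite wE => /mapP.
have kI : {in within A r &, injective k}.
  move=> e f eA fA; rewrite /k => /eqP.
  rewrite nth_uniq ?size_map //; last 2 first.
  - by rewrite -(size_map (fun t => t.1.1)) index_mem -wE.
  - by rewrite -(size_map (fun t => t.1.1)) index_mem -wE.
  move=> /eqP ef; rewrite wE in eA; rewrite wE in fA.
  by rewrite -(nth_index e eA) -(nth_index e fA) ef.
have kim : k @: within A r = [set x in [seq t.2 | t <- L]].
  apply/setP => x; rewrite inE; apply/imsetP/mapP => [[e /kin[t tL ->] ->]|[t tL ->]].
    by exists t; rewrite // kE.
  by exists t.1.1; rewrite ?kE ?Lr.
have rne t : t \in L -> t.1.2 != r.
  by move=> tL; have := card_ends t.1.1; rewrite (eE t tL) cards2; case: eqVneq.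
have [||||c' [V' p1 p2]] := @add_root G A r (fun v => if v == r then H else g v)
    (fun v => g v :|: half L v) c k rA V.
- move=> v; rewrite !inE => /andP[vr vA]; rewrite (negPf vr); congr (_ :|: _).
  apply/setP => x; rewrite inE; apply/hasP/imsetP => [[t tL /andP[/eqP tv /eqP <-]]|].
    exists t.1.1; rewrite ?kE // inE; apply/andP; split; last exact: Lr.
    by apply: (@within_pair _ _ r); rewrite // (eE t tL) -tv setUC.
  case=> e /setIP[ev er] ->; have [t tL E] := kin e er; exists t; rewrite ?E ?kE //.
  rewrite eqxx andbT; move: ev; rewrite inE E (eE t tL) !inE (negPf vr) /=.
  by case/andP; rewrite eq_sym.
- exact: kI.
- move=> e /kin[t tL ->] v; rewrite (eE t tL) !inE kE //.
  by case/andP: (HH t tL) => h1 h2 /orP[]/eqP->; rewrite ?eqxx // (negPf (rne t tL)).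
- move=> v vD /adjacentP[e E]; rewrite kim eqxx => c3.
  have [|t tL Et] := kin e.
    by apply: (@within_pair _ r v) => //; move: vD; rewrite !inE => /andP[].
  have vr : v != r by move: vD; rewrite !inE => /andP[].
  have := dist t tL c3; suff -> : t.1.2 = v by [].
  apply: (@pair_inj r); rewrite 1?eq_sym ?rne //.
  by rewrite -(eE t tL) -Et E.
by exists c'; split=> //; rewrite p1 kim eqxx.
Qed.

Definition conn A : bool :=
  [forall B : {set vertex G}, (B \subset A) ==> (B != set0) ==> (B != A) ==>
     [exists u in B, exists v in A :\: B, adjacent u v]].

Lemma conn_cross A B x y : conn A -> B \subset A -> x \in B -> y \in A ->
  y \notin B -> exists u v, [/\ u \in B, v \in A, v \notin B & adjacent u v].
Proof.
move=> /forallP/(_ B) + BA xB yA yB; rewrite BA /=.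
have -> /= : B != set0 by apply/set0Pn; exists x.
have -> /= : B != A by apply: contraNneq yB => ->.
move/existsP => [u /andP[uB /existsP[v /andP[]]]]; rewrite inE => /andP[vB vA] uv.
by exists u, v.
Qed.

Lemma connPn A : ~~ conn A -> exists B, [/\ B \subset A, B != set0, B != A &
  forall u v, u \in B -> v \in A -> v \notin B -> ~~ adjacent u v].
Proof.
rewrite negb_forall => /existsP[B]; rewrite 3!negb_imply => /and4P[BA B0 BnA].
move=> /existsPn h; exists B; split=> // u v uB vA vB.
by have := h u; rewrite uB /= => /existsPn/(_ v); rewrite inE vB vA.
Qed.

(** B is a union of components of A - r, so an edge leaving B inside A can only lead to r. *)
Lemma conn_del A r B : conn A -> r \in A -> B \subset A :\ r -> B != set0 ->
  (forall u v, u \in B -> v \in A :\ r -> v \notin B -> ~~ adjacent u v) ->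
  exists2 u, u \in B & adjacent r u.
Proof.
move=> cA rA BA /set0Pn[x xB] nB.
have rB : r \notin B by apply: contraTN (rA) => /(subsetP BA); rewrite !inE eqxx.
have BA' : B \subset A by apply: subset_trans BA (subD1set _ _).
have [u [v [uB vA vB uv]]] := conn_cross cA BA' xB rA rB.
have [vr|vr] := eqVneq v r; first by exists u; rewrite // adjacent_sym -vr.
by have := nB u v uB; rewrite !inE vr vA uv => /(_ isT vB).
Qed.

Lemma conn_del2 A r B : conn A -> r \in A -> B \subset A :\ r -> B != set0 ->
  B != A :\ r ->
  (forall u v, u \in B -> v \in A :\ r -> v \notin B -> ~~ adjacent u v) ->
  exists u v, [/\ u \in B, v \in A :\ r, v \notin B, adjacent r u & adjacent r v].
Proof.
move=> cA rA BA B0 BnA nB.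
have [u uB ru] := conn_del cA rA BA B0 nB.
have [||v vB rv] := @conn_del A r ((A :\ r) :\: B) cA rA (subsetDl _ _).
- by apply: contraNneq BnA => /eqP; rewrite setD_eq0 => AB; rewrite eqEsubset BA.
- move=> w x; rewrite !(in_setD (A :\ r) B) => /andP[wB wA] xA.
  by rewrite xA andbT negbK => xB; rewrite adjacent_sym; apply: nB.
by move: vB; rewrite (in_setD (A :\ r) B) => /andP[vB vA]; exists u, v.
Qed.

Definition deg A v := #|within A v|.

Lemma degD1 A r v : v != r -> deg A v = deg (A :\ r) v + #|within A v :&: within A r|.
Proof.
move=> vr; rewrite -(within_cross A vr) /deg -(cardsID (within (A :\ r) v)).
by rewrite (setIidPr (withinS v (subD1set A r))).
Qed.

Lemma deg_le A B v : A \subset B -> deg A v <= deg B v.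
Proof. by move=> AB; apply/subset_leq_card/withinS. Qed.

Lemma degD1_edge A r v e : v != r -> e \in within A v -> e \in within A r ->
  deg (A :\ r) v < deg A v.
Proof.
move=> vr ev er; rewrite (degD1 A vr) -[X in X < _]addn0 ltn_add2l card_gt0.
by apply/set0Pn; exists e; rewrite inE ev.
Qed.

Lemma adjacent_edge A u v : u \in A -> v \in A -> adjacent u v ->
  exists e, [/\ ends e = [set u; v], e \in within A u & e \in within A v].
Proof.
move=> uA vA /adjacentP[e E]; exists e; split=> //; first exact: within_pair E.
by apply: (@within_pair _ _ u); rewrite // setUC.
Qed.

Lemma conn_del_leaf A r : conn A -> r \in A -> deg A r = 1 -> conn (A :\ r).
Proof.
move=> cA rA /eqP/cards1P[e Ee]; apply: contraT => /connPn[B [BA B0 BnA nB]].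
have [u [v [uB vA vB ru rv]]] := conn_del2 cA rA BA B0 BnA nB.
have nb w : w \in A :\ r -> adjacent r w -> ends e = [set r; w].
  rewrite inE => /andP[_ wA] /(adjacent_edge rA wA)[f [E + _]].
  by rewrite Ee => /set1P <-.
have E : [set r; u] = [set r; v] by rewrite -(nb u) ?(subsetP BA) // (nb v).
suff uv : u = v by rewrite -uv uB in vB.
by apply: (@pair_inj r); rewrite ?adjacent_neq.
Qed.

Lemma conn_split A r : conn A -> r \in A -> deg A r = 2 -> ~~ conn (A :\ r) ->
  exists D1 D2, [/\ conn D1 /\ conn D2, D1 :|: D2 = A :\ r, [disjoint D1 & D2],
    forall u v, u \in D1 -> v \in D2 -> ~~ adjacent u v &
    exists d1 d2 e1 e2, [/\ d1 \in D1 /\ d2 \in D2, e1 != e2,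
      within A r = [set e1; e2], ends e1 = [set r; d1] & ends e2 = [set r; d2]]].
Proof.
move=> cA rA dr /connPn[B [BA B0 BnA nB]].
have [u [v [uB vA vB ru rv]]] := conn_del2 cA rA BA B0 BnA nB.
have uA : u \in A :\ r by apply: (subsetP BA).
have AA := subsetP (subD1set A r).
have [e1 [E1 e1r e1u]] := adjacent_edge rA (AA _ uA) ru.
have [e2 [E2 e2r e2v]] := adjacent_edge rA (AA _ vA) rv.
have uv : u != v by apply: contraNneq vB => <-.
have e12 : e1 != e2.
  apply: contraNneq uv => ee; apply/eqP/(@pair_inj r); rewrite ?adjacent_neq //.
  by rewrite -E1 ee.
have wE : within A r = [set e1; e2].
  apply/esym/eqP; rewrite eqEcard cards2 e12 -[#|_|]/(deg A r) dr andbT.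
  by apply/subsetP => e; rewrite !in_set2 => /orP[]/eqP->.
have nb w : w \in A :\ r -> adjacent r w -> w = u \/ w = v.
  move=> wA rw; have [f [E + _]] := adjacent_edge rA (AA _ wA) rw.
  have rnw := adjacent_neq rw; have rnu := adjacent_neq ru; have rnv := adjacent_neq rv.
  rewrite wE !inE => /orP[]/eqP fe; rewrite fe in E; [left|right].
    by apply: (@pair_inj r) => //; rewrite -E.
  by apply: (@pair_inj r) => //; rewrite -E.
(* If the other neighbor y of r is outside C, then C is connected: each part of C without outgoing
   edges contains a neighbor of r, hence x, and two complementary parts cannot both contain x. *)
have sub (C : {set vertex G}) x y : C \subset A :\ r -> x \in C -> y \in A :\ r ->
  y \notin C ->
  (forall u v, u \in C -> v \in A :\ r -> v \notin C -> ~~ adjacent u v) ->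
  (x = u \/ x = v) -> (y = u \/ y = v) -> adjacent r x -> adjacent r y -> conn C.
  move=> CA xC yA yC nC xuv yuv rx ry; apply: contraT => /connPn[B' [B'C B'0 B'nC nB']].
  have xy : x != y by apply: contraNneq yC => <-.
  have nC' (B1 : {set vertex G}) : B1 \subset C ->
    (forall u v, u \in B1 -> v \in C -> v \notin B1 -> ~~ adjacent u v) ->
    B1 != set0 -> x \in B1.
    move=> B1C nB1 B10.
    have [|a aB1 ra] := conn_del cA rA (subset_trans B1C CA) B10.
      move=> a b aB1 bA bB1; have [bC|bC] := boolP (b \in C); first exact: nB1.
      by apply: nC; rewrite // (subsetP B1C).
    have ax : a != y by apply: contraNneq yC => <-; apply: (subsetP B1C).
    have /nb/(_ ra) auv : a \in A :\ r by apply/(subsetP CA)/(subsetP B1C).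
    suff <- : a = x by [].
    by case: auv xuv yuv ax xy => -> [] -> [] ->; rewrite ?eqxx.
  have xB' := nC' B' B'C nB' B'0.
  have : x \notin C :\: B' by rewrite in_setD xB'.
  case/negP; apply: nC'; first exact: subsetDl.
    move=> a b; rewrite !(in_setD C B') => /andP[aB aC] bC; rewrite bC andbT negbK => bB.
    by rewrite adjacent_sym; apply: nB'.
  by apply: contraNneq B'nC => /eqP; rewrite setD_eq0 => CB; rewrite eqEsubset B'C.
have nD a b : a \in (A :\ r) :\: B -> b \in A :\ r -> b \notin (A :\ r) :\: B ->
    ~~ adjacent a b.
  rewrite !(in_setD (A :\ r) B) => /andP[aB aA] bA; rewrite bA andbT negbK => bB.
  by rewrite adjacent_sym; apply: nB.
exists B, ((A :\ r) :\: B); split.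
- split; first by apply: (sub B u v) => //; [left|right].
  apply: (sub _ v u); rewrite ?subsetDl ?(in_setD (A :\ r) B) ?uB ?vA ?andbT //;
    by [right|left].
- by rewrite -{1}(setIidPr BA) setID.
- by rewrite disjoint_sym disjoints_subset setDE subsetIr.
- by move=> a b aB; rewrite (in_setD (A :\ r) B) => /andP[bB bA]; apply: nB.
by exists u, v, e1, e2; rewrite (in_setD (A :\ r) B) vB vA.
Qed.

End Connectivity.

(** * Vertices of degree at most two *)

(** Each S excludes at most one color beyond F, because T and S determine the element added to T;
    five is the number of colors. *)
Lemma avoid (T F : {set color}) (Ss : seq {set color}) :
  T \subset F -> #|F| + size Ss < 5 ->
  exists x, x \notin F /\ {in Ss, forall S, x |: T != S}.
Proof.
elim: Ss F => [|S Ss IH] F TF /=.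
  rewrite addn0 => F5; have [x xF] : exists x, x \in ~: F.
    by apply/set0Pn; rewrite -card_gt0 cardsCs setCK card_option card_prod card_bool subn_gt0.
  by exists x; rewrite inE in xF; split=> // S; rewrite in_nil.
move=> F5; pose kill := [set x | (x \notin T) && (x |: T == S)].
have k1 : #|kill| <= 1.
  apply/card_le1_eqP => x y; rewrite !inE => /andP[xT /eqP xS] /andP[yT /eqP yS].
  have : x \in y |: T by rewrite yS -xS setU11.
  by rewrite !inE (negPf xT) orbF => /eqP.
have [||x [xFk xS]] := IH (F :|: kill).
- exact: subset_trans TF (subsetUl _ _).
- apply: leq_ltn_trans F5; rewrite addnS -addSn leq_add2r.
  by apply: leq_trans (leq_card_setU _ _) _; rewrite -addn1 leq_add2l.
move: xFk; rewrite !inE !negb_or negb_and => /andP[xF kx]; exists x; split=> // U.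
rewrite inE => /orP[/eqP->|/xS //]; case/orP: kx => // /negPn xT.
by rewrite (subsetP TF) in xF.
Qed.

Lemma avoid_None (T F : {set color}) (Ss : seq {set color}) :
  None \in F -> T \subset F -> #|F| + size Ss < 5 ->
  exists z, Some z \notin F /\ {in Ss, forall S, Some z |: T != S}.
Proof.
move=> NF TF F5; have [[z|] [xF xS]] := avoid TF F5; first by exists z.
by rewrite NF in xF.
Qed.

Lemma avoid_two (F : {set color}) : None \in F -> #|F| <= 3 ->
  exists z z', [/\ Some z \notin F, Some z' \notin F & z' != z].
Proof.
move=> NF F3; have [|z [zF _]] := @avoid_None set0 F [::] NF (sub0set _).
  by rewrite addn0; apply: leq_trans F3 _.
have NF' : None \in Some z |: F by rewrite inE NF orbT.
have [|z' [z'F _]] := @avoid_None set0 (Some z |: F) [::] NF' (sub0set _).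
  by rewrite addn0 cardsU1 zF ltnS.
move: z'F; rewrite !inE negb_or => /andP[zz z'F]; exists z, z'; split=> //.
Qed.

Section Extension.
Variable G : multigraph.
Implicit Types (u v w r d : vertex G) (e f : edge G) (A D X : {set vertex G}).
Implicit Types (h : vertex G -> {set color}) (c : edge G -> color).

Definition promise X v : {set color} := if v \in X then [set None] else set0.

Definition rooted X r (z : quad) v : {set color} :=
  promise X v :|: (if v == r then [set Some z] else set0).

Lemma half_cons e d x (L : seq (edge G * vertex G * color)) v :
  half ((e, d, x) :: L) v = (if v == d then [set x] else set0) :|: half L v.
Proof.
apply/setP => y; rewrite !inE /= [v == d]eq_sym.
by case: eqP => _; rewrite !inE // eq_sym.
Qed.

Lemma half_nil v : half (G := G) [::] v = set0.
Proof. by apply/setP => y; rewrite !inE. Qed.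

Lemma palette_card A h c v : #|palette A h c v| <= deg A v + #|h v|.
Proof.
apply: leq_trans (leq_card_setU _ _) _; rewrite leq_add2r; exact: leq_imset_card.
Qed.

Lemma rooted_card X r z : #|rooted X r z r| <= (r \in X) + 1.
Proof.
apply: leq_trans (leq_card_setU _ _) _; rewrite eqxx cards1 leq_add2r /promise.
by case: ifP; rewrite ?cards1 ?cards0.
Qed.

Lemma valid_set1 h c v : valid [set v] h c.
Proof.
split=> [u|u w]; first by rewrite within_set1 imset0 disjoints_subset sub0set;
  split=> // e; rewrite inE.
by rewrite !inE => /eqP-> /eqP-> /adjacent_neq; rewrite eqxx.
Qed.

Lemma within_other A r d e : r \in A -> e \in within A r -> ends e = [set r; d] ->
  d != r /\ d \in A.
Proof.
move=> rA er E; split.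
  by have := card_ends e; rewrite E cards2 eq_sym; case: eqVneq.
by move: er; rewrite inE => /andP[_ /subsetP]; apply; rewrite E set22.
Qed.

(** The coloring [c'] is fixed before [z], so that several values of [z] can go with it. Without the
    half-edge [z] the palette of r has at most two colors, and r needs no comparison with its
    neighbors until [z] is added. *)
Lemma root_step A r X c (L : seq (edge G * vertex G * color))
    (cols := [set x in [seq t.2 | t <- L]]) : r \in A ->
  uniq [seq t.1.1 | t <- L] -> uniq [seq t.2 | t <- L] ->
  within A r =i [seq t.1.1 | t <- L] ->
  (forall t, t \in L -> ends t.1.1 = [set r; t.1.2]) ->
  valid (A :\ r) (fun v => promise X v :|: half L v) c ->
  (forall t, t \in L -> (t.2 \notin promise X r) && (t.2 \notin promise X t.1.2)) ->
  size L + (r \in X) <= 2 ->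
  exists c', forall z, Some z \notin cols ->
    (forall t, t \in L -> #|Some z |: (cols :|: promise X r)| = 3 ->
      Some z |: (cols :|: promise X r) !=
        palette (A :\ r) (fun v => promise X v :|: half L v) c t.1.2) ->
    valid A (rooted X r z) c' /\
    palette A (rooted X r z) c' r = Some z |: (cols :|: promise X r).
Proof.
move=> rA uE uC wE eE V HH sz.
have colsL : #|cols| = size L by rewrite cardsE (card_uniqP uC) size_map.
have P2 : #|cols :|: promise X r| <= 2.
  apply: leq_trans (leq_card_setU _ _) (leq_trans _ sz); rewrite colsL leq_add2l.
  by rewrite /promise; case: ifP; rewrite ?cards1 ?cards0.
have [|c' [V' pr pD]] := add_root_seq (H := promise X r) rA uE uC wE eE V HH.
  by move=> t _ P3; rewrite -/cols P3 in P2.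
have dcols : [disjoint cols & promise X r].
  rewrite disjoints_subset; apply/subsetP => x; rewrite !inE => /mapP[t tL ->].
  by case/andP: (HH t tL).
have imE : c' @: within A r = cols.
  have [_ d'] := V'.1 r rA; rewrite eqxx in d'.
  move: pr; rewrite /palette eqxx -/cols => E; apply/setP => x.
  move/setP/(_ x): E; rewrite !inE; case xP: (x \in promise X r); rewrite ?orbF // => _.
  move/pred0P/(_ x): d'; move/pred0P/(_ x): dcols; rewrite /= xP !andbT !inE.
  by move=> -> ->.
exists c' => z zc zd.
have zP : Some z \notin promise X r by rewrite /promise; case: ifP; rewrite !inE.
have E : c' @: within A r :|: (Some z |: promise X r) = Some z |: (cols :|: promise X r).
  by rewrite imE setUCA.
have rE : (if r == r then [set Some z] else set0) :|: promise X r = Some z |: promise X r.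
  by rewrite eqxx.
split; last by rewrite /palette /rooted [promise X r :|: _]setUC rE E.
apply: valid_ext (set_half (u := r) (H := Some z |: promise X r) rA V' _ _).
- move=> v vA /=; rewrite /rooted; case: eqP => [->|_]; last by rewrite setU0.
  by rewrite setUC.
- rewrite imE disjoint_sym disjoints_subset subUset -disjoints_subset disjoints1 zc.
  by rewrite -disjoints_subset disjoint_sym.
- move=> v vA rv; rewrite E.
  have [e [Ee er _]] := adjacent_edge rA vA rv.
  have vr : v != r by rewrite eq_sym adjacent_neq.
  have /mapP[t tL et] : e \in [seq t.1.1 | t <- L] by rewrite -wE.
  have tv : t.1.2 = v.
    have [dr _] := within_other rA er (etrans (congr1 _ et) (eE t tL)).
    by apply: (@pair_inj G r); rewrite -?(eE t tL) -?et // 1?eq_sym // adjacent_neq.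
  by move=> c3; rewrite pD ?inE ?vr // -tv; apply: zd.
Qed.

Lemma conn_deg0 A r : conn A -> r \in A -> deg A r = 0 -> A = [set r].
Proof.
move=> cA rA /eqP; rewrite cards_eq0 => /eqP d0; apply/eqP; rewrite eq_sym eqEsubset.
rewrite sub1set rA; apply/subsetP => y yA; apply: contraT => yr.
have [|u [v [/set1P-> vA _ /(adjacent_edge rA vA)[e [_]]]]] :=
  @conn_cross G A [set r] r y cA _ (set11 r) yA yr; first by rewrite sub1set.
by rewrite d0 inE.
Qed.

(** Both [z] and [z'] go with the same [c], so that palettes away from r do not depend on the
    choice. With [None] at r one value is enough, since r is then distinguished from any neighbor
    without [None]. *)
Definition extends A X r := exists c z, valid A (rooted X r z) c /\
  (None \in palette A (rooted X r z) c r \/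
   exists z', z' != z /\ valid A (rooted X r z') c).

(** A promised half-edge counts in the degree; the stricter bound at r leaves room for the half-edge
    [Some z]. *)
Definition fits A X r := [/\ r \in A, conn A,
  {in A, forall v, deg A v + (v \in X) <= 3} & deg A r + (r \in X) <= 2].

Lemma extends_leaf A X r : fits A X r -> deg A r = 1 ->
  (forall D Y d, D \subset A :\ r -> fits D Y d -> extends D Y d) -> extends A X r.
Proof.
move=> [rA cA dA dr] d1 IH.
have /cards1P[e We] : #|within A r| == 1 by rewrite -[#|_|]/(deg A r) d1.
have er : e \in within A r by rewrite We set11.
have [d [dnr Ee]] : exists d, d != r /\ ends e = [set r; d].
  by apply: other_end; move: er; rewrite inE => /andP[].
have [_ dinA] := within_other rA er Ee.
have ed : e \in within A d by apply: (@within_pair _ _ d r) => //; rewrite setUC.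
have lt := degD1_edge dnr ed er.
have [||c [z' [V _]]] := IH (A :\ r) X d; rewrite ?subxx //.
  split; [by rewrite !inE dnr|exact: conn_del_leaf|move=> v /setD1P[vr vA]|].
    by apply: leq_trans (dA v vA); rewrite leq_add2r deg_le ?subD1set.
  by rewrite -ltnS; apply: leq_trans (dA d dinA); rewrite ltn_add2r.
have [|||||||c' step] := @root_step A r X c [:: (e, d, Some z')] rA => //=.
- by move=> f; rewrite We !inE.
- by move=> t; rewrite inE => /eqP->.
- apply: valid_ext V => v _; rewrite half_cons half_nil setU0 /rooted.
  by case: (v == d).
- move=> t; rewrite inE => /eqP-> /=; rewrite /promise.
  by do 2 case: ifP; rewrite !inE.
- by move: dr; rewrite d1.
have cE : [set x in [:: Some z']] = [set Some z'] by apply/setP => x; rewrite !inE.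
rewrite /= cE in step.
(* With [None] promised at r, one [z] different from [z'] and separating r from d suffices.
   Otherwise r has a palette of two colors, so any [z] other than [z'] works. *)
have [rX|rX] := boolP (r \in X).
  have pX : promise X r = [set None] by rewrite /promise rX.
  rewrite pX in step; pose S := palette (A :\ r) (fun v => promise X v :|:
    half [:: (e, d, Some z')] v) c d.
  have [|||z [zF zS]] := @avoid_None ([set Some z'] :|: [set None])
    ([set Some z'] :|: [set None]) [:: S]; rewrite ?subxx //.
  - by rewrite !inE orbT.
  - by rewrite cards2.
  have [||V' p'] := step z.
  - by apply: contra zF => h; rewrite inE h.
  - by move=> t; rewrite inE => /eqP-> _; apply: zS; rewrite mem_head.
  by exists c', z; split=> //; left; rewrite p' !inE.
have [||z [z2 [zF z2F zz]]] := @avoid_two [set None; Some z'].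
- by rewrite !inE.
- by rewrite cards2.
have ok x : Some x \notin [set None; Some z'] -> valid A (rooted X r x) c'.
  rewrite !inE /= => xF; apply: (step x _ _).1; rewrite ?inE //.
  by move=> t _; rewrite /promise (negPf rX) setU0 cards2; case: eqP.
by exists c', z; split; [apply: ok|right; exists z2; split=> //; apply: ok].
Qed.

End Extension.

Section ExtensionSplit.
Variable G : multigraph.
Implicit Types (u v w r d : vertex G) (e f : edge G) (A D X : {set vertex G}).
Implicit Types (h : vertex G -> {set color}) (c k : edge G -> color).

Lemma extends_isolated A X r : fits A X r -> deg A r = 0 -> extends A X r.
Proof.
move=> [rA cA dA dr] d0; rewrite (conn_deg0 cA rA d0).
exists (fun=> None), (false, false); split; first exact: valid_set1.
by right; exists (true, true); split=> //; apply: valid_set1.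
Qed.

Lemma half_pair e1 d1 x1 e2 d2 x2 v : half (G := G) [:: (e1, d1, x1); (e2, d2, x2)] v =
  (if v == d1 then [set x1] else set0) :|: (if v == d2 then [set x2] else set0).
Proof. by rewrite !half_cons half_nil setU0. Qed.

Lemma forall_in2 (T : eqType) (P : T -> Prop) (s t : T) :
  P s -> P t -> forall x, x \in [:: s; t] -> P x.
Proof. by move=> Ps Pt x; rewrite !inE => /orP[]/eqP->. Qed.

Lemma root_step2 A r X c e1 d1 x1 e2 d2 x2
    (h := fun v => promise X v :|: half [:: (e1, d1, x1); (e2, d2, x2)] v) :
  r \in A -> r \notin X -> e1 != e2 -> within A r = [set e1; e2] ->
  ends e1 = [set r; d1] -> ends e2 = [set r; d2] -> x1 != x2 ->
  x1 \notin promise X d1 -> x2 \notin promise X d2 ->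
  valid (A :\ r) h c ->
  exists c', forall z, Some z \notin [set x1; x2] ->
    Some z |: [set x1; x2] != palette (A :\ r) h c d1 ->
    Some z |: [set x1; x2] != palette (A :\ r) h c d2 ->
    valid A (rooted X r z) c' /\
    palette A (rooted X r z) c' r = Some z |: [set x1; x2].
Proof.
move=> rA rX e12 We E1 E2 x12 x1d x2d V.
have pX : promise X r = set0 by rewrite /promise (negPf rX).
have cE : [set x in [:: x1; x2]] = [set x1; x2] by apply/setP => x; rewrite !inE.
have [|||||||c' step] := @root_step G A r X c [:: (e1, d1, x1); (e2, d2, x2)] rA.
- by rewrite /= inE e12.
- by rewrite /= inE x12.
- by move=> e; rewrite We !inE.
- by apply: forall_in2.
- exact: V.
- by apply: forall_in2; rewrite pX inE.
- by rewrite (negPf rX).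
rewrite /= cE pX setU0 in step.
exists c' => z zx z1 z2; apply: step => // t tL _.
by move: t tL; apply: forall_in2.
Qed.

(** The two sides are colored independently, and one is then recolored so that the edge from r to
    each side has a color missing in the palette of the neighbor of r on the other side. The palette
    of r contains both colors, so it differs from both neighbors whatever [z] is. *)
Lemma extends_split A X r : fits A X r -> r \notin X -> deg A r = 2 ->
  ~~ conn (A :\ r) ->
  (forall D Y d, D \subset A :\ r -> fits D Y d -> extends D Y d) -> extends A X r.
Proof.
move=> [rA cA dA dr] rX d2 ncD IH.
have [D1 [D2 [[c1 c2] DE dis ncr [r1 [r2 [e1 [e2 [[r1D r2D] e12 We E1 E2]]]]]]]] :=
  conn_split cA rA d2 ncD.
have s1 : D1 \subset A :\ r by rewrite -DE subsetUl.
have s2 : D2 \subset A :\ r by rewrite -DE subsetUr.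
have dsub D d e : D \subset A :\ r -> d \in D -> conn D -> e \in within A r ->
    ends e = [set r; d] -> fits D X d.
  move=> DA dD cD er Ee; split=> // [v vD|].
    have /setD1P[_ vA] := subsetP DA v vD.
    apply: leq_trans (dA v vA); rewrite leq_add2r deg_le //.
    exact: subset_trans DA (subD1set _ _).
  have /setD1P[dnr dinA] := subsetP DA d dD.
  rewrite -ltnS; apply: leq_trans (dA d dinA); rewrite ltn_add2r.
  apply: leq_ltn_trans (deg_le d DA) _; apply: (degD1_edge (e := e)) => //.
  by apply: (@within_pair _ _ d r); rewrite // setUC.
have e1r : e1 \in within A r by rewrite We set21.
have e2r : e2 \in within A r by rewrite We set22.
have f1 := dsub D1 r1 e1 s1 r1D c1 e1r E1.
have f2 := dsub D2 r2 e2 s2 r2D c2 e2r E2.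
have [k1 [z1 [V1 _]]] := IH D1 X r1 s1 f1.
have [k2 [z2 [V2 _]]] := IH D2 X r2 s2 f2.
have free D d c z : fits D X d -> exists m, m != z /\ Some m \notin palette D (rooted X d z)
  c d.
  move=> [_ _ _ dd]; set P := palette _ _ _ _.
  have zP : Some z \in P by rewrite /P /palette !inE eqxx set11 !orbT.
  have P3 : #|P| <= 3.
    apply: leq_trans (palette_card _ _ _ _) _.
    apply: leq_trans (leq_add (leqnn _) (rooted_card _ _ _)) _.
    by rewrite addnA addn1 ltnS.
  have [|m [mP _]] := @avoid_None set0 (None |: P) [::] (setU11 _ _) (sub0set _).
    by rewrite addn0 cardsU1 ltnS; apply: leq_trans (leq_add (leq_b1 _) P3) _.
  move: mP; rewrite in_setU1 negb_or => /andP[_ mP]; exists m; split=> //.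
  by apply: contraNneq mP => ->.
(* Color [m1] is missing at [r1], and [m2] at [r2]. The permutation [s] of colors fixes [None] and
   sends [z2] to [m1] and [m2] to [z1]: after recoloring, the edge to [r2] has color [m1] and [z1]
   is missing at [r2]. *)
have [m1 [mz1 mP1]] := free D1 r1 k1 z1 f1.
have [m2 [mz2 mP2]] := free D2 r2 k2 z2 f2.
pose t1 := tperm (Some z2) (Some m1 : color).
pose s := tperm (t1 (Some m2)) (Some z1) \o t1.
have si : injective s by apply: inj_comp; apply: perm_inj.
have tN (x y : quad) : tperm (Some x) (Some y : color) None = None by rewrite tpermD.
have [m2' m2E] : exists m2', t1 (Some m2) = Some m2'.
  by case E: (t1 (Some m2)) => [q|]; [exists q|have := perm_inj (etrans E (esym (tN z2 m1)))].
have sN : s None = None by rewrite /s /= tN m2E tN.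
have sz : s (Some z2) = Some m1.
  rewrite /s /= /t1 tpermL -/t1 tpermD //.
    apply/eqP => E; have /perm_inj[E'] := etrans E (esym (tpermL (Some z2) (Some m1))).
    by rewrite E' eqxx in mz2.
  by apply: contraNneq mz1 => -[->].
have sm : s (Some m2) = Some z1 by rewrite /s /= tpermL.
have [V2' pE] := valid_inj si V2.
pose h v := promise X v :|: half [:: (e1, r1, Some z1); (e2, r2, Some m1)] v.
have nD v : v \in D1 -> v \in D2 -> False.
  by move=> v1 v2; move/pred0P/(_ v): dis; rewrite /= v1 v2.
have h1 : {in D1, rooted X r1 z1 =1 h}.
  move=> v vD; rewrite /rooted /h half_pair; congr (_ :|: _).
  by case: (v =P r2) => [E|_]; [case: (nD v); rewrite // E|rewrite setU0].
have h2 : {in D2, (fun v => s @: rooted X r2 z2 v) =1 h}.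
  move=> v vD; rewrite /rooted /h half_pair imsetU; congr (_ :|: _).
    by rewrite /promise; case: ifP; rewrite ?imset_set1 ?sN ?imset0.
  case: (v =P r1) => [E|_]; first by case: (nD v); rewrite // E.
  by rewrite set0U; case: eqP; rewrite ?imset_set1 ?sz ?imset0.
have nocross1 v : v \in D1 -> within (D1 :|: D2) v :\: within D1 v = set0.
  move=> vD; apply/setP => e; rewrite !inE; apply/negP => /andP[+ /andP[ve eS]].
  rewrite ve /= => /negP; apply; apply/subsetP => u ue.
  have /setUP[//|uD] := subsetP eS u ue.
  have [w [wv Ee]] := other_end ve; move: ue; rewrite Ee !inE => /orP[]/eqP uE.
    by rewrite uE.
  by have := ncr v w vD; rewrite -uE => /(_ uD)/negP[]; apply/adjacentP; exists e; rewrite uE.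
have nocross2 v : v \in D2 -> within (D1 :|: D2) v :\: within D2 v = set0.
  move=> vD; apply/setP => e; rewrite !inE; apply/negP => /andP[+ /andP[ve eS]].
  rewrite ve /= => /negP; apply; apply/subsetP => u ue.
  have /setUP[uD|//] := subsetP eS u ue.
  have [w [wv Ee]] := other_end ve; move: ue; rewrite Ee !inE => /orP[]/eqP uE.
    by rewrite uE.
  have := ncr w v; rewrite -uE uD => /(_ isT vD)/negP[].
  by rewrite adjacent_sym; apply/adjacentP; exists e; rewrite uE.
have [|||||||||k []] := @glue G D1 D2 h h k1 (s \o k2) (fun=> None) dis.
- exact: valid_ext h1 V1.
- exact: valid_ext h2 V2'.
- by move=> v vD; rewrite nocross1 // imset0 setU0.
- by move=> v vD; rewrite nocross2 // imset0 setU0.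
- by move=> v vD; rewrite nocross1 // => e f; rewrite inE.
- by move=> v vD; rewrite nocross2 // => e f; rewrite inE.
- by move=> v vD; rewrite nocross1 // imset0 disjoints_subset sub0set.
- by move=> v vD; rewrite nocross2 // imset0 disjoints_subset sub0set.
- by move=> u v uD vD uv; have := ncr u v uD vD; rewrite uv.
rewrite DE => V p1 p2.
have [|||c step] := @root_step2 A r X k e1 r1 (Some z1) e2 r2 (Some m1)
  rA rX e12 We E1 E2 _ _ _ V.
- by rewrite eq_sym.
- by rewrite /promise; case: ifP; rewrite !inE.
- by rewrite /promise; case: ifP; rewrite !inE.
have q1 : palette (A :\ r) h k r1 = palette D1 (rooted X r1 z1) k1 r1.
  by rewrite p1 //; apply: eq_palette; rewrite // h1.
have q2 : palette (A :\ r) h k r2 = s @: palette D2 (rooted X r2 z2) k2 r2.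
  by rewrite p2 // -pE; apply: eq_palette; rewrite // h2.
have ok z : Some z \notin [set None; Some z1; Some m1] -> valid A (rooted X r z) c.
  rewrite !inE negb_or /= => /andP[zz zm]; apply: (step z _ _ _).1.
  - by rewrite !inE negb_or /= zz.
  - rewrite -/h q1; apply: contraNneq mP1 => <-; rewrite !inE eqxx; by rewrite !orbT.
  - rewrite -/h q2; apply: contraNneq mP2 => E.
    by rewrite -(mem_imset _ _ si) -E sm !inE eqxx !orbT.
have [||z [z' [zF zF' zz]]] := @avoid_two [set None; Some z1; Some m1].
- by rewrite !inE.
- apply: leq_trans (leq_card_setU _ _) _; rewrite cards1 cards2 addn1 ltnS.
  by case: (_ != _).
by exists c, z; split; [apply: ok|right; exists z'; split=> //; apply: ok].
Qed.

End ExtensionSplit.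

Section ExtensionTwoEdges.
Variable G : multigraph.
Implicit Types (u v r d : vertex G) (e f : edge G) (A D X : {set vertex G}).
Implicit Types (h : vertex G -> {set color}) (c : edge G -> color).

Lemma card_cross_parallel A r d e1 e2 : r \in A -> d \in A -> e1 != e2 ->
  ends e1 = [set r; d] -> ends e2 = [set r; d] ->
  1 < #|within A d :&: within A r|.
Proof.
move=> rA dA e12 E1 E2; apply/card_gt1P; exists e1, e2; split=> //; rewrite inE.
  by rewrite !(@within_pair _ _ d r) // 1?setUC // (@within_pair _ _ r d).
by rewrite !(@within_pair _ _ d r) // 1?setUC // (@within_pair _ _ r d).
Qed.

(** The promise is extended to [d2], so that [e2] has color [None] and [e1] the color [z'] of the
    half-edge at the root [d1]. As [None] then occurs at r, one [z] is enough, and it exists because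
    2 + 2 < 5. *)
Lemma extends_promise A X r e1 d1 e2 d2 : fits A X r -> r \notin X ->
  e1 != e2 -> within A r = [set e1; e2] ->
  ends e1 = [set r; d1] -> ends e2 = [set r; d2] -> conn (A :\ r) -> d2 \notin X ->
  (forall D Y d, D \subset A :\ r -> fits D Y d -> extends D Y d) -> extends A X r.
Proof.
move=> [rA cA dA dr] rX e12 We E1 E2 cD d2X IH.
have e1r : e1 \in within A r by rewrite We set21.
have e2r : e2 \in within A r by rewrite We set22.
have [d1r d1A] := within_other rA e1r E1.
have [d2r d2A] := within_other rA e2r E2.
have lt1 : deg (A :\ r) d1 < deg A d1.
  by apply: (degD1_edge (e := e1)) => //; apply: (@within_pair _ _ d1 r); rewrite // setUC.
have lt2 : deg (A :\ r) d2 < deg A d2.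
  by apply: (degD1_edge (e := e2)) => //; apply: (@within_pair _ _ d2 r); rewrite // setUC.
have [||c [z' [V _]]] := IH (A :\ r) (d2 |: X) d1; rewrite ?subxx //.
  split; [by rewrite !inE d1r|exact: cD|move=> v /setD1P[vr vA]|].
    rewrite in_setU1; case: (v =P d2) => [->|_].
      by rewrite addn1; apply: leq_trans lt2 (leq_trans (leq_addr _ _) (dA d2 d2A)).
    by apply: leq_trans (dA v vA); rewrite leq_add2r deg_le ?subD1set.
  (* If [e1] and [e2] are parallel, their common end receives both half-edges, but it has also lost
     two edges. *)
  rewrite in_setU1; case: (d1 =P d2) => [dd|_]; last first.
    by rewrite -ltnS; apply: leq_trans (dA d1 d1A); rewrite ltn_add2r.
  have := card_cross_parallel rA d1A e12 E1; rewrite E2 dd => /(_ erefl) c2.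
  rewrite addn1 -ltnS; apply: leq_trans (dA d2 d2A).
  by rewrite (negPf d2X) addn0 (degD1 A d2r) -addn2 leq_add2l.
pose h v := promise X v :|: half [:: (e1, d1, Some z'); (e2, d2, None)] v.
have hE : rooted (d2 |: X) d1 z' =1 h.
  move=> v; rewrite /rooted /h half_pair /promise !inE.
  case: (v =P d2) => [->|_] /=; last by rewrite setU0.
  by rewrite (negPf d2X) set0U setUC.
have [||||c' step] := @root_step2 G A r X c e1 d1 (Some z') e2 d2 None rA rX e12 We E1 E2.
- by [].
- by rewrite /promise; case: ifP; rewrite !inE.
- by rewrite /promise (negPf d2X) inE.
- exact: valid_ext (in1W hE) V.
have [|||z [zF zS]] := @avoid_None [set Some z'; None] [set Some z'; None]
  [:: palette (A :\ r) h c d1; palette (A :\ r) h c d2].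
- by rewrite !inE.
- exact: subxx.
- by rewrite cards2.
have [||V' p] := step z zF.
- by apply: zS; rewrite !inE eqxx.
- by apply: zS; rewrite !inE eqxx orbT.
by exists c', z; split=> //; left; rewrite p !inE orbT.
Qed.

(** Here [None] is available on neither edge at r. But it occurs at both [d1] and [d2] and not at r,
    so r is distinguished from them automatically, and two values of [z] remain. *)
Lemma extends_promised A X r e1 d1 e2 d2 : fits A X r -> r \notin X ->
  e1 != e2 -> within A r = [set e1; e2] ->
  ends e1 = [set r; d1] -> ends e2 = [set r; d2] -> conn (A :\ r) ->
  d1 \in X -> d2 \in X ->
  (forall D Y d, D \subset A :\ r -> fits D Y d -> extends D Y d) -> extends A X r.
Proof.
move=> [rA cA dA dr] rX e12 We E1 E2 cD d1X d2X IH.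
have e1r : e1 \in within A r by rewrite We set21.
have e2r : e2 \in within A r by rewrite We set22.
have [d1r d1A] := within_other rA e1r E1.
have [d2r d2A] := within_other rA e2r E2.
have lt1 : deg (A :\ r) d1 < deg A d1.
  by apply: (degD1_edge (e := e1)) => //; apply: (@within_pair _ _ d1 r); rewrite // setUC.
have lt2 : deg (A :\ r) d2 < deg A d2.
  by apply: (degD1_edge (e := e2)) => //; apply: (@within_pair _ _ d2 r); rewrite // setUC.
suff [c [z' [x [xz' xN V]]]] : exists c z' x, [/\ x != Some z', x != None &
    valid (A :\ r) (fun v => promise X v :|: half [:: (e1, d1, Some z'); (e2, d2, x)] v) c].
  have [|||c' step] := @root_step2 G A r X c e1 d1 (Some z')
    e2 d2 x rA rX e12 We E1 E2 _ _ _ V.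
  - by rewrite eq_sym.
  - by rewrite /promise; case: ifP; rewrite !inE.
  - by rewrite /promise; case: ifP; rewrite !inE.
  have N v : v \in X -> None \in palette (A :\ r)
      (fun v => promise X v :|: half [:: (e1, d1, Some z'); (e2, d2, x)] v) c v.
    by move=> vX; rewrite /palette /promise !inE vX inE orbT.
  have ok z : Some z \notin [set None; Some z'; x] -> valid A (rooted X r z) c'.
    move=> zF; apply: (step z _ _ _).1.
    - by apply: contra zF; rewrite !inE => /orP[] ->; rewrite ?orbT.
    - apply: contraTneq (N _ d1X) => <-; rewrite !inE /=; by rewrite eq_sym.
    - apply: contraTneq (N _ d2X) => <-; rewrite !inE /=; by rewrite eq_sym.
  have [||z [z2 [zF zF' zz]]] := @avoid_two [set None; Some z'; x].
  - by rewrite !inE.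
  - apply: leq_trans (leq_card_setU _ _) _; rewrite cards1 cards2 addn1 ltnS.
    by case: (_ != _).
  by exists c', z; split; [apply: ok|right; exists z2; split=> //; apply: ok].
(* The two parallel edges and the promise exhaust the degree of [d1], so that nothing else is left
   in A - r. *)
have [dd|dd] := eqVneq d1 d2.
  have D1 : A :\ r = [set d1].
    apply: conn_deg0; rewrite ?inE ?d1r //.
    have := card_cross_parallel rA d1A e12 E1; rewrite E2 dd => /(_ erefl) c2.
    have := dA d2 d2A; rewrite d2X addn1 ltnS (degD1 A d2r) => c3.
    apply/eqP; rewrite -leqn0 -(leq_add2r 2); apply: leq_trans c3.
    by rewrite leq_add2l.
  exists (fun=> None), (false, false), (Some (true, true)); split=> //.
  by rewrite D1; apply: valid_set1.
have d1D : d1 \in A :\ r by rewrite !inE d1r.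
have d2D : d2 \in A :\ r by rewrite !inE d2r.
have [||c [z' [V _]]] := IH (A :\ r) X d1; rewrite ?subxx //.
  split=> // [v /setD1P[vr vA]|].
    by apply: leq_trans (dA v vA); rewrite leq_add2r deg_le ?subD1set.
  by rewrite -ltnS; apply: leq_trans (dA d1 d1A); rewrite ltn_add2r.
have dd2 : deg (A :\ r) d2 = 1.
  apply/eqP; rewrite eqn_leq -ltnS.
  have := dA d2 d2A; rewrite d2X addn1 ltnS => dd2; rewrite (leq_trans lt2 dd2) lt0n.
  by apply: contraNneq dd => d0; rewrite (conn_deg0 cD d2D d0) inE in d1D.
have /cards1P[f Wf] : #|within (A :\ r) d2| == 1 by rewrite -[#|_|]/(deg _ _) dd2.
have fd : f \in within (A :\ r) d2 by rewrite Wf set11.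
have [u [und Ef]] : exists u, u != d2 /\ ends f = [set d2; u].
  by apply: other_end; move: fd; rewrite inE => /andP[].
(* The color x of [e2] is added at [d2] afterwards. It avoids the edge [f] and the promise at [d2],
   the color [z'] of [e1], and the one color that would give [d2] the palette of u: 3 + 1 < 5. *)
have [||x [xF xS]] := @avoid [set c f; None] [set c f; None; Some z']
  [:: palette (A :\ r) (rooted X d1 z') c u].
- exact: subsetUl.
- rewrite addn1 ltnS; apply: leq_ltn_trans (leq_card_setU _ _) _.
  by rewrite cards1 cards2 addn1 ltnS; case: (_ != _).
exists c, z', x; move: xF; rewrite !inE !negb_or -andbA => /and3P[xf xN xz]; split=> //.
have cf : c f != None.
  have [_ /pred0P/(_ None)/=] := V.1 d2 d2D.
  rewrite Wf imset_set1 /rooted /promise !inE d2X !inE andbT.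
  by rewrite eq_sym => ->.
apply: valid_ext (set_half (u := d2) (H := [set None; x]) d2D V _ _).
- move=> v vD /=; rewrite half_pair /rooted; case: (v =P d2) => [->|_].
    by rewrite eq_sym (negPf dd) set0U /promise d2X.
  by rewrite setU0.
- rewrite Wf imset_set1 disjoints1 !inE negb_or cf eq_sym; exact: xf.
- move=> v vD /(adjacent_edge d2D vD)[e [Ee]]; rewrite Wf => /set1P ef _ _.
  have -> : v = u.
    apply: (@pair_inj G d2); rewrite -?Ef -?Ee ?ef 1?eq_sym //.
    by have := card_ends e; rewrite Ee cards2 eq_sym; case: eqVneq.
  have := xS (palette (A :\ r) (rooted X d1 z') c u) (mem_head _ _).
  by rewrite imset_set1 setUA [x |: _]setUC.
Qed.

Lemma extends_fits A X r : fits A X r -> extends A X r.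
Proof.
have [n] := ubnP #|A|; elim: n A X r => // n IHn A X r An fA.
have [rA cA dA dr] := fA.
have IH D Y d : D \subset A :\ r -> fits D Y d -> extends D Y d.
  move=> DA; apply: IHn; apply: leq_ltn_trans (subset_leq_card DA) _.
  by move: An; rewrite (cardsD1 r) rA.
case dE: (deg A r) => [|[|[|?]]].
- exact: extends_isolated.
- exact: extends_leaf.
- have rX : r \notin X by move: dr; rewrite dE; case: (r \in X).
  have [cD|] := boolP (conn (A :\ r)); last by move/extends_split; apply.
  have /eqP/cards2P[e1 [e2 [e12 We]]] := dE.
  have end1 e : e \in within A r -> exists d, ends e = [set r; d].
    by rewrite inE => /andP[/other_end[d [_ E]] _]; exists d.
  have [d1 E1] : exists d, ends e1 = [set r; d] by apply: end1; rewrite We set21.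
  have [d2 E2] : exists d, ends e2 = [set r; d] by apply: end1; rewrite We set22.
  have [d2X|d2X] := boolP (d2 \in X); last exact: (extends_promise fA rX e12 We E1 E2).
  have [d1X|d1X] := boolP (d1 \in X); first exact: (extends_promised fA rX e12 We E1 E2).
  apply: (extends_promise (e1 := e2) (e2 := e1) fA rX _ _ E2 E1); rewrite // 1?eq_sym //.
  by rewrite We setUC.
- by move: dr; rewrite dE.
Qed.

End ExtensionTwoEdges.

(** * The complement of a maximal core is an induced cycle *)

Section Ring.
Variable G : multigraph.
Implicit Types (u v w d : vertex G) (e : edge G) (A B D W Y : {set vertex G}).

Definition edge_count A : nat := #|[set e : edge G | ends e \subset A]|.

Lemma handshake A : \sum_(v in A) deg A v = (edge_count A).*2.
Proof.
transitivity (\sum_(v in A) \sum_(e in [set e : edge G | ends e \subset A])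
  (v \in ends e : nat)).
  apply: eq_bigr => v vA; rewrite /deg -sum1_card big_mkcond [RHS]big_mkcond.
  by apply: eq_bigr => e _; rewrite !inE; case: (v \in _); case: (_ \subset _).
rewrite exchange_big /= -muln2 /edge_count -sum_nat_const.
apply: eq_bigr => e; rewrite inE => eA.
rewrite -(card_ends e) -sum1_card big_mkcond [RHS]big_mkcond; apply: eq_bigr => v _.
by case: (boolP (v \in ends e)) => [/(subsetP eA)->|]; rewrite ?if_same.
Qed.

Lemma edge_countD1 A w : edge_count A = edge_count (A :\ w) + deg A w.
Proof.
rewrite /edge_count -(cardsID [set e | w \in ends e]) addnC; congr (_ + _);
  apply: eq_card => e.
  by rewrite !inE subsetD1 andbC.
by rewrite !inE andbC.
Qed.

(** Minimum degree two on some nonempty subset amounts to containing a cycle, where two parallel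
    edges count as a cycle. *)
Definition cyclic W : bool :=
  [exists Y : {set vertex G}, [&& Y != set0, Y \subset W & [forall v in Y, 1 < deg Y v]]].

Lemma cyclicP W Y v : v \in Y -> Y \subset W -> {in Y, forall u, 1 < deg Y u} ->
  cyclic W.
Proof.
move=> vY YW dY; apply/existsP; exists Y; rewrite YW /=.
by apply/andP; split; [apply/set0Pn; exists v|apply/forall_inP].
Qed.

(** As in a forest, there is always a vertex of degree at most one to delete. *)
Lemma acyclic_edge_count W : ~~ cyclic W -> W != set0 -> edge_count W < #|W|.
Proof.
have [n] := ubnP #|W|; elim: n W => // n IH W Wn cW W0.
have [v vW dv] : exists2 v, v \in W & deg W v <= 1.
  apply/exists_inP; apply: contraR cW => /exists_inPn h.
  have /set0Pn[x xW] := W0; apply: (cyclicP xW (subxx _)) => u /h.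
  by rewrite -ltnNge.
rewrite (edge_countD1 W v) (cardsD1 v W) vW addnC.
have [E|E0] := eqVneq (W :\ v) set0.
  have Wv : W = [set v] by rewrite -(setD1K vW) E setU0.
  rewrite E cards0 /edge_count /deg {1}Wv within_set1 cards0 add0n addn0 ltnS leqn0 cards_eq0.
  apply/eqP/setP => e; rewrite !inE subset0 -cards_eq0 card_ends; by [].
rewrite -addnS; apply: leq_add => //; apply: IH => //.
  by move: Wn; rewrite (cardsD1 v W) vW.
apply: contra cW => /existsP[Y /and3P[Y0 YW dY]]; apply/existsP; exists Y.
by rewrite Y0 dY (subset_trans YW (subD1set _ _)).
Qed.

Lemma conn_grow D u w : conn D -> u \in D -> adjacent u w -> conn (w |: D).
Proof.
move=> cD uD uw; apply: contraT => /connPn[B [BD B0 BnD nB]].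
have [wD|wD] := boolP (w \in D).
  have wDE : w |: D = D by apply/setUidPr; rewrite sub1set.
  move: BD BnD nB; rewrite wDE => BD BnD nB.
  have /set0Pn[x xB] := B0; have /subsetPn[y yD yB] : ~~ (D \subset B).
    by apply: contra BnD => DB; rewrite eqEsubset BD.
  have [a [b [aB bD bB ab]]] := conn_cross cD BD xB yD yB.
  by have := nB a b aB bD bB; rewrite ab.
have DE : D = (w |: D) :\ w by rewrite setU1K.
have [BD0|/set0Pn[x /setIP[xB xD]]] := eqVneq (B :&: D) set0.
  have Bw : B \subset [set w].
    apply/subsetP => x xB; have := subsetP BD x xB; rewrite !inE => /orP[//|xD].
    by move/setP/(_ x): BD0; rewrite !inE xB xD.
  have /set0Pn[x xB] := B0; have /set1P xw := subsetP Bw x xB.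
  have := nB w u; rewrite -xw xB => /(_ isT); rewrite xw !inE uD orbT => /(_ isT).
  rewrite adjacent_sym uw => /(_ _)/negP; case=> //.
  by apply: contra wD => /(subsetP Bw)/set1P <-.
have [DB|/subsetPn[y yD yB]] := boolP (D \subset B).
  have wB : w \notin B.
    by apply: contra BnD => wB; rewrite eqEsubset BD subUset sub1set wB.
  by have := nB u w (subsetP DB u uD); rewrite !inE eqxx wB uw => /(_ isT isT).
have xBD : x \in B :&: D by rewrite inE xB.
have yBD : y \notin B :&: D by rewrite inE (negPf yB).
have [a [b [/setIP[aB _] bD + ab]]] := conn_cross cD (subsetIr _ _) xBD yD yBD.
rewrite inE bD andbT => bB.
by have := nB a b aB; rewrite !inE bD orbT ab => /(_ isT bB).
Qed.

Lemma conn_set1 v : conn [set v].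
Proof.
apply: contraT => /connPn[B [BD B0 BnD _]]; case/negP: BnD.
rewrite eqEsubset BD sub1set; have /set0Pn[x xB] := B0.
by have /set1P <- := subsetP BD x xB.
Qed.

Definition cubic A := {in A, forall v, deg A v = 3}.

Definition core A D := [&& D \subset A, D != set0, conn D & cyclic (A :\: D)].

Definition max_core A D := core A D /\ forall D', core A D' -> #|D'| <= #|D|.

(** A single vertex v is a core: with n vertices in A, the set A - v has 3n/2 - 3 edges, and this is
    at least n - 1 once n is at least 4, too many for a forest. *)
Lemma max_core_exists A : cubic A -> 3 < #|A| -> exists D, max_core A D.
Proof.
move=> cA A4; have /card_gt0P[v vA] : 0 < #|A| by apply: leq_trans A4.
have c1 : core A [set v].
  rewrite /core sub1set vA conn_set1 -card_gt0 cards1 /=; apply: contraT => nc.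
  have A1 : A :\ v != set0 by rewrite -card_gt0 -ltnS -add1n; move: A4; rewrite (cardsD1 v)
    vA; lia.
  have := acyclic_edge_count nc A1; have := handshake A.
  rewrite (eq_bigr (fun=> 3)) => [|u /cA //]; rewrite sum_nat_const.
  rewrite (edge_countD1 A v) cA //; have := cardsD1 v A; rewrite vA; move: A4.
  move: #|A| #|_ :\ _| (edge_count _) => a b i; lia.
case: (arg_maxnP (fun D : {set vertex G} => #|D|) c1) => D cD maxD.
by exists D; split.
Qed.

Lemma deg_detached A D w : D \subset A -> w \in A :\: D -> ~~ [exists d in D, adjacent d w] ->
  deg (A :\: D) w = deg A w.
Proof.
move=> DA wW; rewrite negb_exists => /forallP nd; apply: eq_card => e.
apply/idP/idP; first by apply/subsetP/withinS/subsetDl.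
rewrite !inE => /andP[we eA]; rewrite we /=; apply/subsetP => x xe.
rewrite inE (subsetP eA) // andbT; apply/negP => xD.
have := nd x; rewrite xD /= => /negP; apply.
have [y [yw Ee]] := other_end we; move: xe wW; rewrite Ee !inE => /orP[]/eqP xE.
  by rewrite -xE xD.
by move=> _; apply/adjacentP; exists e; rewrite xE setUC.
Qed.

(** If w in W is attached to D, then W - w is acyclic, or w could be moved to D; so w lies on every
    cycle of W. Hence all degrees in W are at least two: attached vertices lie on a cycle, others
    keep degree three. Deleting one attached vertex, which has degree two, leaves a forest, so W has
    at most as many edges as vertices and all degrees are exactly two. In particular every vertex is
    attached. *)
Lemma max_core_ring A D (W := A :\: D) : conn A -> cubic A -> max_core A D ->
  [/\ {in W, forall w, deg W w = 2}, {in W, forall w, ~~ cyclic (W :\ w)} & W != set0].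
Proof.
move=> cA cu [/and4P[DA D0 cD cW] maxD].
have W0 : W != set0.
  case/existsP: cW => Y /and3P[/set0Pn[y yY] YW _].
  by apply/set0Pn; exists y; apply: (subsetP YW).
have att w : w \in W -> [exists d in D, adjacent d w] -> ~~ cyclic (W :\ w).
  move=> wW /exists_inP[d dD dw]; apply/negP => cWw.
  have /setDP[wA wD] := wW.
  suff /maxD : core A (w |: D) by rewrite cardsU1 wD ltnn.
  rewrite /core subUset sub1set wA DA (conn_grow cD dD dw) (setUC _ D) -setDDl cWw !andbT.
  by apply/set0Pn; exists w; rewrite !inE eqxx orbT.
have d2 w : w \in W -> 1 < deg W w.
  move=> wW; have [aw|naw] := boolP [exists d in D, adjacent d w]; last first.
    by rewrite (deg_detached DA wW naw) cu //; case/setDP: wW.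
  case/existsP: cW => Y /and3P[Y0 YW /forall_inP dY].
  have [wY|wY] := boolP (w \in Y); first exact: leq_trans (dY w wY) (deg_le _ YW).
  have /negP[] := att w wW aw; apply/existsP; exists Y; rewrite Y0 subsetD1 YW wY /=.
  exact/forall_inP.
have [w wW aw] : exists2 w, w \in W & [exists d in D, adjacent d w].
  have /set0Pn[x xD] := D0; have /set0Pn[y yW] := W0; have /setDP[yA yD] := yW.
  have [u [v [uD vA vD uv]]] := conn_cross cA DA xD yA yD.
  by exists v; [rewrite inE vD|apply/exists_inP; exists u].
have dw : deg W w = 2.
  apply/eqP; rewrite eqn_leq (d2 _ wW) andbT -ltnS.
  have /setDP[wA wD] := wW; rewrite -(cu w wA).
  have /exists_inP[d dD dw] := aw.
  have [e [Ee _ ew]] := adjacent_edge (subsetP DA d dD) wA dw.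
  apply/proper_card/properP; split; first exact/withinS/subsetDl.
  exists e => //; rewrite inE negb_and; apply/orP; right; apply/subsetPn.
  by exists d; rewrite ?Ee ?set21 // inE dD.
have iW : edge_count W <= #|W|.
  have Ww0 : W :\ w != set0.
    have /card_gt0P[e] : 0 < #|within W w| by rewrite -[#|_|]/(deg W w) dw.
    rewrite inE => /andP[we eW]; have [u [uw Ee]] := other_end we.
    by apply/set0Pn; exists u; rewrite !inE uw -in_setD (subsetP eW) // Ee set22.
  have := acyclic_edge_count (att w wW aw) Ww0.
  by rewrite (edge_countD1 W w) dw (cardsD1 w W) wW; lia.
have all2 v : v \in W -> deg W v = 2.
  move=> vW; have := handshake W; rewrite (bigD1 v) //=.
  have : \sum_(i in W | i != v) 2 <= \sum_(i in W | i != v) deg W i.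
    by apply: leq_sum => i /andP[/d2].
  rewrite sum_nat_const; have -> : #|[pred i in W | i != v]| = #|W|.-1.
    by rewrite (cardsD1 v W) vW; apply: eq_card => i; rewrite !inE andbC.
  have := d2 v vW; have : 0 < #|W| by rewrite card_gt0.
  move: (\sum_(_ in _ | _) _) (deg W v) (edge_count W) #|W| iW => a b i n; lia.
split=> // v vW; apply: att => //; apply: contraT => nav.
have := deg_detached DA vW nav; rewrite all2 // cu //; by case/setDP: vW.
Qed.

End Ring.

(** * Induced paths, and the cycle cut open at a vertex *)

Section RingPath.
Variable G : multigraph.
Implicit Types (v w r d : vertex G) (e f : edge G) (B W Y : {set vertex G}).
Implicit Types (s : seq (vertex G)).

(* Induced paths: v :: s' has v adjacent, within the vertices of the list, only to
   the head of s', and by a single edge. *)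
Fixpoint ipath s : Prop :=
  match s with
  | [::] => False
  | v :: s' => match s' with
    | [::] => True
    | w :: _ => [/\ v \notin s', exists2 e, within [set x in s] v = [set e] &
                     ends e = [set v; w] & ipath s']
    end
  end.

Lemma set_cons v s : [set x in v :: s] = v |: [set x in s].
Proof. by apply/setP => x; rewrite !inE. Qed.

Lemma set_consD1 v s : v \notin s -> [set x in v :: s] :\ v = [set x in s].
Proof. by move=> vs; rewrite set_cons setU1K // inE. Qed.

(** The walk from v is forced, since each new vertex has at most one edge left when its predecessor
    is deleted. The last conclusion says that no edge of B leaves the path. *)
Lemma ipath_exists B v : v \in B -> deg B v <= 1 -> {in B, forall x, deg B x <= 2} ->
  exists s, [/\ ipath (v :: s), {subset v :: s <= B} &
    {in v :: s, forall x, within B x \subset within [set y in v :: s] x}].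
Proof.
have [n] := ubnP #|B|; elim: n B v => // n IH B v Bn vB dv d2.
case dE: (deg B v) dv => [|[|//]] _.
  exists [::]; split=> // x; rewrite inE => /eqP-> //.
  by move/eqP: dE; rewrite cards_eq0 => /eqP->; apply: sub0set.
have /cards1P[e We] : #|within B v| == 1 by rewrite -[#|_|]/(deg B v) dE.
have eB : e \in within B v by rewrite We set11.
have [w [wv Ee]] : exists w, w != v /\ ends e = [set v; w].
  by apply: other_end; move: eB; rewrite inE => /andP[].
have [_ wB] := within_other vB eB Ee.
have ew : e \in within B w by apply: (@within_pair _ _ w v); rewrite // setUC.
have [||||s [ps sB cl]] := IH (B :\ v) w.
- by move: Bn; rewrite (cardsD1 v) vB.
- by rewrite !inE wv.
- by rewrite -ltnS; apply: leq_trans (d2 w wB); apply: (degD1_edge (e := e)).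
- by move=> x /setD1P[_ xB]; apply: leq_trans (d2 x xB); apply/deg_le/subD1set.
have vs : v \notin w :: s by apply/negP => /sB; rewrite !inE eqxx.
have sub : {subset v :: w :: s <= B}.
  by move=> x; rewrite inE => /orP[/eqP->|/sB/setD1P[]].
have subS : [set y in v :: w :: s] \subset B by apply/subsetP => x; rewrite inE => /sub.
have eS x : x \in ends e -> e \in within [set y in v :: w :: s] x.
  rewrite inE => ->; apply/subsetP => y; rewrite Ee !inE => /orP[]/eqP->.
    by rewrite eqxx.
  by rewrite eqxx orbT.
exists (w :: s); split=> //.
  split=> //; exists e => //; apply/eqP; rewrite eqEsubset -{1}We withinS //=.
  by rewrite sub1set eS // Ee set21.
move=> x; rewrite inE => /orP[/eqP->|xs].
  by rewrite We sub1set eS // Ee set21.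
apply/subsetP => f fx; have [vf|vf] := boolP (v \in ends f).
  have /set1P fe : f \in [set e].
    by rewrite -We inE vf; move: fx; rewrite inE => /andP[].
  by rewrite fe eS // -fe; move: fx; rewrite inE => /andP[].
apply: (subsetP (@withinS _ [set y in w :: s] _ x _)).
  by apply/subsetP => y; rewrite !inE => ->; rewrite orbT.
apply: (subsetP (cl x xs)); move: fx; rewrite !inE => /andP[-> fB] /=.
by rewrite subsetD1 fB.
Qed.

Lemma ipath_last v s : ipath (v :: s) -> s != [::] ->
  deg [set x in v :: s] (last v s) = 1 /\ v != last v s.
Proof.
elim: s v => // w s IH v [vs [e We Ee] ps] _.
have vl : v != last w s by apply: contraNneq vs => ->; apply: mem_last.
split=> //=; rewrite (degD1 _ (r := v)) 1?eq_sym // set_consD1 //.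
case: s IH vs ps We Ee vl => [|x s] IH vs ps We Ee vl.
  have -> : [set y in [:: w]] = [set w] by apply/setP => y; rewrite !inE.
  rewrite /deg within_set1 cards0 add0n We.
  suff -> : within [set x in [:: v; w]] w :&: [set e] = [set e] by rewrite cards1.
  apply/setIidPr; rewrite sub1set inE Ee set22 /=; apply/subsetP => y.
  by rewrite !inE.
have [-> wl] := IH w ps isT.
suff -> : within [set y in [:: v, w, x & s]] (last w (x :: s)) :&:
  within [set y in [:: v, w, x & s]] v = set0 by rewrite cards0.
apply/setP => f; rewrite We [RHS]in_set0; apply/negP => /setIP[fl /set1P fe].
by move: fl; rewrite fe inE Ee !inE => /andP[/orP[]]; rewrite eq_sym ?(negPf vl) ?(negPf wl).
Qed.

Lemma ring_path W v0 : v0 \in W -> {in W, forall w, deg W w = 2} ->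
  {in W, forall w, ~~ cyclic (W :\ w)} ->
  exists v1 s g1 g2, [/\ ipath (v1 :: s) /\ v0 \notin v1 :: s, W = v0 |: [set x in v1 :: s],
    g1 != g2 /\ within W v0 = [set g1; g2], ends g1 = [set v0; v1] &
    ends g2 = [set v0; last v1 s]].
Proof.
move=> v0W d2 nc.
have [f fv0] : exists f, f \in within W v0.
  by apply/card_gt0P; rewrite -[#|_|]/(deg W v0) d2.
have [v1 [v10 Ef]] : exists w, w != v0 /\ ends f = [set v0; w].
  by apply: other_end; move: fv0; rewrite inE => /andP[].
have [_ v1W] := within_other v0W fv0 Ef.
have fv1 : f \in within W v1 by apply: (@within_pair _ _ v1 v0); rewrite // setUC.
have [|||s [ps sB cl]] := @ipath_exists (W :\ v0) v1.
- by rewrite !inE v10.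
- by rewrite -ltnS -(d2 v1 v1W); apply: (degD1_edge (e := f)).
- by move=> x /setD1P[_ xW]; rewrite -(d2 x xW); apply/deg_le/subD1set.
have v0s : v0 \notin v1 :: s by apply/negP => /sB; rewrite !inE eqxx.
set z := last v1 s; have zs : z \in v1 :: s by apply: mem_last.
have sW x : x \in v1 :: s -> x \in W /\ x != v0 by move/sB => /setD1P[].
have PB : [set x in v1 :: s] \subset W :\ v0 by apply/subsetP => x; rewrite inE => /sB.
have degB x : x \in v1 :: s -> deg (W :\ v0) x = deg [set y in v1 :: s] x.
  by move=> xs; apply/eqP; rewrite eqn_leq !subset_leq_card ?cl ?withinS.
have [zW z0] := sW z zs.
have cardz : #|within W z :&: within W v0| = 2 - deg [set y in v1 :: s] z.
  by rewrite -degB // -(d2 z zW) (degD1 W z0) addKn.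
have [g [gf gz gv0]] : exists g, [/\ g != f, g \in within W z & g \in within W v0].
  (* The last vertex z of the path has a second edge to [v0]. If the path is a single vertex, this
     is an edge parallel to [f]; otherwise z has only one edge on the path. *)
  have [s0|s0] := eqVneq s [::].
    have zv : z = v1 by rewrite /z s0.
    move: cardz; rewrite s0 zv.
    have -> : [set y in [:: v1]] = [set v1] by apply/setP => y; rewrite !inE.
    rewrite /deg within_set1 cards0 subn0 => c2.
    have : 0 < #|(within W v1 :&: within W v0) :\ f|.
      by move: c2; rewrite (cardsD1 f) in_setI fv1 fv0 add1n => -[->].
    by case/card_gt0P => g /setD1P[gf /setIP[gz gv]]; exists g.
  have [dz vz] := ipath_last ps s0.
  have /card_gt0P[g] : 0 < #|within W z :&: within W v0| by rewrite cardz dz.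
  case/setIP => gz gv0; exists g; split=> //.
  apply: contraTneq gz => ->; rewrite inE Ef !inE (negPf z0) /=.
  by rewrite eq_sym (negPf vz).
have gE : ends g = [set v0; z].
  move: gz gv0; rewrite !inE => /andP[zg _] /andP[vg _].
  by apply/esym/eqP; rewrite eqEcard card_ends cards2 eq_sym z0 andbT subUset !sub1set vg.
have Wv0 : within W v0 = [set f; g].
  apply/esym/eqP; rewrite eqEcard cards2 eq_sym gf -[#|_|]/(deg W v0) d2 // andbT.
  by rewrite subUset !sub1set fv0.
exists v1, s, f, g; split=> //; last by rewrite eq_sym.
apply/eqP; rewrite eqEsubset; apply/andP; split; last first.
  by rewrite subUset sub1set v0W (subset_trans PB (subD1set _ _)).
(* The path with [v0] keeps all edges that W has at its vertices, so it is 2-regular; a further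
   vertex w of W would leave it as a cycle of W - w. *)
apply/subsetP => w wW; apply: contraT => wY; case/negP: (nc w wW).
set Y := v0 |: [set x in v1 :: s] in wY *.
have YW : Y \subset W by rewrite subUset sub1set v0W (subset_trans PB (subD1set _ _)).
apply: (@cyclicP _ _ Y v0); [exact: setU11|by rewrite subsetD1 YW|].
move=> x xY; rewrite -(d2 x (subsetP YW x xY)); apply/subset_leq_card/subsetP => e ex.
have xe : x \in ends e by move: ex; rewrite inE => /andP[].
rewrite inE xe /=; move: xY; rewrite !inE => /orP[/eqP xv|xs].
  move: ex; rewrite xv Wv0 !inE => /orP[]/eqP->; rewrite ?Ef ?gE subUset !sub1set.
    by rewrite !inE eqxx /= eqxx orbT.
  by rewrite !inE eqxx /= -in_cons zs orbT.
have [ve|ve] := boolP (v0 \in ends e).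
  have -> : ends e = [set v0; x].
    apply/esym/eqP; rewrite eqEcard card_ends cards2 eq_sym (sW x xs).2 andbT.
    by rewrite subUset !sub1set ve.
  by rewrite subUset !sub1set !inE eqxx /= xs orbT.
have : e \in within (W :\ v0) x by move: ex; rewrite !inE subsetD1 => /andP[-> ->].
move/(subsetP (cl x xs)); rewrite inE => /andP[_ eP].
exact: subset_trans eP (subsetUr _ _).
Qed.

End RingPath.

(** * Closing the cycle *)

(** If S is not [None] with two other colors, it forbids nothing, and an arbitrary pair is returned
    so that every path vertex has exactly one forbidden pair. *)
Lemma doubleton_of (S : {set color}) : exists2 F, F \in doubletons &
  forall p q, p != q -> S = [set None; Some p; Some q] -> ~~ allowed F p q.
Proof.
have dbl p q : p != q -> ((p, q) \in doubletons) || ((q, p) \in doubletons).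
  by case: p q => [[] []] [[] []].
have [[p q] /eqP Spq|none] :=
  pickP (fun t : quad * quad => (t.1 != t.2) && (S == [set None; Some t.1; Some t.2])).
  move: Spq => /eqP/andP[pq /eqP SE]; rewrite /= in pq SE.
  have [F [Fd FE]] : exists F, F \in doubletons /\ (F = (p, q) \/ F = (q, p)).
    by case/orP: (dbl p q pq) => h; [exists (p, q)|exists (q, p)]; split=> //; [left|right].
  exists F => // p' q' pq' SE'.
  have /setP E : [set None; Some p; Some q] = [set None; Some p'; Some q'].
    by rewrite -SE.
  have := E (Some p'); have := E (Some q'); rewrite !inE !eqxx ?orbT /=.
  move=> /orP[]/eqP[qE] /orP[]/eqP[pE]; move: pq'; rewrite pE qE ?eqxx //;
    by case: FE => ->; rewrite /allowed !eqxx !andbF.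
exists ((false, false), (false, true)) => // p q pq SE.
by have := none (p, q); rewrite /= pq SE eqxx.
Qed.

Section PathColoring.
Variable G : multigraph.
Implicit Types (u v w : vertex G) (e f : edge G) (A : {set vertex G}) (s : seq (vertex G)).
Implicit Types (c : edge G -> color).

(** [None] stands for the spokes, [y] and [a] for the edges from v0 to the two extremities, which
    coincide when the cycle has length two. *)
Definition capped v w (a y : quad) u : {set color} := [set None] :|:
  ((if u == w then [set Some a] else set0) :|: (if u == v then [set Some y] else set0)).

Lemma path_color (F : vertex G -> quad * quad) a v s x y
    (h := capped v (last v s) a y) : ipath (v :: s) ->
  reach a [seq F u | u <- v :: s] (x, y) ->
  exists c, [/\ valid [set u in v :: s] h c,
      palette [set u in v :: s] h c v = [set None; Some x; Some y] &
      {in v :: s, forall u, exists p q, allowed (F u) p q /\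
         palette [set u in v :: s] h c u = [set None; Some p; Some q]}].
Proof.
elim: s v x y @h => [|w s IH] v x y h.
  move=> _ /= /andP[/eqP-> al]; exists (fun=> None).
  have SE : [set u in [:: v]] = [set v] by apply/setP => u; rewrite !inE.
  have pE : palette [set u in [:: v]] h (fun=> None) v = [set None; Some a; Some y].
    by rewrite /palette SE within_set1 imset0 set0U /h /capped !eqxx setUA.
  split=> //; first by rewrite SE; apply: valid_set1.
  by move=> u; rewrite inE => /eqP->; exists a, y.
case=> vs [e We Ee] ps; rewrite !map_cons reach_cons => /hasP[x0 _ /and3P[rx /= yx al]].
have [c [V pw pS]] := IH w x0 x ps rx.
set h0 := capped w _ a x in V pw pS.
have AE := set_consD1 vs; set A := [set u in v :: w :: s] in We AE *.
have vA : v \in A by rewrite !inE eqxx.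
pose g u : {set color} := [set None] :|: (if u == last w s then [set Some a] else set0).
have hE : {in A :\ v, h0 =1 fun u => g u :|: half [:: (e, w, Some x)] u}.
  by move=> u _; rewrite half_cons half_nil setU0 /h0 /g /capped setUA.
have vw : v != w by apply: contraNneq vs => ->; rewrite mem_head.
have pE u : u \in A :\ v -> palette (A :\ v) (fun u => g u :|: half [:: (e, w, Some x)] u) c u
    = palette [set u in w :: s] h0 c u.
  by move=> uA; rewrite -AE; apply: eq_palette; rewrite // hE.
have wA : w \in A :\ v by rewrite AE inE mem_head.
have xy : x != y by case/and3P: al.
have xg : Some x \notin g w.
  rewrite /g; case: (w =P last w s) => [E|_]; rewrite !inE //=.
  case: s ps rx E {IH V pw pS We AE A vs vA hE pE wA g h h0} => [_|w' s].
    by case/andP=> /= /eqP<- /and3P[+ _ _] _; rewrite eq_sym.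
  by move=> [ws _ _] _ E; case/negP: ws; rewrite {1}E; apply: (mem_last w' s).
have [|||||||c' [V' pv pu]] := @add_root_seq G A v g [set None; Some y] c [:: (e, w, Some x)]
  vA.
- by [].
- by [].
- by move=> f; rewrite We !inE.
- by move=> t; rewrite inE => /eqP->.
- by apply: (valid_ext hE); rewrite AE.
- by move=> t; rewrite inE => /eqP-> /=; rewrite xg andbT !inE /=.
(* The palette of w consists of [None], [x0] and [x], and does not contain [y]. *)
- move=> t; rewrite inE => /eqP-> _ /=; rewrite pE // pw.
  apply/eqP => /setP/(_ (Some y)); rewrite !inE !eqxx ?orbT /=.
  by move/esym/orP=> []/eqP[E]; [rewrite E eqxx in yx|rewrite E eqxx in xy].
have vl : v != last w s by apply: contraNneq vs => ->; apply: mem_last.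
have h'E : {in A, (fun u => if u == v then [set None; Some y] else g u) =1 h}.
  move=> u _ /=; rewrite /h /capped /g; case: (u =P v) => [->|_].
    by rewrite (negPf vl) set0U.
  by rewrite setU0.
have hpE u : u \in A -> palette A h c' u =
    palette A (fun u => if u == v then [set None; Some y] else g u) c' u.
  by move=> uA; apply: eq_palette; rewrite // h'E.
have pvE : palette A h c' v = [set None; Some x; Some y].
  by rewrite hpE // pv /=; apply/setP => t; rewrite !inE orbA (orbC (t == Some x)).
exists c'; split=> //; first exact: valid_ext h'E V'.
move=> u uS; move: (uS); rewrite inE => /orP[/eqP->|us]; first by exists x, y.
have uD : u \in A :\ v by rewrite AE inE.
rewrite hpE; last by rewrite inE.
by rewrite pu // pE //; apply: pS.
Qed.

End PathColoring.

Section RingClosing.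
Variable G : multigraph.
Implicit Types (u v w : vertex G) (e f : edge G) (A D W X : {set vertex G}).
Implicit Types (s : seq (vertex G)) (c : edge G -> color).

(** D and the path are glued along spokes of color [None], and v0 is added last. Injectivity of [t]
    on the path ensures that each foot has at most one such spoke. *)
Lemma close_ring A D v0 v1 s g1 g2 (m : vertex G -> edge G) (t : vertex G -> vertex G)
    (P := [set u in v1 :: s]) (X := t @: P) c0 z a x y (F : vertex G -> quad * quad) :
  A = v0 |: (D :|: P) -> v0 \notin D :|: P -> [disjoint D & P] -> ipath (v1 :: s) ->
  within A v0 =i [:: m v0; g1; g2] -> uniq [:: m v0; g1; g2] ->
  ends g1 = [set v0; v1] -> ends g2 = [set v0; last v1 s] ->
  {in v0 |: P, forall w, ends (m w) = [set w; t w] /\ t w \in D} ->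
  {in P, forall w, within (D :|: P) w :\: within P w = [set m w]} ->
  {in P &, injective t} ->
  valid D (rooted X (t v0) z) c0 ->
  reach a [seq F u | u <- v1 :: s] (x, y) ->
  {in P, forall w p q, p != q ->
     palette D (rooted X (t v0) z) c0 (t w) = [set None; Some p; Some q] ->
     ~~ allowed (F w) p q} ->
  uniq [:: z; y; a] ->
  [set Some z; Some y; Some a] != palette D (rooted X (t v0) z) c0 (t v0) ->
  exists c, valid A (fun=> set0) c.
Proof.
move=> AE v0S dis ps W0 uW E1 E2 mt mP tI VD re FP uq u0P.
have [c1 [VP pv pS]] := path_color ps re.
set hP := capped v1 _ a y in VP pv pS.
set hD := rooted X (t v0) z in VD FP u0P.
pose S := D :|: P.
have nDP u : u \in D -> u \in P -> False.
  by move=> uD uP; move/pred0P/(_ u): dis; rewrite /= uD uP.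
have DS u : u \in D -> u \in S by move=> uD; rewrite in_setU uD.
have PS u : u \in P -> u \in S by move=> uP; rewrite in_setU uP orbT.
have v1P : v1 \in P by rewrite inE mem_head.
have zP : last v1 s \in P by rewrite inE mem_last.
pose h u : {set color} := (if u == t v0 then [set Some z] else set0) :|:
  ((if u == last v1 s then [set Some a] else set0) :|:
   (if u == v1 then [set Some y] else set0)).
pose h1 u := if u \in D then hD u else hP u.
have t0D : t v0 \in D by case: (mt v0 (setU11 _ _)).
have mtP w : w \in P -> ends (m w) = [set w; t w] /\ t w \in D.
  by move=> wP; apply: mt; rewrite inE wP orbT.
have cross u e : u \in D -> e \in within S u :\: within D u ->
    exists w, [/\ w \in P, e = m w & t w = u].
  move=> uD /setDP[eS eD].
  have [ue eSs] : u \in ends e /\ ends e \subset S by move: eS; rewrite inE => /andP[].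
  have [w [wu Ee]] := other_end ue.
  have wP : w \in P.
    have /setUP[wD|//] : w \in S by apply: (subsetP eSs); rewrite Ee set22.
    by case/negP: eD; apply: (@within_pair _ _ u w).
  exists w; have em : e = m w.
    apply/set1P; rewrite -(mP w wP) inE; apply/andP; split.
      rewrite inE negb_and; apply/orP; right; apply/subsetPn; exists u => //.
      by apply/negP => /(nDP u uD).
    by apply: (@within_pair _ _ w u); [exact: PS|exact: DS|rewrite setUC].
  split=> //; have [Em tD] := mtP w wP.
  apply/esym; apply: (@pair_inj G w); first by rewrite eq_sym eq_sym.
    by apply: contraTneq tD => <-; apply/negP => /nDP/(_ wP).
  by rewrite -Em -em Ee setUC.
have crossm w : w \in P -> m w \in within S (t w) :\: within D (t w).
  move=> wP; have [Em tD] := mtP w wP; rewrite inE; apply/andP; split.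
    rewrite inE negb_and; apply/orP; right; apply/subsetPn; exists w.
      by rewrite Em set21.
    by apply/negP => /nDP/(_ wP).
  by apply: (@within_pair _ _ (t w) w); [exact: DS|exact: PS|rewrite setUC].
have Nh u : None \notin h u by rewrite /h; do 3 case: ifP => _; rewrite !inE.
have imN (Z : {set edge G}) : (fun=> None : color)
  @: Z = if Z == set0 then set0 else [set None].
  case: eqP => [->|/eqP/set0Pn[e eZ]]; first exact: imset0.
  apply/setP => q; rewrite !inE; apply/imsetP/eqP => [[//]|->]; by exists e.
have [|||||||||c2 []] := @glue G D P h h1 c0 c1 (fun=> None) dis.
- by apply: valid_ext VD => u uD; rewrite /h1 uD.
- apply: valid_ext VP => u uP; rewrite /h1; case: ifP => // uD.
  by case: (nDP u uD uP).
- move=> u uD; rewrite /h1 uD /hD /rooted /h imN.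
  have -> : (u == last v1 s) = false.
    by apply/negP => /eqP E; apply: (nDP u uD); rewrite E.
  have -> : (u == v1) = false by apply/negP => /eqP E; apply: (nDP u uD); rewrite E.
  rewrite !setU0 setUC; congr (_ :|: _); rewrite /promise -/S.
  have [/imsetP[w wP uE]|uX] := boolP (u \in X).
    by have := crossm w wP; rewrite -uE; case: eqP => // ->; rewrite inE.
  case: eqP => // /eqP/set0Pn[e /(cross u e uD)[w [wP _ tw]]].
  by rewrite -tw imset_f in uX.
- move=> u uP; rewrite /h1; case: ifP => [uD|_]; first by case: (nDP u uD uP).
  rewrite imN mP //; have -> : ([set m u] == set0) = false.
    by apply/negbTE/set0Pn; exists (m u); rewrite inE.
  rewrite /hP /capped /h; have -> : (u == t v0) = false.
    by apply/negP => /eqP E; apply: (nDP u) => //; rewrite E.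
  by rewrite set0U setUC.
- move=> u uD e f /(cross u e uD)[w [wP -> tw]] /(cross u f uD)[w' [wP' -> tw']] _.
  by congr m; apply: tI; rewrite // tw tw'.
- by move=> u uP; rewrite mP // => e f /set1P-> /set1P->.
- by move=> u _; rewrite imN; case: eqP; rewrite ?disjoints1 // disjoints_subset sub0set.
- by move=> u _; rewrite imN; case: eqP; rewrite ?disjoints1 // disjoints_subset sub0set.
- move=> u v uD vP /adjacentP[e Ee] _.
  have vs : v \in v1 :: s by move: vP; rewrite inE.
  have [p [q [al pE]]] := pS v vs.
  have -> : palette D h1 c0 u = palette D hD c0 u.
    by apply: eq_palette; rewrite // /h1 uD.
  have -> : palette P h1 c1 v = palette P hP c1 v.
    apply: eq_palette; rewrite // /h1; case: ifP => // vD.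
    by case: (nDP v vD vP).
  rewrite pE; apply/eqP => pu.
  have pq : p != q by case/and3P: al.
  have tv : t v = u.
    have [|w [wP em tw]] := cross u e uD.
      rewrite inE; apply/andP; split.
        rewrite inE negb_and; apply/orP; right; apply/subsetPn; exists v.
          by rewrite Ee set22.
        by apply/negP => /nDP/(_ vP).
      by apply: (@within_pair _ _ u v); [exact: DS|exact: PS|].
    have [Em _] := mtP w wP; rewrite -tw; congr t.
    have : v \in ends e by rewrite Ee set22.
    rewrite em Em tw !inE => /orP[]/eqP // vu.
    by case: (nDP u uD); rewrite -vu.
  by have := FP v vP p q pq; rewrite tv pu al => /(_ erefl).
rewrite -/S => V2 pD pP.
have ASE : A :\ v0 = S by rewrite AE setU1K.
have hE : {in S, h =1 fun u => set0 :|: half [:: (m v0, t v0, Some z); (g1, v1, Some y);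
    (g2, last v1 s, Some a)] u}.
  move=> u _; rewrite !half_cons half_nil setU0 set0U /h.
  by congr (_ :|: _); rewrite setUC.
have pE u : u \in S -> palette S (fun u => set0 :|: half [:: (m v0, t v0, Some z);
    (g1, v1, Some y); (g2, last v1 s, Some a)] u) c2 u = palette S h c2 u.
  by move=> uS; apply: eq_palette; rewrite // hE.
have colE : [set x0 in [seq t0.2 | t0 <- [:: (m v0, t v0, Some z); (g1, v1, Some y);
    (g2, last v1 s, Some a)]]] :|: set0 = [set Some z; Some y; Some a].
  by rewrite setU0; apply/setP => q; rewrite !inE -orbA.
have NP v : v \in P -> None \in palette S h c2 v.
  by move=> vP; rewrite pP // /palette /h1; case: ifP => [vD|_];
    [case: (nDP v vD vP)|rewrite /hP /capped !inE eqxx orbT].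
have NC v : v \in P -> [set Some z; Some y; Some a] != palette S h c2 v.
  by move=> vP; apply: contraTneq (NP v vP) => <-; rewrite !inE.
have [||||||||c3 [V3 _ _]] := @add_root_seq G A v0 (fun=> set0) set0 c2
    [:: (m v0, t v0, Some z); (g1, v1, Some y); (g2, last v1 s, Some a)].
- by rewrite AE setU11.
- exact: uW.
- by move: uq; rewrite -(map_inj_uniq (@Some_inj _)).
- exact: W0.
- move=> q; rewrite !inE => /or3P[]/eqP-> //=.
  by case: (mt v0 (setU11 _ _)).
- by rewrite ASE; apply: valid_ext hE V2.
- by move=> q _; rewrite !inE.
- move=> q qL _; rewrite colE ASE; move: qL; rewrite !inE => /or3P[]/eqP-> /=.
  + rewrite pE ?DS // pD //; have -> // : palette D h1 c0 (t v0) = palette D hD c0 (t v0).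
    by apply: eq_palette; rewrite // /h1 t0D.
  + by rewrite pE ?PS //; apply: NC.
  + by rewrite pE ?PS //; apply: NC.
by exists c3; apply: valid_ext V3 => u _; case: eqP.
Qed.

End RingClosing.

(** * Spokes with distinct feet *)

Section Spokes.
Variable G : multigraph.
Implicit Types (u v w d : vertex G) (e : edge G) (A D W X : {set vertex G}).
Implicit Types (s : seq (vertex G)) (c : edge G -> color) (m : vertex G -> edge G).
Implicit Types (t : vertex G -> vertex G).

(* [m w] is the spoke of w and [t w] its foot in D. *)
Definition spokes A D m t := {in A :\: D, forall w,
  [/\ within A w = m w |: within (A :\: D) w, m w \notin within (A :\: D) w,
      ends (m w) = [set w; t w] & t w \in D]}.

Lemma spokes_exist A D : conn A -> cubic A -> max_core A D -> exists m t, spokes A D m t.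
Proof.
move=> cA cu mc; have [W2 _ /set0Pn[w0 w0W]] := max_core_ring cA cu mc.
have sp w : w \in A :\: D -> exists e u, [/\ within A w = e |: within (A :\: D) w,
    e \notin within (A :\: D) w, ends e = [set w; u] & u \in D].
  move=> wW; have /setDP[wA wD] := wW.
  have sub : within (A :\: D) w \subset within A w by apply/withinS/subsetDl.
  have : #|within A w :\: within (A :\: D) w| == 1.
    by rewrite cardsD (setIidPr sub) -/(deg A w) -/(deg _ w) cu // W2.
  case/cards1P => e eE.
  have : e \in [set e] by rewrite inE.
  rewrite -eE => /setDP[eA eW].
  have we : w \in ends e by move: eA; rewrite inE => /andP[].
  have [u [uw Ee]] := other_end we; exists e, u; split=> //.
    by rewrite -eE -{2}(setIidPr sub) setUC setID.
  have [_ uA] := within_other wA eA Ee.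
  by apply: contraR eW => uD; apply: within_pair Ee; rewrite // inE uD.
have [e0 [u0 _]] := sp w0 w0W.
have [] := @fin_all_exists _ (fun=> (edge G * vertex G)%type) (fun w p => w \in A :\: D ->
   [/\ within A w = p.1 |: within (A :\: D) w, p.1 \notin within (A :\: D) w,
      ends p.1 = [set w; p.2] & p.2 \in D]).
  move=> w; have [/sp[e [u h]]|nW] := boolP (w \in A :\: D); first by exists (e, u).
  by exists (e0, u0).
by move=> p pP; exists (fun w => (p w).1), (fun w => (p w).2) => w /pP.
Qed.

Lemma spoke_cross A D m t u e : D \subset A -> spokes A D m t -> u \in D ->
  e \in within A u -> e \notin within D u -> exists w, [/\ w \in A :\: D, e = m w & t w = u].
Proof.
move=> DA sp uD eA eD; have ue : u \in ends e by move: eA; rewrite inE => /andP[].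
have [w [wu Ee]] := other_end ue; have [_ wA] := within_other (subsetP DA u uD) eA Ee.
have wD : w \notin D by apply: contra eD => wD; apply: within_pair Ee.
have wW : w \in A :\: D by rewrite inE wD.
have [AE mW Em tD] := sp w wW; exists w.
have em : e = m w.
  have : e \in within A w by apply: (@within_pair _ _ w u);
    [|exact: (subsetP DA)|rewrite setUC].
  rewrite AE => /setU1P[//|]; rewrite inE => /andP[_ /subsetP/(_ u ue)].
  by rewrite inE uD.
split=> //; apply/esym/(@pair_inj G w) => //; first by apply: contraTneq tD => <-.
by rewrite -Em -em Ee setUC.
Qed.

Lemma spoke_in A D m t w : D \subset A -> spokes A D m t -> w \in A :\: D ->
  m w \in within A (t w) :\: within D (t w).
Proof.
move=> DA sp wW; have /setDP[wA wD] := wW; have [_ _ Em tD] := sp w wW.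
rewrite inE; apply/andP; split.
  rewrite inE negb_and; apply/orP; right; apply/subsetPn; exists w => //.
  by rewrite Em set21.
by apply: (@within_pair _ _ (t w) w); [exact: (subsetP DA)| |rewrite setUC].
Qed.

Lemma spoke_inj A D m t w w' : spokes A D m t -> w \in A :\: D -> w' \in A :\: D ->
  m w = m w' -> w = w'.
Proof.
move=> sp wW wW' mm; have [_ _ Em _] := sp w wW; have [_ _ Em' tD] := sp w' wW'.
have : w \in ends (m w') by rewrite -mm Em set21.
rewrite Em' !inE => /orP[]/eqP // wt; have /setDP[_ /negP[]] := wW.
by rewrite wt.
Qed.

Lemma close_single A D m t v0 : conn A -> cubic A -> max_core A D -> spokes A D m t ->
  v0 \in A :\: D -> {in (A :\: D) :\ v0 &, injective t} -> exists c, valid A (fun=> set0) c.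
Proof.
move=> cA cu mc sp v0W tI; have [W2 nc _] := max_core_ring cA cu mc.
have [/and4P[DA D0 cD cW] _] := mc.
have [v1 [s [g1 [g2 [[ps v0s] WE [g12 Wv0] E1 E2]]]]] := ring_path v0W W2 nc.
set P := [set x in v1 :: s] in WE.
have v0P : v0 \notin P by rewrite inE.
have PE : (A :\: D) :\ v0 = P by rewrite WE setU1K.
have PW w : w \in P -> w \in A :\: D by move=> wP; rewrite WE in_setU wP orbT.
pose X := t @: P; pose u0 := t v0.
have [A0 m0 Em0 u0D] := sp v0 v0W; rewrite -/u0 in Em0 u0D.
have degX u : u \in D -> deg A u = deg D u + #|within A u :\: within D u|.
  move=> uD; rewrite /deg -(cardsID (within D u) (within A u)).
  by rewrite (setIidPr (withinS u DA)).
(* In D each foot in X has lost at least one edge, its spoke; [u0] has lost that of [v0], and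
   another one if it is in X. *)
have fD : fits D X u0.
  split=> // [u uD|].
    rewrite -(cu u (subsetP DA u uD)) degX // leq_add2l.
    have [/imsetP[w wP ->]|//] := boolP (u \in X).
    by rewrite card_gt0; apply/set0Pn; exists (m w); apply: spoke_in; rewrite // PW.
  rewrite -ltnS -(cu u0 (subsetP DA u0 u0D)) degX // -addnS leq_add2l.
  have m0c := spoke_in DA sp v0W.
  have [/imsetP[w wP uw]|_] := boolP (u0 \in X); last first.
    by rewrite card_gt0; apply/set0Pn; exists (m v0).
  apply/card_gt1P; exists (m v0), (m w); split=> //.
    by rewrite uw; apply: spoke_in; rewrite // PW.
  by apply: contraNneq v0P => /(spoke_inj sp v0W (PW w wP))->.
have [c0 [z [VD alt]]] := extends_fits fD.
have [F FP] : exists F : vertex G -> quad * quad, forall w, F w \in doubletons /\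
    forall p q, p != q -> palette D (rooted X u0 z) c0 (t w) = [set None; Some p; Some q] ->
    ~~ allowed (F w) p q.
  apply: (@fin_all_exists _ (fun=> (quad * quad)%type) (fun w Fw => Fw \in doubletons /\
    forall p q, p != q -> palette D (rooted X u0 z) c0 (t w) = [set None; Some p; Some q] ->
    ~~ allowed Fw p q)) => w.
  by have [F Fd Fp] := doubleton_of (palette D (rooted X u0 z) c0 (t w)); exists F.
have Fd : all [in doubletons] [seq F u | u <- v1 :: s].
  by apply/allP => _ /mapP[w _ ->]; case: (FP w).
have fin z' a x y : valid D (rooted X u0 z') c0 ->
    reach a [seq F u | u <- v1 :: s] (x, y) ->
    {in P, forall w p q, p != q ->
      palette D (rooted X u0 z') c0 (t w) = [set None; Some p; Some q] ->
      ~~ allowed (F w) p q} ->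
    uniq [:: z'; y; a] ->
    [set Some z'; Some y; Some a] != palette D (rooted X u0 z') c0 u0 ->
    exists c, valid A (fun=> set0) c.
  move=> V re FF uq pu.
  have DP : [disjoint D & P].
    by apply/pred0P => u /=; apply/negP => /andP[uD /PW]; rewrite inE uD.
  apply: (@close_ring G A D v0 v1 s g1 g2 m t c0 z' a x y F) => //.
  - by rewrite setUCA -WE -{1}(setID A D) (setIidPr DA).
  - by rewrite inE negb_or v0P andbT; case/setDP: v0W.
  - by move=> e; rewrite A0 Wv0 !inE.
  - rewrite /= !inE g12 andbT negb_or; move: m0; rewrite Wv0 !inE negb_or.
    by rewrite andbT.
  - by move=> w; rewrite -WE => /sp[].
  - move=> w wP; have [Aw mw Em tD] := sp w (PW w wP).
    apply/setP => e; rewrite in_set1; apply/idP/eqP => [/setDP[eS eP]|->].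
      have : e \in within A w.
        apply: (subsetP (@withinS _ (D :|: P) A w _)) eS.
        by rewrite subUset DA; apply/subsetP => u /PW/setDP[].
      rewrite Aw => /setU1P[//|eW]; case/negP: eP.
      move: eS eW; rewrite !inE => /andP[-> /subsetP eS] /andP[_ /subsetP eW] /=.
      apply/subsetP => u ue; have := eS u ue; have := eW u ue.
      by rewrite !inE => /andP[/negPf->].
    rewrite inE; apply/andP; split.
      rewrite inE negb_and; apply/orP; right; apply/subsetPn; exists (t w).
        by rewrite Em set22.
      by apply/negP => /PW; rewrite inE tD.
    by apply: (@within_pair _ _ w (t w)); rewrite ?in_setU ?wP ?tD ?orbT.
  - by move=> w w' wP wP'; apply: tI; rewrite PE.
(* If [None] occurs at [u0], then [v0] differs from [u0] and only needs three distinct colors. *)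
have [Nu|Nu] := boolP (None \in palette D (rooted X u0 z) c0 u0).
  have [a [[x y] /andP[re /and3P[/= az yz ay]]]] := reach_avoiding z Fd isT.
  apply: (fin z a x y) => //.
  - by move=> w _; case: (FP w).
  - by rewrite /= !inE negb_or eq_sym yz eq_sym az eq_sym ay.
  - by apply: contraTneq Nu => <-; rewrite !inE.
case: alt => [|[z' [zz V']]]; first by rewrite (negPf Nu).
have u0X : u0 \notin X.
  by apply: contra Nu => uX; rewrite /palette /rooted /promise uX !inE orbT.
(* Without [None] at [u0], no other spoke ends there: its palette is [Some z |: C] for a pair C of
   colors inside D. *)
have dD : deg D u0 = 2.
  have := degX u0 u0D; rewrite cu ?(subsetP DA) //.
  suff /eqP-> : #|within A u0 :\: within D u0| == 1 by rewrite addn1 => -[].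
  apply/cards1P; exists (m v0); apply/setP => e; rewrite in_set1.
  apply/idP/eqP => [/setDP[eA eD]|->]; last exact: spoke_in.
  have [w [wW -> tw]] := spoke_cross DA sp u0D eA eD.
  have : w \in v0 |: P by rewrite -WE.
  by case/setU1P => [->//|wP]; case/negP: u0X; rewrite -tw imset_f.
pose C := c0 @: within D u0.
have C2 : #|C| == 2.
  by rewrite card_in_imset ?dD -?[#|_|]/(deg D u0) ?dD //; case: (VD.1 u0 u0D).
have pz z1 : palette D (rooted X u0 z1) c0 u0 = Some z1 |: C.
  by rewrite /palette /rooted /promise (negPf u0X) eqxx set0U setUC.
have NC : None \notin C by apply: contra Nu => NC; rewrite pz inE NC orbT.
have Cz z1 : valid D (rooted X u0 z1) c0 -> Some z1 \notin C.
  move=> V1; have [_ /pred0P/(_ (Some z1))/=] := V1.1 u0 u0D.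
  by rewrite -/C /rooted eqxx !inE eqxx orbT andbT => ->.
have [F0 F0d CE] : exists2 F0, F0 \in doubletons & forall q, (Some q \in C)
  = (q \in [:: F0.1; F0.2]).
  have /cards2P[[g|] [[g'|] [gg CE]]] := C2; rewrite CE !inE ?eqxx ?orbT // in NC.
  have : ((g, g') \in doubletons) || ((g', g) \in doubletons).
    by move: gg; clear; case: g g' => [[] []] [[] []].
  case/orP => d; [exists (g, g')|exists (g', g)] => // q; rewrite CE !inE //=.
  by rewrite orbC.
have [a [[x y] /andP[re sepa]]] := reach_separated F0d Fd isT.
rewrite /= -!CE in sepa.
have ay : a != y by apply: contraNneq sepa => ->.
(* Since [u0] is not in X, replacing [z] by [z1] leaves the palettes of the other feet, and hence
   their forbidden pairs, unchanged. *)
have {}fin z1 : valid D (rooted X u0 z1) c0 -> z1 != a -> z1 != y ->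
    exists c, valid A (fun=> set0) c.
  move=> V1 za zy; apply: (fin z1 a x y) => //.
  - move=> w wP p q pq E; case: (FP w) => _; apply=> //; rewrite -E.
    apply: eq_palette => //; rewrite /rooted; case: eqP => // tw.
    by case/negP: u0X; rewrite -tw imset_f.
  - by rewrite /= !inE negb_or zy za eq_sym ay.
  - rewrite pz; apply/eqP => /setP E.
    have := E (Some a); have := E (Some y); rewrite !inE !eqxx ?orbT /=.
    have Sne (p q : quad) : p != q -> (Some p == Some q) = false.
      by move=> pq; apply/eqP => -[] /eqP; rewrite (negPf pq).
    rewrite !Sne 1?eq_sym // /= => yC aC.
    by rewrite -yC -aC in sepa.
(* The spoke color is not in C, so it differs from the one of [a] and [y] lying in C. If [z] equals
   the other one, then [z'] differs from both. *)
have ne z1 : valid D (rooted X u0 z1) c0 -> [|| (z1 != a) && (z1 != y), (Some a \in C)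
  && (z1 == y)
   | (Some y \in C) && (z1 == a)].
  move=> V1; move: sepa (Cz z1 V1); have [->|_] := eqVneq z1 a.
    by rewrite (negPf ay) /= => + /negPf aC; rewrite aC; case: (Some y \in C).
  have [->|_ //] := eqVneq z1 y.
  by rewrite /= => + /negPf yC; rewrite yC; case: (Some a \in C).
case/or3P: (ne z VD) => [/andP[za zy]|/andP[aC /eqP zy]|/andP[yC /eqP za]].
- exact: fin VD za zy.
- apply: (fin z') => //; last by rewrite -zy.
  by apply: contraTneq aC => <-; apply: Cz.
- apply: (fin z') => //; first by rewrite -za.
  by apply: contraTneq yC => <-; apply: Cz.
Qed.

End Spokes.

(** * Feet shared by several spokes *)

Definition colors : seq color := None :: [seq Some q | q <- quads].

Lemma mem_colors x : x \in colors.
Proof. by case: x => [[[] []]|]. Qed.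

Definition escapes (s t : seq color) : bool := has [predC t] s.

(* Colors for a 4-cycle w1 w3 w2 w4 with w1, w2 attached to u by al, be and w3, w4
   attached to u' by ga, de: y and y' are the colors of the remaining edges of u
   and u', and p, q, r, s those of w1w3, w1w4, w2w3, w2w4.  Colors al and ga are
   prescribed, so as to tell the palettes of u and u' from those in D. *)
Definition square_ok (y y' al be ga de p q r s : color) : bool :=
  let Su := [:: y; al; be] in let Su' := [:: y'; ga; de] in
  let S1 := [:: al; p; q] in let S2 := [:: be; r; s] in
  let S3 := [:: ga; p; r] in let S4 := [:: de; q; s] in
  all uniq [:: Su; Su'; S1; S2; S3; S4] &&
  all (fun st => escapes st.1 st.2)
    [:: (S1, Su); (S2, Su); (S3, Su'); (S4, Su'); (Su', Su);
        (S3, S1); (S3, S2); (S4, S1); (S4, S2)].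

Lemma square_colors y y' al ga : y != al -> y' != ga ->
  exists be de p q r s, square_ok y y' al be ga de p q r s.
Proof.
pose some (P : pred color) := find P colors < size colors.
have someP P : some P -> exists x, P x by rewrite /some -has_find => /hasP[x _]; exists x.
(* The search is restricted to p = be, which is possible as the edge w1w3 and the spoke of w2 have
   no common end. Conditionals and [find] cut each branch at its first conflict. *)
pose ck := all (fun y => all (fun y' => all (fun al => all (fun ga =>
  if (y == al) || (y' == ga) then true else
  some (fun be => if be \in [:: y; al; ga] then false else
  some (fun de => if de \in [:: y'; ga] then false else
  some (fun q => if q \in [:: al; be; de] then false else
  some (fun r => if r \in [:: be; ga] then false else
  some (fun s => square_ok y y' al be ga de be q r s))))))
  colors) colors) colors) colors.
have ckT : ck by vm_compute.
move: ckT => /allP/(_ y (mem_colors y))/allP/(_ y' (mem_colors y')).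
move=> /allP/(_ al (mem_colors al))/allP/(_ ga (mem_colors ga)) + ya yg.
rewrite (negPf ya) (negPf yg) orFb => /someP[be]; case: ifP => // _ /someP[de].
case: ifP => // _ /someP[q]; case: ifP => // _ /someP[r]; case: ifP => // _ /someP[s h].
by exists be, de, be, q, r, s.
Qed.

Lemma escapes_neq (s t : seq color) : escapes s t -> [set x in s] != [set x in t].
Proof.
by case/hasP => x xs /negP xt; apply/eqP => /setP/(_ x); rewrite !inE xs => /esym.
Qed.

Section DoubleSpokes.
Variable G : multigraph.
Implicit Types (u v w r : vertex G) (e : edge G) (A B D W X : {set vertex G}).
Implicit Types (c : edge G -> color) (m : vertex G -> edge G).
Implicit Types (L M N : seq (edge G * vertex G * color)).

Lemma half_cat L M v : half (L ++ M) v = half L v :|: half M v.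
Proof. by apply/setP => x; rewrite !inE has_cat. Qed.

Lemma half_at r L : (forall t, t \in L -> t.1.2 == r) ->
  half L r = [set x in [seq t.2 | t <- L]].
Proof.
move=> Lr; apply/setP => x; rewrite !inE;
  apply/hasP/mapP => [[t tL /andP[_ /eqP <-]]|[t tL ->]].
  by exists t.
by exists t; rewrite // Lr // eqxx.
Qed.

Lemma half_out v L : (forall t, t \in L -> t.1.2 != v) -> half L v = set0.
Proof.
move=> Lv; apply/setP => x; rewrite !inE; apply/hasP => -[t tL /andP[tv _]].
by move: (Lv t tL); rewrite tv.
Qed.

(** The half-edges in [L] become edges at r, those in [N] are new at r, and those in [M] remain
    elsewhere. An explicit coloring is built by passing from one list to the next. *)
Lemma add_root_half A B r c L M N (cols := [seq t.2 | t <- L ++ N]) :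
  A = r |: B -> r \notin B ->
  uniq [seq t.1.1 | t <- L] -> uniq cols ->
  within A r =i [seq t.1.1 | t <- L] ->
  (forall t, t \in L -> ends t.1.1 = [set r; t.1.2]) ->
  (forall t, t \in N -> t.1.2 == r) -> (forall t, t \in M -> t.1.2 != r) ->
  (forall t, t \in L -> t.2 \notin half M t.1.2) ->
  valid B (half (L ++ M)) c ->
  (forall t, t \in L -> [set x in cols] != palette B (half (L ++ M)) c t.1.2) ->
  exists c', [/\ valid A (half (N ++ M)) c',
    palette A (half (N ++ M)) c' r = [set x in cols] &
    {in B, forall v, palette A (half (N ++ M)) c' v = palette B (half (L ++ M)) c v}].
Proof.
move=> AE rB uE uC wE eE Nr Mr LM V dist.
have AB : A :\ r = B by rewrite AE setU1K.
have rA : r \in A by rewrite AE setU11.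
have NE := half_at Nr.
have colsE : [set x in [seq t.2 | t <- L]] :|: half N r = [set x in cols].
  by rewrite NE; apply/setP => x; rewrite !inE /cols map_cat mem_cat.
have : uniq ([seq t.2 | t <- L] ++ [seq t.2 | t <- N]) by rewrite -map_cat.
rewrite cat_uniq => /and3P[uL /hasPn LN _].
have hE : {in B, half (L ++ M) =1 fun v => half M v :|: half L v}.
  by move=> v _; rewrite half_cat setUC.
have pE v : v \in B -> palette B (fun v => half M v :|: half L v) c v =
    palette B (half (L ++ M)) c v.
  by move=> vB; apply: eq_palette; rewrite // hE.
have tB t : t \in L -> t.1.2 \in B.
  move=> tL; have er : t.1.1 \in within A r by rewrite wE; apply/mapP; exists t.
  by have [tr tA] := within_other rA er (eE t tL); rewrite -AB !inE tr.
have [|||c' [V' pr pB]] := @add_root_seq G A r (half M) (half N r) c L rA uE uL wE eE.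
- by rewrite AB; apply: valid_ext hE V.
- move=> t tL; rewrite LM // andbT NE inE; apply/negP => tN.
  by have := LN _ tN; rewrite map_f.
- by move=> t tL _; rewrite colsE AB pE ?tB //; apply: dist.
have h'E : {in A, (fun v => if v == r then half N r else half M v) =1 half (N ++ M)}.
  move=> v vA /=; rewrite half_cat; case: eqP => [->|/eqP vr].
    by rewrite [half M r]half_out ?setU0.
  rewrite [half N v]half_out ?set0U // => t tN; rewrite (eqP (Nr t tN)) eq_sym.
  exact: vr.
exists c'; split; first exact: valid_ext h'E V'.
  by rewrite -colsE -pr; apply/esym/eq_palette; rewrite // h'E.
move=> v vB; have vA : v \in A by rewrite AE inE vB orbT.
rewrite -pE // -{1}AB -pB ?AB //; by apply/esym/eq_palette; rewrite // h'E.
Qed.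

(** Two spokes leave at most one edge inside D; connectedness of D, which contains another foot,
    requires one. *)
Lemma double_spoke_deg A D m (t : vertex G -> vertex G) w1 w2 w : conn A -> cubic A ->
  max_core A D -> spokes A D m t -> w1 \in A :\: D -> w2 \in A :\: D ->
  w \in A :\: D -> w1 != w2 -> t w1 = t w2 -> t w != t w1 -> deg D (t w1) = 1.
Proof.
move=> cA cu [/and4P[DA D0 cD _] _] sp w1W w2W wW w12 tt tw.
have [_ _ _ uD] := sp w1 w1W; have [_ _ _ twD] := sp w wW.
have m12 : m w1 != m w2 by apply: contraNneq w12 => /(spoke_inj sp w1W w2W)->.
have c2 : 1 < #|within A (t w1) :\: within D (t w1)|.
  apply/card_gt1P; exists (m w1), (m w2); split=> //.
    exact: (spoke_in DA sp w1W).
  by rewrite tt; exact: (spoke_in DA sp w2W).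
have : #|within A (t w1)| = 3 by rewrite -[LHS]/(deg A (t w1)) cu // (subsetP DA).
rewrite -(cardsID (within D (t w1))) (setIidPr (withinS (t w1) DA)).
rewrite -[#|within D (t w1)|]/(deg D (t w1)).
have : deg D (t w1) != 0.
  by apply: contraNneq tw => /(conn_deg0 cD uD) E; move: twD; rewrite E => /set1P->.
by move: (deg D (t w1)) c2 => n; move: #|_| => k; clear; lia.
Qed.

Lemma double_spoke_adjacent A D m (t : vertex G -> vertex G) w1 w2 w : conn A -> cubic A ->
  max_core A D ->
  spokes A D m t -> w1 \in A :\: D -> w2 \in A :\: D -> w \in A :\: D ->
  w1 != w2 -> t w1 = t w2 -> t w != t w1 -> w1 != w -> adjacent w1 w.
Proof.
move=> cA cu mc sp w1W w2W wW w12 tt tw w1w.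
have [W2 nc W0] := max_core_ring cA cu mc.
have [/and4P[DA D0 cD _] maxD] := mc.
set W := A :\: D in w1W w2W wW W2 nc W0.
pose u := t w1; pose U := u |: W; pose Z := U :\ w.
have [A1 m1 Em1 uD] := sp w1 w1W; have [A2 m2 Em2 _] := sp w2 w2W.
have [Aw mw Emw twD] := sp w wW.
have uA := subsetP DA u uD.
have uW : u \notin W by rewrite inE uD.
have /setDP[wA wD] := wW.
have m12 : m w1 != m w2 by apply: contraNneq w12 => /(spoke_inj sp w1W w2W)->.
have mU x : x \in W -> t x = u -> m x \in within U u.
  move=> xW tx; have [_ _ Ex _] := sp x xW.
  by apply: (@within_pair _ _ u x); rewrite ?setU11 ?in_setU ?xW ?orbT // setUC Ex tx.
have degu : deg D u = 1 by apply: (double_spoke_deg cA cu mc sp w1W w2W wW).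
(* Exchanging the foot u and the vertex w of the cycle gives another maximal core,
   so A :\: (w |: D :\ u) is 2-regular. *)
have cDu := conn_del_leaf cD uD degu.
have twDu : t w \in D :\ u by rewrite !inE tw.
have tww : adjacent (t w) w by apply/adjacentP; exists (m w); rewrite Emw setUC.
have cD1 := conn_grow cDu twDu tww.
have ZE : A :\: (w |: D :\ u) = Z.
  apply/setP => x; rewrite !inE; case: (x =P w) => //= _; case: (x =P u) => [->|_] //=.
have degUw : deg U w = 2.
  rewrite -(W2 w wW); apply: eq_card => e; apply/idP/idP; last first.
    by apply/subsetP/withinS; rewrite subsetUr.
  move=> eU; have : e \in within A w.
    apply: subsetP eU; apply: withinS; rewrite subUset sub1set uA; exact: subsetDl.
  rewrite Aw => /setU1P[em|//]; move: eU; rewrite inE => /andP[_ /subsetP/(_ (t w))].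
  by rewrite em Emw set22 !inE (negPf tw) twD => /(_ isT).
have cardZ : #|Z| = #|W|.
  have wU : w \in U by rewrite in_setU wW orbT.
  by have := cardsD1 w U; rewrite wU {1}/U cardsU1 uW => -[].
(* W has as many edges as vertices; adding u brings at least two edges and deleting w removes two,
   so Z has at least as many edges as vertices. *)
have cycZ : cyclic Z.
  apply: contraT => nZ; have Z0 : Z != set0 by rewrite -card_gt0 cardZ card_gt0.
  have := acyclic_edge_count nZ Z0; rewrite cardZ.
  have := handshake W; rewrite (eq_bigr (fun=> 2)) => [|x /W2 //].
  rewrite sum_nat_const.
  have := edge_countD1 U w; rewrite -/Z degUw.
  have := edge_countD1 U u; rewrite /U setU1K // -/U.
  have : 1 < deg U u.
    by apply/card_gt1P; exists (m w1), (m w2); split=> //; apply: mU.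
  move: #|W| (edge_count W) (edge_count U) (edge_count Z) (deg U u); clear; lia.
have core1 : core A (w |: D :\ u).
  rewrite /core ZE cycZ cD1 !andbT subUset sub1set wA (subset_trans (subD1set _ _) DA) /=.
  by apply/set0Pn; exists w; rewrite setU11.
have mc1 : max_core A (w |: D :\ u).
  split=> // D' /maxD; rewrite cardsU1 !inE (negPf wD) andbF /=.
  by rewrite (cardsD1 u D) uD.
have [Z2 _ _] := max_core_ring cA cu mc1; rewrite ZE in Z2.
have w1Z : w1 \in Z by rewrite in_setD1 w1w in_setU w1W orbT.
(* With its spoke, [w1] has three edges in U but only two in Z = U - w, so one of them ends at w. *)
have : 2 < deg U w1.
  rewrite -(W2 w1 w1W); apply/proper_card/properP; split.
    by apply: withinS; apply: subsetUr.
  exists (m w1) => //; apply: (@within_pair _ _ w1 u) => //.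
    by rewrite in_setU w1W orbT.
  exact: setU11.
rewrite (degD1 U w1w) -/Z Z2 // -[X in X < _]addn0 ltn_add2l card_gt0.
case/set0Pn => e /setIP[]; rewrite !inE => /andP[w1e _] /andP[we _].
apply/adjacentP; exists e; apply/esym/eqP; rewrite eqEcard card_ends cards2 w1w andbT.
by rewrite subUset !sub1set w1e.
Qed.

End DoubleSpokes.

(** * A 4-cycle attached to two vertices *)

Section Square.
Variable G : multigraph.
Implicit Types (u v w r d : vertex G) (e f : edge G) (A B D W X Y : {set vertex G}).
Implicit Types (s : seq (vertex G)) (c : edge G -> color) (m : vertex G -> edge G).
Implicit Types (L M N Q R : seq (edge G * vertex G * color)).

Lemma half_eq L M : L =i M -> half L =1 half M.
Proof. by move=> LM v; apply/setP => x; rewrite !inE; apply: eq_has_r. Qed.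

Lemma add_root_list A B r c L M N Q R (cols := [seq t.2 | t <- L ++ N]) :
  A = r |: B -> r \notin B -> Q =i L ++ M -> R =i N ++ M ->
  uniq [seq t.1.1 | t <- L] -> uniq cols ->
  within A r =i [seq t.1.1 | t <- L] ->
  (forall t, t \in L -> ends t.1.1 = [set r; t.1.2]) ->
  (forall t, t \in N -> t.1.2 == r) -> (forall t, t \in M -> t.1.2 != r) ->
  (forall t, t \in L -> t.2 \notin half M t.1.2) ->
  valid B (half Q) c ->
  (forall t, t \in L -> [set x in cols] != palette B (half Q) c t.1.2) ->
  exists c', [/\ valid A (half R) c',
    palette A (half R) c' r = [set x in cols] &
    {in B, forall v, palette A (half R) c' v = palette B (half Q) c v}].
Proof.
move=> AE rB QE RE uE uC wE eE Nr Mr LM V dist.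
have pQ v : palette B (half (L ++ M)) c v = palette B (half Q) c v.
  by apply: eq_palette; rewrite // (half_eq QE).
have [|t tL|c' [V' p1 p2]] := add_root_half (c := c) AE rB uE uC wE eE Nr Mr LM.
- by apply: valid_ext V => v _; apply: half_eq.
- by rewrite pQ; apply: dist.
have pR v : palette A (half R) c' v = palette A (half (N ++ M)) c' v.
  by apply: eq_palette; rewrite // (half_eq RE).
exists c'; split.
- by apply: valid_ext V' => v _; rewrite (half_eq RE).
- by rewrite pR p1.
- by move=> v vB; rewrite pR p2 // pQ.
Qed.

Lemma within_card3 A w e1 e2 e3 : deg A w = 3 -> uniq [:: e1; e2; e3] ->
  e1 \in within A w -> e2 \in within A w -> e3 \in within A w ->
  within A w =i [:: e1; e2; e3].
Proof.
move=> dw uq i1 i2 i3.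
have sub : {subset [:: e1; e2; e3] <= within A w} by apply/allP; rewrite /= i1 i2 i3.
by apply: fsym; apply: subset_cardP; [rewrite (card_uniqP uq) -[RHS]/(deg A w)
  dw|apply/subsetP].
Qed.

Lemma set_half_edge D h c u p f (H : {set color}) : u \in D -> valid D h c ->
  within D u = [set f] -> ends f = [set u; p] -> c f \notin H ->
  c f |: H != palette D h c p ->
  valid D (fun v => if v == u then H else h v) c.
Proof.
move=> uD V Wf Ef fH neq; apply: set_half => //.
  by rewrite Wf imset_set1 disjoints1.
move=> v vD uv _; rewrite Wf imset_set1.
have [e [Ee eu _]] := adjacent_edge uD vD uv.
have /set1P ef : e \in [set f] by rewrite -Wf.
suff -> : v = p by [].
apply: (@pair_inj G u); [exact: adjacent_neq uv| |by rewrite -Ee ef Ef].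
by have := card_ends f; rewrite Ef cards2; case: eqVneq.
Qed.

(** Each of [w1], [w2] is adjacent to each of [w3], [w4], and the resulting 4-cycle exhausts the
    complement of D, since deleting any vertex outside it would leave a cycle. *)
Lemma double_spokes_valid A D m (t : vertex G -> vertex G) w1 w2 w3 w4 :
  conn A -> cubic A -> max_core A D -> spokes A D m t ->
  uniq [:: w1; w2; w3; w4] -> {subset [:: w1; w2; w3; w4] <= A :\: D} ->
  t w1 = t w2 -> t w3 = t w4 -> t w3 != t w1 -> exists c, valid A (fun=> set0) c.
Proof.
move=> cA cu mc sp uw sw t12 t34 t31.
have [/and4P[DA D0 cD _] _] := mc.
have [W2 nc _] := max_core_ring cA cu mc.
have [w1W w2W w3W w4W] : [/\ w1 \in A :\: D, w2 \in A :\: D, w3 \in A :\: D & w4 \in A :\: D].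
  by split; apply: sw; rewrite !inE eqxx ?orbT.
have [n12 n13 n14 [n23 n24 n34]] : [/\ w1 != w2, w1 != w3, w1 != w4 & [/\ w2 != w3,
  w2 != w4 & w3 != w4]].
  by move: uw; rewrite /= !inE !negb_or -!andbA => /and5P[-> -> -> ->] /andP[-> /andP[-> _]].
have [u uE1] : exists u, t w1 = u by exists (t w1).
have [u' uE3] : exists u', t w3 = u' by exists (t w3).
have uE2 : t w2 = u by rewrite -t12.
have uE4 : t w4 = u' by rewrite -t34.
have uu : u' != u by rewrite -uE1 -uE3.
have uu' : u != u' by rewrite eq_sym.
have [_ m1 Em1 uD] := sp w1 w1W; have [_ m2 Em2 _] := sp w2 w2W.
have [_ m3 Em3 u'D] := sp w3 w3W; have [_ m4 Em4 _] := sp w4 w4W.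
rewrite uE1 in Em1 uD; rewrite uE2 in Em2; rewrite uE3 in Em3 u'D; rewrite uE4 in Em4.
have du : deg D u = 1.
  by rewrite -uE1; apply: (double_spoke_deg cA cu mc sp w1W w2W w3W n12 t12 t31).
have du' : deg D u' = 1.
  by rewrite -uE3; apply: (double_spoke_deg cA cu mc sp w3W w4W w1W n34 t34); rewrite eq_sym.
have adj w v : w \in [:: w1; w2] -> v \in [:: w3; w4] -> adjacent w v.
  have n21 : w2 != w1 by rewrite eq_sym.
  rewrite !inE => /orP[]/eqP-> /orP[]/eqP->.
  - by apply: (double_spoke_adjacent cA cu mc sp w1W w2W w3W); rewrite ?uE1 ?uE2 ?uE3 ?uE4.
  - by apply: (double_spoke_adjacent cA cu mc sp w1W w2W w4W); rewrite ?uE1 ?uE2 ?uE3 ?uE4.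
  - by apply: (double_spoke_adjacent cA cu mc sp w2W w1W w3W); rewrite ?uE1 ?uE2 ?uE3 ?uE4.
  - by apply: (double_spoke_adjacent cA cu mc sp w2W w1W w4W); rewrite ?uE1 ?uE2 ?uE3 ?uE4.
have /adjacentP[e13 E13] : adjacent w1 w3 by apply: adj; rewrite !inE eqxx ?orbT.
have /adjacentP[e14 E14] : adjacent w1 w4 by apply: adj; rewrite !inE eqxx ?orbT.
have /adjacentP[e23 E23] : adjacent w2 w3 by apply: adj; rewrite !inE eqxx ?orbT.
have /adjacentP[e24 E24] : adjacent w2 w4 by apply: adj; rewrite !inE eqxx ?orbT.
have {adj t12 t34 t31} [d1 d2 d3 d4] : [/\ w1 \notin D, w2 \notin D,
  w3 \notin D & w4 \notin D].
  by split; [case/setDP: w1W|case/setDP: w2W|case/setDP: w3W|case/setDP: w4W].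
have ne w v : w \notin D -> v \in D -> w != v by move=> wD vD; apply: contraNneq wD => ->.
have [nu1 nu2 nu3 nu4] : [/\ w1 != u, w2 != u, w3 != u & w4 != u] by split; apply: ne.
have [nv1 nv2 nv3 nv4] : [/\ w1 != u', w2 != u', w3 != u' & w4 != u'] by split; apply: ne.
pose A1 := w1 |: D; pose A2 := w2 |: A1; pose A3 := w3 |: A2; pose A4 := w4 |: A3.
have inA4 w : (w \in A4) = [|| w == w4, w == w3, w == w2, w == w1 | w \in D].
  by rewrite !in_setU1.
have Y0 : A4 \subset A.
  apply/subsetP => w; rewrite inA4 => /or4P[/eqP->|/eqP->|/eqP->|/orP[/eqP->|/(subsetP DA)//]];
  by [case/setDP: w4W|case/setDP: w3W|case/setDP: w2W|case/setDP: w1W].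
have e_sep e f w v x : ends e = [set w; v] -> ends f = [set w; x] -> v != w -> v != x ->
  e != f.
  move=> Ee Ef vw vx; apply/eqP => ef; have : v \in ends f by rewrite -ef Ee set22.
  by rewrite Ef !inE (negPf vw) (negPf vx).
have sy (x y : vertex G) : x != y -> (x == y = false) * (y == x = false).
  by move=> xy; rewrite [y == x]eq_sym (negPf xy).
have neE := (sy _ _ n12, sy _ _ n13, sy _ _ n14, sy _ _ n23, sy _ _ n24, sy _ _ n34,
  (sy _ _ nu1, sy _ _ nu2, sy _ _ nu3, sy _ _ nu4, sy _ _ nv1, sy _ _ nv2, sy _ _ nv3,
   sy _ _ nv4, sy _ _ uu)).
have E31 : ends e13 = [set w3; w1] by rewrite E13 setUC.
have E41 : ends e14 = [set w4; w1] by rewrite E14 setUC.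
have E32 : ends e23 = [set w3; w2] by rewrite E23 setUC.
have E42 : ends e24 = [set w4; w2] by rewrite E24 setUC.
have u1 : uniq [:: m w1; e13; e14].
  by rewrite /= !inE negb_or (e_sep _ _ _ _ _ Em1 E13) ?(e_sep _ _ _ _ _ Em1 E14)
    ?(e_sep _ _ _ _ _ E13 E14) ?neE.
have u2 : uniq [:: m w2; e23; e24].
  by rewrite /= !inE negb_or (e_sep _ _ _ _ _ Em2 E23) ?(e_sep _ _ _ _ _ Em2 E24)
    ?(e_sep _ _ _ _ _ E23 E24) ?neE.
have u3 : uniq [:: m w3; e13; e23].
  by rewrite /= !inE negb_or (e_sep _ _ _ _ _ Em3 E31) ?(e_sep _ _ _ _ _ Em3 E32)
    ?(e_sep _ _ _ _ _ E31 E32) ?neE.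
have u4 : uniq [:: m w4; e14; e24].
  by rewrite /= !inE negb_or (e_sep _ _ _ _ _ Em4 E41) ?(e_sep _ _ _ _ _ Em4 E42)
    ?(e_sep _ _ _ _ _ E41 E42) ?neE.
have AE : A = A4.
  apply/eqP; rewrite eqEsubset Y0 andbT; apply/subsetP => w wA.
  apply: contraT; rewrite inA4 !negb_or => /and5P[x4 x3 x2 x1 wD].
  have wW : w \in A :\: D by rewrite inE wD.
  case/negP: (nc w wW); pose Y := [set x in [:: w1; w2; w3; w4]].
  have wY x : x \in [:: w1; w2; w3; w4] -> x \in Y by move=> xs; rewrite in_set.
  have [y1 y2 y3 y4] : [/\ w1 \in Y, w2 \in Y, w3 \in Y & w4 \in Y].
    by split; apply: wY; rewrite !inE eqxx ?orbT.
  apply: (cyclicP y1).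
    rewrite subsetD1; apply/andP; split; first by apply/subsetP => x; rewrite inE => /sw.
    by rewrite !inE (negPf x1) (negPf x2) (negPf x3).
  move=> x; rewrite in_set !in_cons in_nil orbF => /or4P[]/eqP->; apply/card_gt1P.
  - by exists e13, e14; split; [exact: within_pair E13|exact: within_pair E14|];
      move: u1; rewrite /= !inE => /and3P[].
  - by exists e23, e24; split; [exact: within_pair E23|exact: within_pair E24|];
      move: u2; rewrite /= !inE => /and3P[].
  - by exists e13, e23; split; [exact: within_pair E31|exact: within_pair E32|];
      move: u3; rewrite /= !inE => /and3P[].
  - by exists e14, e24; split; [exact: within_pair E41|exact: within_pair E42|];
      move: u4; rewrite /= !inE => /and3P[].
have [a1 a2 a3 a4] : [/\ w1 \in A4, w2 \in A4, w3 \in A4 & w4 \in A4].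
  by rewrite !inA4 !eqxx ?orbT.
have [au av] : u \in A4 /\ u' \in A4 by rewrite !inA4 uD u'D !orbT.
have cu4 w : w \in A4 -> deg A4 w = 3 by rewrite -AE; apply: cu.
have I1 : within A4 w1 =i [:: m w1; e13; e14].
  by apply: within_card3 => //; [exact: cu4|exact: within_pair Em1|exact: within_pair
    E13|exact: within_pair E14].
have I2 : within A4 w2 =i [:: m w2; e23; e24].
  by apply: within_card3 => //; [exact: cu4|exact: within_pair Em2|exact: within_pair
    E23|exact: within_pair E24].
have I3 : within A4 w3 =i [:: m w3; e13; e23].
  by apply: within_card3 => //; [exact: cu4|exact: within_pair Em3|exact: within_pair
    E31|exact: within_pair E32].
have I4 : within A4 w4 =i [:: m w4; e14; e24].
  by apply: within_card3 => //; [exact: cu4|exact: within_pair Em4|exact: within_pair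
    E41|exact: within_pair E42].
have A34 : A3 \subset A4 by apply: subsetUr.
have A24 : A2 \subset A4 by apply: subset_trans (subsetUr _ _) A34.
have A14 : A1 \subset A4 by apply: subset_trans (subsetUr _ _) A24.
have wl1 : w2 \notin A1 by rewrite in_setU1 negb_or d2 andbT eq_sym.
have wl2 : w3 \notin A2 by rewrite !in_setU1 !neE /= d3.
have wl3 : w4 \notin A3 by rewrite !in_setU1 !neE /= d4.
have wl31 : w3 \notin A1 by rewrite !in_setU1 !neE /= d3.
have wl41 : w4 \notin A1 by rewrite !in_setU1 !neE /= d4.
have wl42 : w4 \notin A2 by rewrite !in_setU1 !neE /= d4.
have out (X : {set vertex G}) w e v x : v \notin X -> ends e = [set x; v] ->
  e \notin within X w.
  move=> vX Ee; rewrite inE negb_and; apply/orP; right; apply/subsetPn.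
  by exists v; rewrite // Ee set22.
have J1 : within A1 w1 =i [:: m w1].
  move=> e; apply/idP/idP => [eA|].
    have := subsetP (withinS w1 A14) e eA;
      rewrite I1 !in_cons => /or3P[->//|/eqP E|/orP[/eqP E|//]].
      by move: eA; rewrite E (negPf (out _ _ _ _ _ wl31 E13)).
    by move: eA; rewrite E (negPf (out _ _ _ _ _ wl41 E14)).
  by rewrite in_cons orbF => /eqP->; apply: within_pair Em1; rewrite in_setU1 ?eqxx ?uD ?orbT.
have J2 : within A2 w2 =i [:: m w2].
  move=> e; apply/idP/idP => [eA|].
    have := subsetP (withinS w2 A24) e eA;
      rewrite I2 !in_cons => /or3P[->//|/eqP E|/orP[/eqP E|//]].
      by move: eA; rewrite E (negPf (out _ _ _ _ _ wl2 E23)).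
    by move: eA; rewrite E (negPf (out _ _ _ _ _ wl42 E24)).
  by rewrite in_cons orbF => /eqP->; apply: within_pair Em2; rewrite !in_setU1 ?eqxx ?uD ?orbT.
have J3 : within A3 w3 =i [:: m w3; e13; e23].
  move=> e; rewrite -I3; apply/idP/idP; first exact/subsetP/withinS.
  rewrite I3 !in_cons orbF => /or3P[]/eqP->.
  - by apply: within_pair Em3; rewrite !in_setU1 ?eqxx ?u'D ?orbT.
  - by apply: within_pair E31; rewrite !in_setU1 ?eqxx ?orbT.
  - by apply: within_pair E32; rewrite !in_setU1 ?eqxx ?orbT.
(* Only the colors of edges inside D are kept from this coloring; the half-edges at [u] and [u'] are
   replaced below. *)
have fD : fits D set0 u.
  by split=> // [v vD|]; rewrite inE addn0 ?du // -(cu v (subsetP DA v vD)) deg_le.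
have [c0 [z [V _]]] := extends_fits fD; set h0 := rooted _ _ _ in V.
have h0c v : #|h0 v| <= 1.
  rewrite /h0 /rooted /promise inE set0U; case: ifP; by rewrite ?cards1 ?cards0.
have nbr v : deg D v = 1 -> exists f p, [/\ within D v = [set f], ends f = [set v; p],
    p != v, p \in D & c0 f \in palette D h0 c0 p].
  move=> /eqP/cards1P[f Wf]; have fv : f \in within D v by rewrite Wf set11.
  have vf : v \in ends f by move: fv; rewrite inE => /andP[].
  have [p [pv Ef]] := other_end vf; exists f, p.
  have [_ pD] := within_other (within_sub fv) fv Ef.
  split=> //; rewrite inE imset_f //.
  by apply: (@within_pair _ _ p v); rewrite ?(within_sub fv) // setUC.
have free p : p \in D -> exists x, x \notin palette D h0 c0 p.
  move=> pD; have [||x [xp _]] := @avoid set0 (palette D h0 c0 p) [::]; first exact: sub0set.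
    rewrite addn0 ltnS; apply: leq_trans (palette_card _ _ _ _) _.
    rewrite -(addn1 3) leq_add // -(cu p (subsetP DA p pD)); exact: deg_le.
  by exists x.
have [f [p [Wf Ef pu pD yp]]] := nbr u du.
have [f' [p' [Wf' Ef' pu' pD' yp']]] := nbr u' du'.
(* A spoke of [u] gets a color missing at its neighbor [p] in D, which separates [u] from [p]
   whatever the other spoke is; likewise for [u'] and [p']. *)
have [al alp] := free p pD; have [ga gap] := free p' pD'.
have ya : c0 f != al by apply: contraNneq alp => <-.
have yg : c0 f' != ga by apply: contraNneq gap => <-.
have [be [de [x13 [x14 [x23 [x24]]]]]] := square_colors ya yg.
case/andP; rewrite [all uniq _]/= => /and5P[q0 q0' q1 q2 /and3P[q3 q4 _]].
case/and5P => /escapes_neq s1u /escapes_neq s2u /escapes_neq s3u /escapes_neq s4u.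
case/and5P => /escapes_neq su'u /escapes_neq s31 /escapes_neq s32 /escapes_neq s41.
rewrite andbT => /escapes_neq s42.
have set3 (a b d : color) : [set x in [:: a; b; d]] = a |: [set b; d].
  by apply/setP => x; rewrite !inE.
have fal : c0 f \notin [set al; be].
  by move: q0; rewrite /= !inE => /andP[].
have fga : c0 f' \notin [set ga; de].
  by move: q0'; rewrite /= !inE => /andP[].
have V1 := set_half_edge uD V Wf Ef fal _.
have {}V1 : valid D (fun v => if v == u then [set al; be] else h0 v) c0.
  by apply: V1; apply: contraNneq alp => <-; rewrite !inE eqxx orbT.
have V2 := set_half_edge u'D V1 Wf' Ef' fga _.
have {}V2 : valid D (fun v => if v == u' then [set ga; de] else
    if v == u then [set al; be] else h0 v) c0.
  (* When the two feet are adjacent, the palette of [u] has changed, and it is the choice of colors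
     for the square that separates them. *)
  apply: V2; have [E|pu2] := eqVneq p' u.
    by rewrite E /palette eqxx Wf imset_set1 -!set3.
  apply: contraNneq gap; rewrite /palette (negPf pu2) => <-.
  by rewrite !inE eqxx orbT.
pose Q0 := [:: (m w1, u, al); (m w2, u, be); (m w3, u', ga); (m w4, u', de)].
have hQ v : half Q0 v = if v == u' then [set ga; de] else
    if v == u then [set al; be] else set0.
  rewrite /Q0 !half_cons half_nil !setU0; case: (v =P u) => [->|_].
    by rewrite neE !setU0.
  by rewrite !set0U; case: (v == u'); rewrite ?setU0.
have {}V2 : valid D (half Q0) c0.
  apply: valid_ext V2 => v vD; rewrite hQ; case: eqP => // _; case: (v =P u) => // /eqP vu.
  by rewrite /h0 /rooted /promise inE (negPf vu) setU0.
have Pu : palette D (half Q0) c0 u = [set x in [:: c0 f; al; be]].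
  by rewrite /palette Wf imset_set1 hQ neE eqxx set3.
have Pu' : palette D (half Q0) c0 u' = [set x in [:: c0 f'; ga; de]].
  by rewrite /palette Wf' imset_set1 hQ eqxx set3.
have [be_al de_ga] : be != al /\ de != ga.
  move: q0 q0'; rewrite /= !inE => /and3P[_ ab _] /and3P[_ gd _].
  by rewrite eq_sym ab eq_sym gd.
have [x1314 x2324] : x14 != x13 /\ x24 != x23.
  move: q1 q2; rewrite /= !inE => /and3P[_ ab _] /and3P[_ gd _].
  by rewrite eq_sym ab eq_sym gd.
pose Q1 := [:: (e13, w1, x13); (e14, w1, x14); (m w2, u, be); (m w3, u', ga); (m w4, u', de)].
have [|||||||||k1 [K1 k1w k1D]] := @add_root_list A1 D w1 c0 [:: (m w1, u, al)]
  [:: (m w2, u, be); (m w3, u', ga); (m w4, u', de)] [:: (e13, w1, x13); (e14, w1, x14)]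
  Q0 Q1 erefl d1 (fun=> erefl) (fun=> erefl).
- by [].
- exact: q1.
- exact: J1.
- by move=> t0; rewrite inE => /eqP->.
- by apply/allP; rewrite /= !eqxx.
- by apply/allP; rewrite /= !neE.
- by apply/allP; rewrite /= !inE /= !neE eqxx (negPf be_al).
- exact: V2.
- by apply/allP; rewrite /= Pu s1u.
pose Q2 := [:: (e23, w2, x23); (e24, w2, x24); (e13, w1, x13); (e14, w1, x14);
  (m w3, u', ga); (m w4, u', de)].
have [||||||||||k2 [K2 k2w k2D]] := @add_root_list A2 A1 w2 k1 [:: (m w2, u, be)]
  [:: (e13, w1, x13); (e14, w1, x14); (m w3, u', ga); (m w4, u', de)]
  [:: (e23, w2, x23); (e24, w2, x24)] Q1 Q2 erefl wl1 _ (fun=> erefl).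
- by move=> q; rewrite !inE; do ?[case: (q == _) => //].
- by [].
- exact: q2.
- exact: J2.
- by move=> t0; rewrite inE => /eqP->.
- by apply/allP; rewrite /= !eqxx.
- by apply/allP; rewrite /= !neE.
- by apply/allP; rewrite /= !inE /= !neE.
- exact: K1.
- by apply/allP; rewrite /= k1D // Pu s2u.
pose Q3 := [:: (m w4, u', de); (e14, w1, x14); (e24, w2, x24)].
have uA1 : u' \in A1 by rewrite in_setU1 u'D orbT.
have [w1A1 w1A2 w2A2] : [/\ w1 \in A1, w1 \in A2 & w2 \in A2] by rewrite !in_setU1 !eqxx ?orbT.
have uA2 : u' \in A2 by rewrite in_setU1 uA1 orbT.
have [||||||||||k3 [K3 k3w k3D]] := @add_root_list A3 A2 w3 k2
  [:: (m w3, u', ga); (e13, w1, x13); (e23, w2, x23)] Q3 [::] Q2 Q3 erefl wl2 _ (fun=> erefl).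
- by move=> q; rewrite !inE; do ?[case: (q == _) => //].
- exact: u3.
- exact: q3.
- exact: J3.
- by move=> t0; rewrite !inE => /or3P[]/eqP->.
- by [].
- by apply/allP; rewrite /= !neE.
- apply/allP; rewrite /= !inE /= !neE !eqxx /= ?orbF.
  by rewrite de_ga x1314 x2324.
- exact: K2.
- apply/allP; rewrite /= k2D // k1D // Pu' s3u k2D // k1w k2w s31.
  by rewrite s32.
have [|||||||||k4 [K4 _ _]] := @add_root_list A4 A3 w4 k3 Q3 [::] [::] Q3 [::] erefl wl3
  (fun=> erefl) (fun=> erefl).
- exact: u4.
- exact: q4.
- exact: I4.
- by move=> t0; rewrite !inE => /or3P[]/eqP->.
- by [].
- by [].
- by apply/allP; rewrite /= !inE.
- exact: K3.
- have [uA3 w1A3 w2A3] : [/\ u' \in A3, w1 \in A3 & w2 \in A3].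
    by rewrite !(in_setU1 _ w3) uA2 w1A2 w2A2 !orbT.
  apply/allP; rewrite /= !k3D // k2D // k1D // Pu' s4u k2D // k1w k2w s41.
  by rewrite s42.
by exists k4; rewrite AE; apply: valid_ext K4 => v _; rewrite half_nil.
Qed.

End Square.

(** * Existence of the coloring *)

Section Existence.
Variable G : multigraph.
Implicit Types (u v w r d : vertex G) (e f : edge G) (A B D W X : {set vertex G}).
Implicit Types (s : seq (vertex G)) (c : edge G -> color) (m : vertex G -> edge G).

(** The common foot u has no edge inside D, so D is reduced to u, and every vertex of the cycle is
    one of the three: A is K4. *)
Lemma triple_spoke_valid A D m (t : vertex G -> vertex G) w1 w2 w3 :
  conn A -> cubic A -> max_core A D -> spokes A D m t ->
  uniq [:: w1; w2; w3] -> {subset [:: w1; w2; w3] <= A :\: D} ->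
  t w1 = t w2 -> t w1 = t w3 -> exists c, valid A (fun=> set0) c.
Proof.
move=> cA cu mc sp uw sw t12 t13.
have [/and4P[DA D0 cD _] _] := mc.
have [W2 nc _] := max_core_ring cA cu mc.
have [w1W w2W w3W] : [/\ w1 \in A :\: D, w2 \in A :\: D & w3 \in A :\: D].
  by split; apply: sw; rewrite !inE eqxx ?orbT.
have [n12 n13 n23] : [/\ w1 != w2, w1 != w3 & w2 != w3].
  by move: uw; rewrite /= !inE !negb_or => /and3P[/andP[-> ->] -> _].
have [u uE] : exists u, t w1 = u by exists (t w1).
have [_ _ _ uD] := sp w1 w1W; rewrite uE in uD.
have uA := subsetP DA u uD.
have mu w : w \in A :\: D -> t w = u -> m w \in within A u :\: within D u.
  by move=> wW tw; rewrite -tw; apply: (spoke_in DA sp wW).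
have um : uniq [:: m w1; m w2; m w3].
  rewrite /= !inE negb_or; apply/and3P; split=> //.
    apply/andP; split; first by apply: contraNneq n12 => /(spoke_inj sp w1W w2W)->.
    by apply: contraNneq n13 => /(spoke_inj sp w1W w3W)->.
  by apply: contraNneq n23 => /(spoke_inj sp w2W w3W)->.
have [k1 k2 k3] : [/\ m w1 \in within A u :\: within D u, m w2 \in within A u :\: within D u &
    m w3 \in within A u :\: within D u].
  by split; apply: mu; rewrite // -?t12 -?t13.
have Iu : within A u =i [:: m w1; m w2; m w3].
  by apply: within_card3 um _ _ _; [exact: cu|case/setDP: k1|case/setDP: k2|case/setDP: k3].
have Du0 : deg D u = 0.
  apply/eqP; rewrite cards_eq0; apply/eqP/setP => e; rewrite [RHS]in_set0.
  apply/negP => eD; have := subsetP (withinS u DA) e eD; rewrite Iu !in_cons orbF.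
  by case/or3P => /eqP E; [case/setDP: k1|case/setDP: k2|case/setDP: k3]; rewrite -E eD.
have DE := conn_deg0 cD uD Du0.
have tu w : w \in A :\: D -> t w = u.
  by move=> wW; have [_ _ _] := sp w wW; rewrite {1}DE => /set1P.
have WE w : w \in A :\: D -> w \in [:: w1; w2; w3].
  move=> wW; have := mu w wW (tu w wW); rewrite in_setD Iu !in_cons !orbF.
  case/andP => _ /or3P[]/eqP; [move/(spoke_inj sp wW w1W)|move/(spoke_inj sp wW w2W)|
    move/(spoke_inj sp wW w3W)] => ->; by rewrite eqxx ?orbT.
have [v1 [s [g1 [g2 [[ps v0s] RE [g12 Wv0] E1 E2]]]]] := ring_path w1W W2 nc.
have vs w : w \in v1 :: s -> w \in A :\: D by rewrite RE in_setU in_set => ->; rewrite orbT.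
have in2 w : w != w1 -> w \in A :\: D -> w \in v1 :: s.
  by move=> ww; rewrite RE in_setU1 (negPf ww) in_set.
have w2s : w2 \in v1 :: s by apply: in2; rewrite // eq_sym.
have w3s : w3 \in v1 :: s by apply: in2; rewrite // eq_sym.
have [x sx] : exists x, s = [:: x].
  case: s ps v0s RE E2 vs in2 w2s w3s => [|x s] ps v0s RE E2 vs in2 w2s w3s.
    by move: n23; move: w2s w3s; rewrite !inE => /eqP-> /eqP->; rewrite eqxx.
  exists x; case: s ps v0s RE E2 vs in2 w2s w3s => // y s [v1n _ [xn _ _]]
    v0s RE E2 vs in2 w2s w3s.
  have in23 w : w \in [:: v1, x, y & s] -> w = w2 \/ w = w3.
    move=> ws; have := WE w (vs w ws); rewrite !in_cons orbF => /or3P[]/eqP ww;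
      [|by left|by right].
    by rewrite -ww ws in v0s.
  have [i1 i2 i3] : [/\ v1 \in [:: v1, x, y & s], x \in [:: v1, x, y & s] & y \in [:: v1, x,
    y & s]].
    by rewrite !inE !eqxx ?orbT.
  have vx : v1 != x by apply: contraNneq v1n => ->; rewrite mem_head.
  have vy : v1 != y by apply: contraNneq v1n => ->; rewrite inE mem_head orbT.
  have xy : x != y by apply: contraNneq xn => ->; rewrite mem_head.
  by case: (in23 v1 i1) vx vy => ->; case: (in23 x i2) xy => ->; case: (in23 y i3) => ->;
    rewrite eqxx.
rewrite sx in ps v0s RE E2 vs in2 w2s w3s.
case: ps => v1x [e We Ee] _.
have [v1s xs] : v1 \in [:: v1; x] /\ x \in [:: v1; x] by rewrite !inE !eqxx orbT.
have [v1W xW] := (vs v1 v1s, vs x xs).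
have sy (a b : vertex G) : a != b -> (a == b = false) * (b == a = false).
  by move=> ab; rewrite [b == a]eq_sym (negPf ab).
have nv : v1 != x by move: v1x; rewrite inE.
have [nw1 nwx] : w1 != v1 /\ w1 != x by move: v0s; rewrite !inE negb_or => /andP[].
have ne w : w \in A :\: D -> w != u by case/setDP => _ wD; apply: contraNneq wD => ->.
have neE := (sy _ _ nv, sy _ _ nw1, sy _ _ nwx, sy _ _ (ne _ w1W), sy _ _ (ne _ v1W),
  sy _ _ (ne _ xW)).
have spu w : w \in A :\: D -> ends (m w) = [set w; u].
  by move=> wW; have [_ _ -> _] := sp w wW; rewrite tu.
pose B1 := v1 |: [set x]; pose B2 := w1 |: B1; pose B3 := u |: B2.
have B1E : [set y in [:: v1; x]] = B1 by apply/setP => y; rewrite !inE.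
have B2E : A :\: D = B2 by rewrite RE B1E.
have AE : A = B3.
  by rewrite /B3 -B2E -{1}(setID A D) (setIidPr DA) {1}DE.
have um' : uniq [:: m w1; m v1; m x].
  have inj w w' : w \in A :\: D -> w' \in A :\: D -> w != w' -> m w != m w'.
    by move=> wW wW' ww; apply: contraNneq ww => /(spoke_inj sp wW wW')->.
  by rewrite /= !inE negb_or !inj.
have Iu' : within A u =i [:: m w1; m v1; m x].
  by apply: within_card3 um' _ _ _; [exact: cu|case/setDP: (mu w1 w1W uE)|
    case/setDP: (mu v1 v1W (tu v1 v1W))|case/setDP: (mu x xW (tu x xW))].
(* Two opposite edges of K4, [e] and the spoke of [w1], share [a1], and the other four edges get the
   four other colors; each palette is [a1] with a different pair. *)
pose a1 : color := Some (false, false); pose a2 : color := Some (false, true).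
pose a3 : color := Some (true, false); pose a4 : color := Some (true, true).
pose Q0 := [:: (e, x, a1); (g2, x, a4); (m x, x, a2)].
have p0 : palette [set x] (half Q0) (fun=> None) x = [set y in [:: a1; a4; a2]].
  rewrite /palette within_set1 imset0 set0U; apply/setP => y.
  by rewrite !inE /= eqxx /= orbF ![y == _]eq_sym.
pose M1 := [:: (g2, x, a4); (m x, x, a2)].
pose N1 := [:: (g1, v1, a3); (m v1, v1, None : color)].
have x1 : v1 \notin [set x] by rewrite inE neE.
have x2 : w1 \notin B1 by rewrite !inE !neE.
have x3 : u \notin B2 by rewrite !inE !neE.
have [|||||||||c1 [V1 q1 r1]] := @add_root_list G B1 [set x] v1 (fun=> None) [:: (e, x, a1)]
  M1 N1
  Q0 (N1 ++ M1) erefl x1 (fun=> erefl) (fun=> erefl).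
- by [].
- by [].
- by move=> f; rewrite -B1E We !inE.
- by move=> q; rewrite inE => /eqP->.
- by apply/allP; rewrite /= !eqxx.
- by apply/allP; rewrite /= !neE.
- by apply/allP; rewrite /= !inE /= !eqxx.
- exact: valid_set1.
- by apply/allP; rewrite /= p0 escapes_neq.
pose M2 := [:: (m x, x, a2); (m v1, v1, None : color)].
pose L2 := [:: (g1, v1, a3); (g2, x, a4)].
pose Q2 := [:: (m w1, w1, a1); (m x, x, a2); (m v1, v1, None : color)].
have [xB1 v1B1] : x \in B1 /\ v1 \in B1 by rewrite !inE !eqxx orbT.
have [||||||||||c2 [V2' q2 r2]] := @add_root_list G B2 B1 w1 c1 L2 M2 [:: (m w1, w1, a1)]
  (N1 ++ M1) Q2 erefl x2 _ (fun=> erefl).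
- by move=> q; rewrite !inE; do ?[case: (q == _) => //].
- by rewrite /= inE g12.
- by [].
- by move=> f; rewrite -B2E Wv0 !inE.
- by move=> q; rewrite !inE => /orP[]/eqP->.
- by apply/allP; rewrite /= !eqxx.
- by apply/allP; rewrite /= !neE.
- by apply/allP; rewrite /= !inE /= !neE !eqxx.
- exact: V1.
- by apply/allP; rewrite /= q1 r1 ?set11 // p0 !escapes_neq.
have [xB2 v1B2 w1B2] : [/\ x \in B2, v1 \in B2 & w1 \in B2] by rewrite !inE !eqxx !orbT.
have [||||||||||c3 [V3 _ _]] := @add_root_list G B3 B2 u c2
  [:: (m w1, w1, a1); (m v1, v1, None : color); (m x, x, a2)] [::] [::] Q2 [::]
    erefl x3 _ (fun=> erefl).
- by move=> q; rewrite !inE; do ?[case: (q == _) => //].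
- exact: um'.
- by [].
- by move=> f; rewrite -AE Iu'.
- by move=> q; rewrite !inE => /or3P[]/eqP-> /=; rewrite setUC; apply: spu.
- by [].
- by [].
- by apply/allP; rewrite /= !inE.
- exact: V2'.
- apply/allP; rewrite /= q2 !r2 // q1 r1 ?set11 // p0 !escapes_neq //.
by exists c3; rewrite AE; apply: valid_ext V3 => v _; rewrite half_nil.
Qed.

Lemma cubic_valid A : conn A -> cubic A -> 3 < #|A| -> exists c, valid A (fun=> set0) c.
Proof.
move=> cA cu A3; have [D mc] := max_core_exists cu A3.
have [m [t sp]] := spokes_exist cA cu mc.
have [_ _ /set0Pn[v0 v0W]] := max_core_ring cA cu mc.
have dec X : {in X &, injective t} \/ exists x y, [/\ x \in X, y \in X, x != y & t x = t y].
  have [/forall_inP h|] := boolP [forall x in X, [forall y in X, (t x == t y) ==> (x == y)]].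
    left=> x y xX yX txy; have /forall_inP/(_ y yX) := h x xX.
    by rewrite txy eqxx => /eqP.
  rewrite negb_forall => /existsP[x]; rewrite negb_imply => /andP[xX].
  rewrite negb_forall => /existsP[y]; rewrite negb_imply => /andP[yX].
  by rewrite negb_imply => /andP[/eqP txy xy]; right; exists x, y.
have sub1 v w : w \in (A :\: D) :\ v -> w != v /\ w \in A :\: D by move/setD1P.
have [tI|[w1 [w2 [w1W w2W n12 t12]]]] := dec (A :\: D).
  apply: (close_single cA cu mc sp v0W) => x y /sub1[_ xW] /sub1[_ yW]; exact: tI.
(* Cutting the cycle at [w1] resolves a single coincidence of feet; a second one either involves the
   same foot or gives a second pair. *)
have [tI|[w3 [w4 [/sub1[n31 w3W] /sub1[n41 w4W] n34 t34]]]] := dec ((A :\: D) :\ w1).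
  exact: (close_single cA cu mc sp w1W).
have [t31|t31] := eqVneq (t w3) (t w1).
  apply: (triple_spoke_valid cA cu mc sp (w1 := w1) (w2 := w3) (w3 := w4)) => //.
  - by rewrite /= !inE negb_or eq_sym n31 eq_sym n41 n34.
  - by move=> w; rewrite !in_cons orbF => /or3P[]/eqP->.
  - by rewrite -t34.
have n3 : w3 != w2 by apply: contraNneq t31 => ->; rewrite t12.
have n4 : w4 != w2 by apply: contraNneq t31 => E; rewrite t34 E t12.
apply: (double_spokes_valid cA cu mc sp (w1 := w1) (w2 := w2) (w3 := w3) (w4 := w4)) => //.
- by rewrite /= !inE !negb_or n12 ![w1 == _]eq_sym ![w2 == _]eq_sym n31 n41 n3 n4 n34.
- by move=> w; rewrite !in_cons orbF => /or4P[]/eqP->.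
Qed.

(** The handshake identity makes the order even, and order two would be a triple edge. *)
Lemma cubic_order A : conn A -> cubic A -> A != set0 -> multiplicity_le G 2 -> 3 < #|A|.
Proof.
move=> cA cu /set0Pn[v vA] mult; have := handshake A.
rewrite (eq_bigr (fun=> 3)) => [|x /cu //]; rewrite sum_nat_const => A3.
have A0 : 0 < #|A| by apply/card_gt0P; exists v.
rewrite ltnNge; apply/negP => A4.
have /eqP/cards2P[x [y [xy AE]]] : #|A| = 2.
  by move: (edge_count A) #|A| A3 A0 A4; clear => i n; lia.
have xA : x \in A by rewrite AE set21.
have := mult x y; rewrite leqNgt => /negP; apply.
rewrite -(cu x xA); apply/subset_leq_card/subsetP => e; rewrite inE AE => /andP[_ eA].
by rewrite inE eqEcard eA card_ends cards2 xy.
Qed.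

Lemma valid_exists A : multiplicity_le G 2 -> (forall v, degree v <= 3) ->
  exists c, valid A (fun=> set0) c.
Proof.
move=> mult d3; have [n] := ubnP #|A|; elim: n A => // n IH A An.
have degle v : deg A v <= 3.
  by apply: leq_trans (d3 v); apply/subset_leq_card/subsetP => e; rewrite !inE => /andP[].
have [A0|A0] := eqVneq A set0.
  by exists (fun=> None); rewrite A0; split=> [v|v w]; rewrite inE.
have [cA|/connPn[B [BA B0 BnA nB]]] := boolP (conn A).
  have [/exists_inP[r rA dr]|] := boolP [exists r in A, deg A r <= 2].
    have fA : fits A set0 r by split=> // [v vA|]; rewrite inE addn0.
    have [c [z [V _]]] := extends_fits fA; exists c.
    (* The half-edge at r is dropped; r is then left with at most two colors and needs no
       comparison. *)
    apply: valid_ext (set_half (u := r) (H := set0) rA V _ _).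
    - by move=> v _ /=; rewrite /rooted /promise inE set0U; case: eqP.
    - by rewrite disjoint_sym disjoints_subset sub0set.
    - move=> v _ _; rewrite setU0 => c3.
      by have := leq_trans (leq_imset_card c (mem (within A r))) dr; rewrite c3.
  rewrite negb_exists_in => /forall_inP dA; apply: cubic_valid => //.
    by move=> v vA; apply/eqP; rewrite eqn_leq degle ltnNge dA.
  apply: cubic_order => // v vA; apply/eqP; rewrite eqn_leq degle ltnNge dA //.
have [B' B'E] : exists B', B' = A :\: B by exists (A :\: B).
have AE : B :|: B' = A by rewrite B'E -{1}(setIidPr BA) setID.
have lt (X : {set vertex G}) : X \subset A -> X != A -> #|X| < n.
  by move=> XA XnA; rewrite -ltnS; apply: leq_trans An;
    rewrite ltnS proper_card // properEneq XnA.
have [c1 V1] := IH B (lt B BA BnA).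
have [|c2 V2] := IH B'.
  apply: lt; first by rewrite B'E subsetDl.
  apply: contraNneq B0 => E; rewrite -subset0; apply/subsetP => x xB.
  by have := subsetP BA x xB; rewrite -E B'E inE xB.
have cr1 v : v \in B -> within A v :\: within B v = set0.
  move=> vB; apply/setP => e; rewrite [RHS]in_set0; apply/negP => /setDP[eA eB].
  have ve : v \in ends e by move: eA; rewrite inE => /andP[].
  have [w [wv Ee]] := other_end ve; have [_ wA] := within_other (subsetP BA v vB) eA Ee.
  have [wB|wB] := boolP (w \in B); first by case/negP: eB; apply: within_pair Ee.
  by have /negP[] := nB v w vB wA wB; apply/adjacentP; exists e.
have cr2 v : v \in B' -> within A v :\: within B' v = set0.
  rewrite B'E => /setDP[vA vB]; apply/setP => e; rewrite [RHS]in_set0.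
  apply/negP => /setDP[eA eB].
  have ve : v \in ends e by move: eA; rewrite inE => /andP[].
  have [w [wv Ee]] := other_end ve; have [_ wA] := within_other vA eA Ee.
  have [wB|wB] := boolP (w \in B); last first.
    by case/negP: eB; apply: within_pair Ee; rewrite inE ?vA ?vB ?wA ?wB.
  by have /negP[] := nB w v wB vA vB; apply/adjacentP; exists e; rewrite setUC.
have dis : [disjoint B & B'] by rewrite B'E disjoint_sym disjoints_subset setDE subsetIr.
have [|||||||c [V _ _]] := @glue G B B' (fun=> set0) (fun=> set0) c1 c2 (fun=> None) dis V1 V2;
  rewrite ?AE.
- by move=> v vB; rewrite cr1 // imset0 setU0.
- by move=> v vB; rewrite cr2 // imset0 setU0.
- by move=> v vB; rewrite cr1 // => e f; rewrite inE.
- by move=> v vB; rewrite cr2 // => e f; rewrite inE.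
- by move=> v vB; rewrite disjoint_sym disjoints_subset sub0set.
- by move=> v vB; rewrite disjoint_sym disjoints_subset sub0set.
- move=> v w vB; rewrite B'E => /setDP[wA wB] vw.
  by have := nB v w vB wA wB; rewrite vw.
by exists c; rewrite -AE.
Qed.

Lemma kint_coloring_exists : multiplicity_le G 2 -> (forall v, degree v <= 3) ->
  exists c : edge G -> 'I_5, kint_edge_coloring c 2.
Proof.
move=> mult d3; have [c [V1 V2]] := valid_exists setT mult d3.
have c5 : #|{: color}| = 5 by rewrite card_option card_prod card_bool.
pose g (x : color) : 'I_5 := cast_ord c5 (enum_rank x).
have gI : injective g by move=> x y /cast_ord_inj/enum_rank_inj.
have wT v : within setT v = incident v by apply/setP => e; rewrite !inE subsetT andbT.
exists (g \o c); apply/andP; split.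
  apply/forallP => e; apply/forallP => f; apply/implyP => ef; apply/implyP.
  move=> /pred0Pn[v /= /andP[ve vf]]; rewrite (inj_eq gI).
  have [i _] := V1 v (in_setT v); apply: contra ef => /eqP E; apply/eqP.
  by apply: i; rewrite // wT inE.
have pE v : colors_at (g \o c) v = g @: palette setT (fun=> set0) c v.
  by rewrite /colors_at imset_comp /palette setU0 wT.
apply/forallP => u; apply/forallP => v; apply/implyP => uv.
rewrite !pE -imsetI; last by move=> x y _ _ /gI.
(* Three common colors force both palettes, of size at most three, to equal their intersection. *)
rewrite card_imset // leqNgt; apply/negP => c3.
have le3 w : #|palette setT (fun=> set0) c w| <= 3.
  apply: leq_trans (palette_card _ _ _ _) _; rewrite cards0 addn0 /deg wT; exact: d3.
have uI := subsetIl (palette setT (fun=> set0) c u) (palette setT (fun=> set0) c v).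
have vI := subsetIr (palette setT (fun=> set0) c u) (palette setT (fun=> set0) c v).
have eu : palette setT (fun=> set0) c u :&: palette setT (fun=> set0) c v ==
    palette setT (fun=> set0) c u by rewrite eqEcard uI (leq_trans (le3 u)).
have ev : palette setT (fun=> set0) c u :&: palette setT (fun=> set0) c v ==
    palette setT (fun=> set0) c v by rewrite eqEcard vI (leq_trans (le3 v)).
have u3 : #|palette setT (fun=> set0) c u| = 3.
  by apply/eqP; rewrite eqn_leq le3 (leq_trans c3) ?subset_leq_card.
have := V2 u v (in_setT u) (in_setT v) uv u3.
by move: eu ev => /eqP E /eqP <-; rewrite E eqxx.
Qed.

End Existence.

From mathcomp Require Import all_boot all_order all_algebra.
From mathcomp Require Import all_classical all_reals all_analysis.

Theorem theorem1 (R : realType) (G : multigraph)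
    (Gsubcubic : subcubic G) (Gplanar : planar R G)
    (Gmult : multiplicity_le G 2) :
  kint_chromatic_index G 2 Gmult <= 5.
Proof.
apply/kint_chromatic_index_le; apply: kint_coloring_exists => // v.
by apply: leq_trans (leq_bigmax v) Gsubcubic.
Qed.
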